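(* Let $X$ be a Banach space and let $\Gamma:[0,1]\to cwk(X)$ be a multifunction such that: (1) $\Gamma$ is Bochner measurable; (2) $\Gamma$ is Henstock–Kurzweil–Pettis (HKP) integrable; (3) the variational measure $V_\Phi$ associated to the primitive $\Phi$ of $\Gamma$ is $\lambda$-continuous. Then $\Gamma$ can be decomposed as a sum $\Gamma=f+G$, where $f$ is any strongly measurable selection of $\Gamma$ and $G$ is a variationally Henstock and Birkhoff integrable multifunction. That is, $\Gamma$ admits a strongly measurable selection, and for every strongly measurable selection $f$ of $\Gamma$ there is a multifunction $G:[0,1]\to cwk(X)$ which is both variationally Henstock integrable and Birkhoff integrable and satisfies $\Gamma(t)=G(t)+f(t)$ for every $t\in[0,1]$.
   Context: $\lambda$ is Lebesgue measure on $[0,1]$, $\mathcal{L}$ the family of Lebesgue measurable subsets of $[0,1]$, $\mathcal{I}$ the collection of closed subintervals of $[0,1]$, $|I|=\lambda(I)$. $X$ is an arbitrary (real) Banach space with dual $X^*$. $cwk(X)$ is the family of nonempty convex weakly compact subsets of $X$, with Minkowski addition, multiplication by scalars and the Hausdorff distance $d_H$; $\|A\|:=d_H(A,\{0\})=\sup\{\|x\|:x\in A\}$. For $C\in cwk(X)$, $s(x^*,C)=\sup\{\langle x^*,x\rangle:x\in C\}$. For $A\in cwk(X)$, $x\in X$, $A+x:=\{a+x:a\in A\}$. A multifunction $\Gamma:[0,1]\to cwk(X)$ is Bochner measurable if there are simple multifunctions $\Gamma_n:[0,1]\to cwk(X)$ with $\lim_n d_H(\Gamma_n(t),\Gamma(t))=0$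 for almost all $t$. A function $f:[0,1]\to X$ is strongly measurable if it is the almost everywhere norm limit of a sequence of simple measurable functions. A selection of $\Gamma$ is a function $f:[0,1]\to X$ with $f(t)\in\Gamma(t)$ for every $t\in[0,1]$. $\Gamma$ is HKP-integrable if $s(x^*,\Gamma)$ is Henstock–Kurzweil integrable for each $x^*\in X^*$ and for each $I\in\mathcal{I}$ there is $w_I\in cwk(X)$ with $s(x^*,w_I)=(HK)\int_I s(x^*,\Gamma(t))\,dt$ for all $x^*\in X^*$; its primitive is $\Phi(I):=w_I$. A Perron partition in $[0,1]$ is a finite collection $\{(I_1,t_1),\dots,(I_p,t_p)\}$ of nonoverlapping closed subintervals $I_i$ of $[0,1]$ with $t_i\in I_i$; it is a Perron partition of $[0,1]$ if moreover $\bigcup_i I_i=[0,1]$. A gauge is a positive function $\delta$ on $[0,1]$; the partition is $\delta$-fine if $I_i\subset(t_i-\delta(t_i),t_i+\delta(t_i))$ for all $i$. A map $\Phi:\mathcal{I}\to cwk(X)$ is (finitely) additive if $\Phi(I_1\cup I_2)=\Phi(I_1)+\Phi(I_2)$ for nonoverlapping $I_1,I_2\in\mathcal{I}$ with $I_1\cup I_2\in\mathcal{I}$. Its variational measure is, for $E\subset[0,1]$, $V_\Phi(E)=\inf_\delta\sup\sum_i\|\Phi(I_i)\|$, the infimum being over gauges $\delta$ and the supremum over all $\delta$-fine Perron partitions $\{(I_i,t_i)\}$ in $[0,1]$ with all $t_i\in E$. $V_\Phi$ is $\lambda$-continuous if $V_\Phi(E)=0$ whenever $\lambda(E)=0$.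 $\Gamma$ is variationally Henstock integrable on $[0,1]$ if there is an additive $\Phi_\Gamma:\mathcal{I}\to cwk(X)$ such that for every $\varepsilon>0$ there is a gauge $\delta$ on $[0,1]$ with $\sum_{i=1}^p d_H(\Phi_\Gamma(I_i),\Gamma(t_i)|I_i|)<\varepsilon$ for each $\delta$-fine Perron partition $\{(I_1,t_1),\dots,(I_p,t_p)\}$ of $[0,1]$. $\Gamma$ is Birkhoff integrable on $[0,1]$ if there is $\Phi_\Gamma([0,1])\in cwk(X)$ such that for every $\varepsilon>0$ there is a countable partition $\Pi_0$ of $[0,1]$ in $\mathcal{L}$ such that for every countable partition $\Pi=(A_n)_n$ of $[0,1]$ in $\mathcal{L}$ finer than $\Pi_0$ and any choice of points $t_n\in A_n$, the series $\sum_n\lambda(A_n)\Gamma(t_n)$ is unconditionally convergent in the Hausdorff metric and $d_H(\Phi_\Gamma([0,1]),\sum_n\Gamma(t_n)\lambda(A_n))<\varepsilon$. *)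

(* Defs.v *)
From HB Require Import structures.
From mathcomp Require Import all_boot all_order all_algebra.
From mathcomp Require Import all_classical all_reals all_analysis.

Set Implicit Arguments.
Unset Strict Implicit.
Unset Printing Implicit Defensive.

Import Order.TTheory GRing.Theory Num.Theory.
Import numFieldNormedType.Exports.

Local Open Scope classical_set_scope.
Local Open Scope ring_scope.

(* Functions and multifunctions on [0,1] are total functions on R of which only
   the values on [0,1] matter; interval functions I |-> Phi(I) are functions
   Phi : R -> R -> _ of the two end points. *)

Section Lebesgue.
Context {R : realType}.

(* The library's completed Lebesgue measure is defined on the Caratheodory
   sigma-algebra, i.e. on the Lebesgue measurable sets. *)
Definition lambda := @completed_lebesgue_measure R.

Definition lebesgue_measurable (A : set R) : Prop :=
  measurable (A : set (caratheodory_type (wlength (idfun : R -> R))^*%mu)).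

Definition simple01 (T : Type) (g : R -> T) : Prop :=
  finite_set (g @` `[0, 1]%classic) /\
  forall c : T, lebesgue_measurable (`[0, 1]%classic `&` g @^-1` [set c]).

End Lebesgue.

Section PerronPartitions.
Context {R : realType}.

(* (l, r, t) stands for the pair ([l, r], t). *)
Definition lft (p : R * R * R) : R := p.1.1.
Definition rgt (p : R * R * R) : R := p.1.2.
Definition tagpt (p : R * R * R) : R := p.2.
Definition itv_length (p : R * R * R) : R := rgt p - lft p.

Definition nonoverlapping (p q : R * R * R) : bool :=
  (rgt p <= lft q) || (rgt q <= lft p).

(* Intervals are nondegenerate: a one-point interval would contribute nothing
   to any of the sums below. *)
Definition perron_in (a b : R) (P : seq (R * R * R)) : Prop :=
  (forall p : R * R * R, p \in P ->
     [/\ a <= lft p, lft p < rgt p, rgt p <= b & lft p <= tagpt p <= rgt p]) /\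
  pairwise nonoverlapping P.

Definition perron_of (a b : R) (P : seq (R * R * R)) : Prop :=
  perron_in a b P /\
  \bigcup_(p in [set` P]) `[lft p, rgt p]%classic = `[a, b]%classic.

Definition gauge (a b : R) (delta : R -> R) : Prop :=
  forall t, a <= t <= b -> 0 < delta t.

Definition fine_partition (delta : R -> R) (P : seq (R * R * R)) : Prop :=
  forall p : R * R * R, p \in P ->
    `[lft p, rgt p]%classic `<=`
    `]tagpt p - delta (tagpt p), tagpt p + delta (tagpt p)[%classic.

Definition is_HK_integral (a b : R) (g : R -> R) (v : R) : Prop :=
  forall eps : R, 0 < eps -> exists delta, gauge a b delta /\
    forall P, perron_of a b P -> fine_partition delta P ->
      `|\sum_(p <- P) g (tagpt p) * itv_length p - v| < eps.

Definition HK_integrable (a b : R) (g : R -> R) : Prop :=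
  exists v, is_HK_integral a b g v.

End PerronPartitions.

Section Sets.
Context {R : realType} {X : completeNormedModType R}.

Definition dual : Type := {x' : {linear X -> R^o} | continuous x'}.

Definition pairing (x' : dual) (x : X) : R := sval x' x.

Definition weak_space : Type :=
  sup_topology
    (fun x' : dual => Topological.on (initial_topology (sval x' : X -> R^o))).
HB.instance Definition _ := Topological.on weak_space.

Definition weakly_compact (A : set X) : Prop := @compact weak_space A.

Definition cwk (A : set X) : Prop :=
  [/\ A !=set0, convex_set A & weakly_compact A].

Definition mink_add (A B : set X) : set X := [set a + b | a in A & b in B].
Definition mink_scale (r : R) (A : set X) : set X := [set r *: a | a in A].

Definition hausdorff_dist (A B : set X) : \bar R :=
  maxe (ereal_sup [set ereal_inf [set `|a - b|%:E | b in B] | a in A])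
       (ereal_sup [set ereal_inf [set `|a - b|%:E | a in A] | b in B]).

Definition set_norm (A : set X) : \bar R := hausdorff_dist A [set 0].

(* The real supremum is adequate because elements of cwk X are nonempty and
   bounded. *)
Definition support_fun (x' : dual) (C : set X) : R := sup (pairing x' @` C).

End Sets.
Arguments dual {R} X.
Arguments weak_space {R} X.

Section Multifunctions.
Context {R : realType} {X : completeNormedModType R}.
Implicit Types (Gamma : R -> set X) (Phi : R -> R -> set X) (f : R -> X).

Definition multifunction Gamma : Prop := forall t, 0 <= t <= 1 -> cwk (Gamma t).

Definition bochner_measurable Gamma : Prop :=
  exists Gamma_ : nat -> R -> set X,
    (forall n, multifunction (Gamma_ n) /\ simple01 (Gamma_ n)) /\
    {ae lambda, forall t : R, 0 <= t <= 1 ->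
       hausdorff_dist (Gamma_ n t) (Gamma t) @[n --> \oo] --> 0%E}.

Definition strongly_measurable f : Prop :=
  exists f_ : nat -> R -> X,
    (forall n, simple01 (f_ n)) /\
    {ae lambda, forall t : R, 0 <= t <= 1 -> f_ n t @[n --> \oo] --> f t}.

Definition selection Gamma f : Prop := forall t, 0 <= t <= 1 -> Gamma t (f t).

Definition HKP_integrable Gamma : Prop :=
  (forall x' : dual X,
     HK_integrable 0 1 (fun t => support_fun x' (Gamma t))) /\
  forall a b : R, 0 <= a -> a < b -> b <= 1 ->
    exists w : set X, cwk w /\ forall x' : dual X,
      is_HK_integral a b (fun t => support_fun x' (Gamma t))
                     (support_fun x' w).

Definition HKP_primitive Gamma Phi : Prop :=
  forall a b : R, 0 <= a -> a < b -> b <= 1 ->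
    cwk (Phi a b) /\ forall x' : dual X,
      is_HK_integral a b (fun t => support_fun x' (Gamma t))
                     (support_fun x' (Phi a b)).

Definition variational_measure Phi (E : set R) : \bar R :=
  ereal_inf
    [set ereal_sup
       [set (\sum_(p <- P) set_norm (Phi (lft p) (rgt p)))%E
         | P in [set P | [/\ perron_in 0 1 P, fine_partition delta P
                           & forall p : R * R * R, p \in P -> E (tagpt p)]]]
      | delta in gauge 0 1].

Definition lambda_continuous (V : set R -> \bar R) : Prop :=
  forall E : set R, E `<=` `[0, 1]%classic -> lebesgue_measurable E ->
    lambda E = 0%E -> V E = 0%E.

Definition additive_itv Phi : Prop :=
  forall a b c : R, 0 <= a -> a < b -> b < c -> c <= 1 ->
    Phi a c = mink_add (Phi a b) (Phi b c).

Definition variationally_henstock_integrable Gamma : Prop :=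
  exists Phi,
    [/\ forall a b : R, 0 <= a -> a < b -> b <= 1 -> cwk (Phi a b),
        additive_itv Phi &
        forall eps : R, 0 < eps -> exists delta, gauge 0 1 delta /\
          forall P, perron_of 0 1 P -> fine_partition delta P ->
            (\sum_(p <- P) hausdorff_dist (Phi (lft p) (rgt p))
               (mink_scale (itv_length p) (Gamma (tagpt p))) < eps%:E)%E].

(* Countable partitions are sequences; finite ones are padded with empty
   blocks. *)
Definition countable_partition (A : nat -> set R) : Prop :=
  [/\ forall n, lebesgue_measurable (A n), trivIset setT A
    & \bigcup_n A n = `[0, 1]%classic].

Definition finer (A B : nat -> set R) : Prop :=
  forall n, exists m, A n `<=` B m.

(* An empty block gets an arbitrary point of [0,1], so that its term in the
   series below is {0}. *)
Definition choice_of_points (A : nat -> set R) (t : nat -> R) : Prop :=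
  forall n, 0 <= t n <= 1 /\ (A n !=set0 -> A n (t n)).

Definition hausdorff_series (C : nat -> set X) (S : set X) : Prop :=
  cwk S /\
  hausdorff_dist (\big[mink_add/[set 0]]_(k < n) C k) S @[n --> \oo] --> 0%E.

Definition unconditionally_convergent (C : nat -> set X) : Prop :=
  forall s : nat -> nat, bijective s ->
    exists S, hausdorff_series (fun k => C (s k)) S.

Definition birkhoff_integrable Gamma : Prop :=
  exists W : set X, cwk W /\
    forall eps : R, 0 < eps -> exists A0, countable_partition A0 /\
      forall A t, countable_partition A -> finer A A0 ->
        choice_of_points A t ->
        let C n := mink_scale (fine (lambda (A n))) (Gamma (t n)) in
        unconditionally_convergent C /\
        exists S, hausdorff_series C S /\ (hausdorff_dist W S < eps%:E)%E.

End Multifunctions.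

(* Main.v *)
Require Import Defs.
From HB Require Import structures.
From mathcomp Require Import all_boot all_order all_algebra.
From mathcomp Require Import all_classical all_reals all_analysis measurable_realfun.
From mathcomp Require Import ring lra.

Set Implicit Arguments.
Unset Strict Implicit.
Unset Printing Implicit Defensive.

Import Order.TTheory GRing.Theory Num.Theory.
Import numFieldNormedType.Exports.

Local Open Scope classical_set_scope.
Local Open Scope ring_scope.

(** A strongly measurable selection f exists because Gamma is close to
    countably valued multifunctions off a null set (measurable_selection).  Given
    any such f, the multifunction G = Gamma - f (translate) has values containing
    the origin, so that all its support functions are nonnegative.  This
    turns conditional integrability into absolute integrability.

    For every functional u the support function of G is nonnegative and dominated
    by an integrable function, hence integrable.  So f is integrable against
    u, with an integral that is linear in u and at most support_fun u (Phi a b); by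
    weak compactness of Phi a b this functional of u is the evaluation at a point
    z a b of Phi a b (representation, selection_integral).  The sets
    Phi a b - z a b (primitive) are the integrals of G; they contain
    the origin, increase with the interval, and have norm at most twice that of
    Phi a b, so that their variation vanishes on null sets.

    The distance of convex weakly compact sets is the supremum of the differences
    of their support functions over the dual ball (hausdorff_leP).  The
    integrability of G thus concerns the family of nonnegative functions
    t |-> support_fun u (G t), u in the dual ball, and all estimates have to be
    uniform in u, even when u varies from one tagged interval to another.
    Measurability of G and f gives countable measurable partitions on whose
    pieces, negligible ones excepted, the whole family oscillates arbitrarily
    little (oscillation_partition).

    Variational Henstock integrability is henstock_error_small.  Null sets
    contribute nothing, and the other pieces are exhausted by closed sets A.
    If u-integrals are compared with values taken on A, the error comes from the
    gaps of A only (gap_estimate).  By Baire's theorem, applied on a comeagre null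
    subset of A where the variation of the primitive vanishes, the gaps have
    finite total weight near some point (gap_sums_bounded); a finite number of
    gaps can be avoided by the gauge and the others have small weight.  Hence the
    points near which the error does not have null variation cannot form a
    nonempty closed set.

    Birkhoff integrability follows: a single gauge serves for all u,
    and one partition fine for it has finitely many tags, so that finitely many
    pieces carry almost all of every integral.  This makes the family uniformly
    integrable (uniformly_integrable); the series of scaled values over a
    partition finer than one with small oscillation then have uniformly small
    tails (sum_points_tail) and sums close to the integral.  Since the
    terms contain the origin, the partial sums increase, and an increasing Cauchy
    sequence of convex weakly compact sets has a limit of the same kind
    (cwk_limit). *)

(** * Perron partitions and the Henstock-Kurzweil integral *)

Lemma inv_nat_gt0 (R : realType) (n : nat) : 0 < n.+1%:R^-1 :> R.
Proof. by rewrite invr_gt0. Qed.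

Lemma inv_nat_small (R : realType) (e : R) : 0 < e -> exists n : nat, n.+1%:R^-1 < e.
Proof. by move=> e0; exists (Num.truncn e^-1); rewrite invf_plt ?posrE // truncnS_gt. Qed.

Lemma perm_pairwise (T : eqType) (r : rel T) (s t : seq T) :
  symmetric r -> perm_eq s t -> pairwise r s -> pairwise r t.
Proof.
move=> rC; elim: s t => [|x s IH] t st; first by move: st; rewrite perm_sym => /perm_nilP ->.
have xt : x \in t by rewrite -(perm_mem st) mem_head.
case/splitPr: xt st => t1 t2; rewrite perm_sym perm_catC /= perm_cons perm_catC perm_sym.
move=> st /= /andP[xs /(IH _ st)].
rewrite !pairwise_cat /= => /and3P[a12 -> ->]; rewrite !andbT.
move: xs; rewrite (eq_all_r (perm_mem st)) all_cat => /andP[x1 ->].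
rewrite /= andbT; apply/allrelP => y z yt1; rewrite inE => /predU1P[->|zt2].
  by rewrite rC; exact: (allP x1).
exact: (allrelP a12).
Qed.

Section PerronPartitions.
Context {R : realType}.
Implicit Types (a b c : R) (P Q : seq (R * R * R)) (F : R -> R -> R).

Lemma nonoverlapping_sym : symmetric (@nonoverlapping R).
Proof. by move=> p q; rewrite /nonoverlapping orbC. Qed.

Lemma perron_in_perm a b P Q :
  perm_eq P Q -> perron_in a b P -> perron_in a b Q.
Proof.
move=> PQ [mP oP]; split=> [p|].
  by rewrite -(perm_mem PQ); exact: mP.
exact: perm_pairwise nonoverlapping_sym PQ oP.
Qed.

Lemma perron_of_perm a b P Q :
  perm_eq P Q -> perron_of a b P -> perron_of a b Q.
Proof.
move=> PQ [inP cP]; split; first exact: perron_in_perm PQ inP.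
rewrite -cP; congr bigcup; apply/seteqP; split=> p /=;
  by rewrite (perm_mem PQ).
Qed.

Lemma perron_in_filter a b P (q : pred (R * R * R)) :
  perron_in a b P -> perron_in a b [seq p <- P | q p].
Proof.
move=> [mP oP]; split=> [p|]; last exact: pairwise_filter.
by rewrite mem_filter => /andP[_]; exact: mP.
Qed.

Lemma perron_in_cat a b c P Q : a <= b -> b <= c ->
  perron_in a b P -> perron_in b c Q -> perron_in a c (P ++ Q).
Proof.
move=> ab bc [mP oP] [mQ oQ]; split=> [p|].
  rewrite mem_cat => /orP[/mP[h1 h2 h3 h4]|/mQ[h1 h2 h3 h4]]; split => //; lra.
rewrite pairwise_cat oP oQ !andbT; apply/allrelP => p q /mP[_ _ pb _] /mQ[bq _ _ _].
by rewrite /nonoverlapping (le_trans pb bq).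
Qed.

Lemma perron_of_cat a b c P Q : a <= b -> b <= c ->
  perron_of a b P -> perron_of b c Q -> perron_of a c (P ++ Q).
Proof.
move=> ab bc [iP cP] [iQ cQ]; split; first exact: perron_in_cat iP iQ.
have -> : [set` P ++ Q] = [set` P] `|` [set` Q].
  by apply/seteqP; split=> p /=; rewrite mem_cat => /orP.
rewrite bigcup_setU cP cQ; apply/seteqP; split=> x /=; rewrite !in_itv /=.
  by case=> /andP[h1 h2]; lra.
by move=> /andP[h1 h2]; case: (leP x b) => xb; [left|right]; lra.
Qed.

Lemma perron_of1 a b t : a < b -> a <= t <= b -> perron_of a b [:: (a, b, t)].
Proof.
move=> ab atb; split.
  by split=> // p; rewrite inE => /eqP ->; rewrite /lft /rgt /tagpt /=; split.
rewrite -[RHS](bigcup_set1 (fun p : R * R * R => `[lft p, rgt p]%classic) (a, b, t)).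
by congr bigcup; apply/seteqP; split=> p /=; rewrite inE => /eqP.
Qed.

Lemma fine_partition_cat delta P Q : fine_partition delta (P ++ Q) <->
  fine_partition delta P /\ fine_partition delta Q.
Proof.
split=> [fPQ|[fP fQ] p].
  by split=> p hp; apply: fPQ; rewrite mem_cat hp ?orbT.
by rewrite mem_cat => /orP[/fP|/fQ].
Qed.

Lemma fine_partition_le delta delta' P :
  (forall p, p \in P -> delta (tagpt p) <= delta' (tagpt p)) ->
  fine_partition delta P -> fine_partition delta' P.
Proof.
move=> dd' fP p hp x /(fP _ hp); rewrite /= !in_itv /=.
by have := dd' _ hp; move=> h /andP[h1 h2]; lra.
Qed.

Lemma fine_partition_filter delta P q :
  fine_partition delta P -> fine_partition delta [seq p <- P | q p].
Proof. by move=> fP p; rewrite mem_filter => /andP[_ /fP]. Qed.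

(** The supremum of the end points reached by fine partitions starting at a is
    itself reached, by an interval tagged there, and cannot lie below b. *)
Lemma cousin a b delta : a < b -> gauge a b delta ->
  exists P, perron_of a b P /\ fine_partition delta P.
Proof.
move=> ab gd.
pose S := [set x | x = a \/ (a < x <= b /\
  exists P, perron_of a x P /\ fine_partition delta P)].
have Sb : ubound S b by move=> x [->|[/andP[_ ->] _]] //; exact: ltW.
have hS : has_sup S by split; [exists a; left|exists b].
pose s := sup S.
have as_ : a <= s by apply: sup_upper_bound => //; left.
have sb : s <= b by apply: ge_sup => //; case: hS.
have ds : 0 < delta s by apply: gd; rewrite as_ sb.
have [x Sx sx] : exists2 x, S x & s - delta s < x.
  by apply: sup_adherent.
have xs : x <= s by exact: sup_upper_bound.
have ext y : x < y -> s <= y -> y <= b -> y < s + delta s ->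
    exists P, perron_of a y P /\ fine_partition delta P.
  move=> xy sy yb yd.
  have o1 : perron_of x y [:: (x, y, s)] by apply: perron_of1 => //; rewrite xs.
  have f1 : fine_partition delta [:: (x, y, s)].
    move=> p; rewrite inE => /eqP -> z /=.
    by rewrite /lft /rgt /tagpt /= !in_itv /= => /andP[h1 h2]; lra.
  case: Sx => [xa|[/andP[ax xb] [P [oP fP]]]].
    by exists [:: (x, y, s)]; rewrite -xa.
  exists (P ++ [:: (x, y, s)]); split.
    by apply: perron_of_cat oP o1; exact: ltW.
  exact/fine_partition_cat.
have [sltb|bs] := ltP s b.
  pose y := Num.min b (s + delta s / 2).
  have sy : s < y by rewrite lt_min sltb ltrDl divr_gt0.
  have : S y.
    right; split; first by rewrite (le_lt_trans as_ sy) ge_min lexx.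
    apply: ext; [exact: le_lt_trans sy|exact: ltW|by rewrite ge_min lexx|].
    by rewrite gt_min; apply/orP; right; lra.
  by move=> /(sup_upper_bound hS); rewrite leNgt sy.
have sE : s = b by lra.
have [xltb|bx] := ltP x b.
  by apply: ext; rewrite -?sE //; lra.
case: Sx => [xa|[_ [P [oP fP]]]]; first by lra.
by exists P; split=> //; have <- : x = b by lra.
Qed.

End PerronPartitions.

Section PerronComplement.
Context {R : realType}.
Implicit Types (a b c : R) (P Q : seq (R * R * R)) (F : R -> R -> R).

Definition additive_on a b F := forall u v w,
  a <= u -> u < v -> v < w -> w <= b -> F u w = F u v + F v w.

Lemma additive_on_sub a b a' b' F : a <= a' -> b' <= b ->
  additive_on a b F -> additive_on a' b' F.
Proof. by move=> aa bb FA u v w au uv vw wb; apply: FA => //; lra. Qed.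

Definition complement_spec a b P (L : seq (R * R)) :=
  [/\ forall I, I \in L -> [/\ a <= I.1, I.1 < I.2 & I.2 <= b],
      forall D : R * R -> seq (R * R * R),
        (forall I, I \in L -> perron_of I.1 I.2 (D I)) ->
        perron_of a b (P ++ flatten (map D L))
    & forall F, additive_on a b F ->
        \sum_(p <- P) F (lft p) (rgt p) + \sum_(I <- L) F I.1 I.2 = F a b].

(** The closure of the complement of a Perron partition in an interval is a
    finite union of intervals.  This is stated with an arbitrary family D of
    partitions of these intervals and for all additive interval functions at
    once, since both are produced by the same splitting at the first member. *)
Lemma perron_complement a b P : a < b -> perron_in a b P ->
  exists L, complement_spec a b P L.
Proof.
have [n] := ubnP (size P); elim: n P a b => // n IH [|p P] a b.
  move=> _ ab _; exists [:: (a, b)]; split=> [I|D oD|F _].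
  - by rewrite inE => /eqP -> /=.
  - by rewrite /= cats0; apply: oD; rewrite inE.
  - by rewrite big_nil big_seq1 add0r.
rewrite /= ltnS => sP ab [mP /= /andP[pP oP]].
have [pa plr prb ptag] := mP p (mem_head _ _).
have {}mP q : q \in P -> [/\ a <= lft q, lft q < rgt q, rgt q <= b & lft q <= tagpt q <= rgt q].
  by move=> qP; apply: mP; rewrite inE qP orbT.
pose PL := [seq q <- P | rgt q <= lft p].
pose PR := [seq q <- P | ~~ (rgt q <= lft p)].
have iL : perron_in a (lft p) PL.
  split; last exact: pairwise_filter.
  by move=> q; rewrite mem_filter => /andP[h /mP[h1 h2 h3 h4]].
have iR : perron_in (rgt p) b PR.
  split; last exact: pairwise_filter.
  move=> q; rewrite mem_filter => /andP[h qP]; have [h1 h2 h3 h4] := mP _ qP.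
  split=> //; have := allP pP _ qP; rewrite /nonoverlapping (negbTE h) orbF.
  by [].
have pLR : perm_eq (PL ++ PR) P by rewrite perm_filterC.
have [LL sLL] : exists L, (a < lft p /\ complement_spec a (lft p) PL L) \/ (a = lft p /\ PL = [::] /\ L = [::]).
  have [apl|lpa] := ltP a (lft p).
    have sPL : (size PL < n)%N.
      by rewrite size_filter (leq_ltn_trans (count_size _ _)).
    by have [L hL] := IH _ _ _ sPL apl iL; exists L; left.
  exists [::]; right; split; first lra; split=> //.
  case: PL iL {pLR} => // q s [/(_ q (mem_head _ _))[h1 h2 h3 _] _]; exfalso; lra.
have [LR sLR] : exists L, (rgt p < b /\ complement_spec (rgt p) b PR L) \/ (b = rgt p /\ PR = [::] /\ L = [::]).
  have [prb'|bpr] := ltP (rgt p) b.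
    have sPR : (size PR < n)%N.
      by rewrite size_filter (leq_ltn_trans (count_size _ _)).
    by have [L hL] := IH _ _ _ sPR prb' iR; exists L; left.
  exists [::]; right; split; first lra; split=> //.
  case: PR iR {pLR} => // q s [/(_ q (mem_head _ _))[h1 h2 h3 _] _]; exfalso; lra.
exists (LL ++ LR); split.
- move=> I; rewrite mem_cat => /orP[].
    by case: sLL => [[_ [h _ _]] /h[h1 h2 h3]|[_ [_ ->]]] //; split=> //; lra.
  by case: sLR => [[_ [h _ _]] /h[h1 h2 h3]|[_ [_ ->]]] //; split=> //; lra.
- move=> D oD.
  have oL I : I \in LL -> perron_of I.1 I.2 (D I).
    by move=> h; apply: oD; rewrite mem_cat h.
  have oR I : I \in LR -> perron_of I.1 I.2 (D I).
    by move=> h; apply: oD; rewrite mem_cat h orbT.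
  apply: (@perron_of_perm _ _ _ ((PL ++ flatten (map D LL)) ++ ([:: p] ++ (PR ++ flatten (map D LR))))).
    apply/permP => q; have := permP pLR q.
    by rewrite map_cat flatten_cat -(cat1s p P) !count_cat => <-; ring.
  have op : perron_of (lft p) (rgt p) [:: p].
    by move: plr ptag; case: (p) => [[l r] t]; exact: perron_of1.
  have oRR : perron_of (lft p) b ([:: p] ++ (PR ++ flatten (map D LR))).
    case: sLR => [[_ [_ h _]]|[-> [-> ->]]] //.
    by apply: perron_of_cat op (h _ oR) => //; exact: ltW.
  case: sLL oL => [[_ [_ h _]] /h oLL|[-> [-> ->]]] //.
  by apply: perron_of_cat oLL oRR; lra.
- move=> F FA; rewrite big_cons -(perm_big _ pLR) !big_cat /=.
  have -> : F a b = F a (lft p) * (a < lft p)%R%:R + F (lft p) (rgt p)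
                    + F (rgt p) b * (rgt p < b)%R%:R.
    have [apl|lpa] := ltP a (lft p); have [prb'|bpr] := ltP (rgt p) b; rewrite ?mulr1 ?mulr0 ?addr0 ?add0r.
    - by rewrite (FA a (rgt p) b) // ?(FA a (lft p) (rgt p)) //; lra.
    - have -> : b = rgt p by lra.
      by rewrite (FA a (lft p) (rgt p)) //; lra.
    - have -> : a = lft p by lra.
      by rewrite (FA (lft p) (rgt p) b) //; lra.
    - by congr F; lra.
  have -> : F a (lft p) * (a < lft p)%R%:R =
     \sum_(i <- PL) F (lft i) (rgt i) + \sum_(I <- LL) F I.1 I.2.
    case: sLL => [[apl [_ _ /(_ F) ->]]|[h1 [-> ->]]].
    + by rewrite apl mulr1.
    + by apply: additive_on_sub FA; lra.
    + by rewrite !big_nil addr0 h1 ltxx mulr0.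
  have -> : F (rgt p) b * (rgt p < b)%R%:R =
     \sum_(i <- PR) F (lft i) (rgt i) + \sum_(I <- LR) F I.1 I.2.
    case: sLR => [[apl [_ _ /(_ F) ->]]|[h1 [-> ->]]].
    + by rewrite apl mulr1.
    + by apply: additive_on_sub FA; lra.
    + by rewrite !big_nil addr0 h1 ltxx mulr0.
  ring.
Qed.

End PerronComplement.

Section PerronSums.
Context {R : realType}.
Implicit Types (a b c : R) (P Q : seq (R * R * R)) (F : R -> R -> R).

Lemma additive_on_length a b : additive_on a b (fun u v => v - u).
Proof. by move=> u v w *; ring. Qed.

Lemma perron_in_sum_le a b P F : a < b -> additive_on a b F ->
  (forall u v, a <= u -> u < v -> v <= b -> 0 <= F u v) ->
  perron_in a b P -> \sum_(p <- P) F (lft p) (rgt p) <= F a b.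
Proof.
move=> ab FA F0 iP; have [L [hL _ /(_ _ FA) <-]] := perron_complement ab iP.
by rewrite lerDl big_seq; apply: sumr_ge0 => I /hL[h1 h2 h3]; exact: F0.
Qed.

Lemma perron_in_length_le a b P : a < b -> perron_in a b P ->
  \sum_(p <- P) itv_length p <= b - a.
Proof.
move=> ab; apply: (@perron_in_sum_le _ _ _ (fun u v => v - u)) => //.
  exact: additive_on_length.
by move=> u v _ uv _; lra.
Qed.

(** A complementary interval would contain a point not covered by the
    partition. *)
Lemma perron_of_sum a b P F : a < b -> additive_on a b F ->
  perron_of a b P -> \sum_(p <- P) F (lft p) (rgt p) = F a b.
Proof.
move=> ab FA [iP cP]; have [L [hL oL /(_ _ FA) <-]] := perron_complement ab iP.
suff -> : L = [::] by rewrite big_nil addr0.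
case: L hL oL => // I L hL oL; exfalso.
have [aI I12 Ib] := hL I (mem_head _ _).
have /oL[[_]] : forall J, J \in I :: L -> perron_of J.1 J.2 [:: (J.1, J.2, J.1)].
  by move=> J /hL[h1 h2 h3]; apply: perron_of1 => //; lra.
rewrite pairwise_cat => /and3P[/allrelP h _ _] _.
have : `[a, b]%classic ((I.1 + I.2) / 2) by rewrite /= in_itv /=; lra.
rewrite -cP => -[p /= pP]; rewrite in_itv /=.
have := h p (I.1, I.2, I.1) pP (mem_head _ _).
by rewrite /nonoverlapping /rgt /lft /= => /orP[]; lra.
Qed.

Lemma gauge_min a b (d d' : R -> R) : gauge a b d -> gauge a b d' ->
  gauge a b (fun t => Num.min (d t) (d' t)).
Proof. by move=> gd gd' t h; rewrite lt_min gd // gd'. Qed.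

Lemma fine_partition_min (d d' : R -> R) P :
  fine_partition (fun t => Num.min (d t) (d' t)) P ->
  fine_partition d P /\ fine_partition d' P.
Proof.
by move=> fP; split; apply: fine_partition_le fP => p _; rewrite ge_min lexx ?orbT.
Qed.

Lemma gauge_sub a b a' b' (d : R -> R) : a <= a' -> b' <= b ->
  gauge a b d -> gauge a' b' d.
Proof. by move=> aa bb gd t h; apply: gd; lra. Qed.

End PerronSums.

Section HKIntegral.
Context {R : realType}.
Implicit Types (a b c u v w eta : R) (P Q : seq (R * R * R)) (F : R -> R -> R) (g h : R -> R).

Notation riemann g P := (\sum_(p <- P) g (tagpt p) * itv_length p).

Lemma HK_partition a b g v d eps : a < b -> is_HK_integral a b g v ->
  gauge a b d -> 0 < eps ->
  exists P, [/\ perron_of a b P, fine_partition d P & `|riemann g P - v| < eps].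
Proof.
move=> ab gv gd e0; have [d' [gd' hd']] := gv _ e0.
have [P [oP /fine_partition_min[fP fP']]] := cousin ab (gauge_min gd gd').
by exists P; split=> //; exact: hd'.
Qed.

Lemma is_HK_integral_unique a b g v w : a < b ->
  is_HK_integral a b g v -> is_HK_integral a b g w -> v = w.
Proof.
move=> ab gv gw; apply/eqP; rewrite -subr_eq0 -normr_le0; apply/ler_addgt0Pl => e e0.
rewrite addr0; have [d [gd hd]] := gv _ (divr_gt0 e0 (@ltr0Sn _ 1)).
have [P [oP fP hP]] := HK_partition ab gw gd (divr_gt0 e0 (@ltr0Sn _ 1)).
have := hd P oP fP; move: hP; set r := riemann g P => h1 h2.
have -> : v - w = (r - w) - (r - v) by ring.
by apply: (le_trans (ler_normB _ _)); rewrite (splitr e) lerD // ltW.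
Qed.

Lemma is_HK_integral_ext a b g h v : (forall t, a <= t <= b -> g t = h t) ->
  is_HK_integral a b g v -> is_HK_integral a b h v.
Proof.
move=> gh gv e /gv[d [gd hd]]; exists d; split=> // P oP fP.
have -> : riemann h P = riemann g P.
  rewrite big_seq [RHS]big_seq; apply: eq_bigr => p pP; rewrite gh //.
  by have [/(_ _ pP)[h1 h2 h3 h4] _] := oP.1; lra.
exact: hd.
Qed.

Lemma is_HK_integralD a b g h v w :
  is_HK_integral a b g v -> is_HK_integral a b h w ->
  is_HK_integral a b (fun t => g t + h t) (v + w).
Proof.
move=> gv hw e e0; have e2 : 0 < e / 2 by rewrite divr_gt0.
have [d [gd hd]] := gv _ e2; have [d' [gd' hd']] := hw _ e2.
exists (fun t => Num.min (d t) (d' t)); split; first exact: gauge_min.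
move=> P oP /fine_partition_min[/(hd _ oP) h1 /(hd' _ oP) h2].
under eq_bigr do rewrite mulrDl.
rewrite big_split /=.
set r := riemann g P in h1 *; set s := riemann h P in h2 *.
have -> : r + s - (v + w) = (r - v) + (s - w) by ring.
by apply: (le_lt_trans (ler_normD _ _)); rewrite (splitr e) ltrD.
Qed.

Lemma is_HK_integralZ a b g v k :
  is_HK_integral a b g v -> is_HK_integral a b (fun t => k * g t) (k * v).
Proof.
move=> gv e e0; have k0 : 0 < `|k| + 1 by rewrite ltr_wpDl.
have [d [gd hd]] := gv _ (divr_gt0 e0 k0).
exists d; split=> // P oP fP.
under eq_bigr do rewrite -mulrA.
have := hd P oP fP; rewrite -mulr_sumr -mulrBr normrM ltr_pdivlMr // => h1.
apply: le_lt_trans h1; rewrite mulrC ler_wpM2l // lerDl //.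
Qed.

Lemma is_HK_integralB a b g h v w :
  is_HK_integral a b g v -> is_HK_integral a b h w ->
  is_HK_integral a b (fun t => g t - h t) (v - w).
Proof.
move=> gv /(is_HK_integralZ (-1)) hw.
rewrite -[- w]mulN1r; apply: is_HK_integral_ext (is_HK_integralD gv hw).
by move=> t _; rewrite mulN1r.
Qed.

Lemma is_HK_integral_cst a b k : a < b -> is_HK_integral a b (fun=> k) (k * (b - a)).
Proof.
move=> ab e e0; exists (fun=> 1); split=> // P oP _.
rewrite -mulr_sumr -(perron_of_sum ab (@additive_on_length R a b) oP).
by rewrite subrr normr0.
Qed.

Lemma is_HK_integral_ge0 a b g v : a < b ->
  (forall t, a <= t <= b -> 0 <= g t) -> is_HK_integral a b g v -> 0 <= v.
Proof.
move=> ab g0 gv; apply/ler_addgt0Pl => e e0.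
have g1 : gauge a b (fun=> 1) by [].
have [P [oP _]] := HK_partition ab gv g1 e0.
have : 0 <= riemann g P.
  rewrite big_seq; apply: sumr_ge0 => p /(oP.1.1)[h1 h2 h3 h4].
  by rewrite mulr_ge0 ?g0 /itv_length; lra.
rewrite ltr_norml => h1 /andP[h2 h3]; lra.
Qed.

Definition HK_primitive a b g F := forall u v, a <= u -> u < v -> v <= b ->
  is_HK_integral u v g (F u v).

Lemma HK_primitive_sub a b a' b' g F : a <= a' -> b' <= b ->
  HK_primitive a b g F -> HK_primitive a' b' g F.
Proof. by move=> aa bb gF u v h1 h2 h3; apply: gF; lra. Qed.

(** A gauge for [u, w] is also a gauge for its two parts, whose fine partitions
    can be concatenated. *)
Lemma HK_primitive_additive a b g F : HK_primitive a b g F -> additive_on a b F.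
Proof.
move=> gF u v w au uv vw wb; have uw := lt_trans uv vw.
apply/eqP; rewrite -subr_eq0 -normr_le0; apply/ler_addgt0Pl => e e0.
rewrite addr0; have e3 : 0 < e / 3 by rewrite divr_gt0.
have [d [gd hd]] := gF u w au uw wb _ e3.
have gd1 : gauge u v d by apply: gauge_sub gd => //; exact: ltW.
have gd2 : gauge v w d by apply: gauge_sub gd => //; exact: ltW.
have [P [oP fP]] := HK_partition uv (gF u v au uv (ltW (lt_le_trans vw wb))) gd1 e3.
have [Q [oQ fQ]] := HK_partition vw (gF v w (ltW (le_lt_trans au uv)) vw wb) gd2 e3.
have := hd (P ++ Q) (perron_of_cat (ltW uv) (ltW vw) oP oQ).
move=> /(_ ((fine_partition_cat _ _ _).2 (conj fP fQ))).
rewrite big_cat /=; move: (riemann g P) (riemann g Q) => r s.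
rewrite !ltr_norml ler_norml => /andP[h1 h2] /andP[h3 h4] /andP[h5 h6]; lra.
Qed.

(** Saks-Henstock: a gauge good for all partitions of an interval is
    equally good for parts of partitions, because the complementary intervals
    can be partitioned with arbitrarily small errors. *)
Lemma Saks_Henstock a b g F d eta P : a < b -> HK_primitive a b g F ->
  gauge a b d ->
  (forall Q, perron_of a b Q -> fine_partition d Q ->
    `|riemann g Q - F a b| <= eta) ->
  perron_in a b P -> fine_partition d P ->
  `|\sum_(p <- P) (g (tagpt p) * itv_length p - F (lft p) (rgt p))| <= eta.
Proof.
move=> ab gF gd hd iP fP; have FA := HK_primitive_additive gF.
have [L [hL oL /(_ _ FA) sL]] := perron_complement ab iP.
apply/ler_addgt0Pl => e e0.
pose k : R := (size L).+1%:R; have k0 : 0 < k by rewrite ltr0n.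
have hD (I : R * R) : exists Q, I \in L -> [/\ perron_of I.1 I.2 Q, fine_partition d Q
    & `|riemann g Q - F I.1 I.2| < e / k].
  have [IL|_] := boolP (I \in L); last by exists [::].
  have [aI I12 Ib] := hL I IL.
  have gdI : gauge I.1 I.2 d by exact: gauge_sub gd.
  have [Q hQ] := HK_partition I12 (gF _ _ aI I12 Ib) gdI (divr_gt0 e0 k0).
  by exists Q.
have [D {}hD] := choice hD.
have := hd _ (oL D (fun I IL => let: And3 h _ _ := hD I IL in h)).
have fD : fine_partition d (P ++ flatten (map D L)).
  apply/fine_partition_cat; split=> // p /flatten_mapP[I IL pI].
  by have [_ /(_ _ pI)] := hD _ IL.
move=> /(_ fD); rewrite big_cat big_flatten big_map /= -sL.
have : `|\sum_(I <- L) (riemann g (D I) - F I.1 I.2)| <= e.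
  apply: (le_trans (ler_norm_sum _ _ _)).
  rewrite big_seq; apply: (@le_trans _ _ (\sum_(I <- L | I \in L) e / k)).
    by apply: ler_sum => I /hD[_ _ /ltW].
  rewrite -big_seq big_const_seq count_predT iter_addr_0 -mulr_natr mulrAC ler_pdivrMr //.
  by rewrite ler_pM2l // /k ler_nat.
rewrite !sumrB.
move: (riemann g P) (\sum_(I <- L) riemann g (D I)) (\sum_(p <- P) F (lft p) (rgt p)) (\sum_(I <- L) F I.1 I.2).
move=> r s t u; rewrite !ler_norml => /andP[h1 h2] /andP[h3 h4]; lra.
Qed.

End HKIntegral.

(** * Lebesgue measure of tagged intervals *)

Section LebesgueFacts.
Context {R : realType}.
Implicit Types (a b c t : R) (A B K U : set R) (P : seq (R * R * R)).

Notation mes A := (fine (lambda A)).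

Lemma lebesgue_measurableI A B : lebesgue_measurable A -> lebesgue_measurable B ->
  lebesgue_measurable (A `&` B).
Proof. exact: measurableI. Qed.

Lemma lebesgue_measurableU A B : lebesgue_measurable A -> lebesgue_measurable B ->
  lebesgue_measurable (A `|` B).
Proof. exact: measurableU. Qed.

Lemma lebesgue_measurableD A B : lebesgue_measurable A -> lebesgue_measurable B ->
  lebesgue_measurable (A `\` B).
Proof. exact: measurableD. Qed.

Lemma lebesgue_measurable0 : lebesgue_measurable (set0 : set R).
Proof. exact: measurable0. Qed.

Lemma lebesgue_measurable_bigcup (F : nat -> set R) :
  (forall i, lebesgue_measurable (F i)) -> lebesgue_measurable (\bigcup_i F i).
Proof. by move=> mF; apply: bigcupT_measurable. Qed.

Lemma lebesgue_measurable_bigcap (F : nat -> set R) :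
  (forall i, lebesgue_measurable (F i)) -> lebesgue_measurable (\bigcap_i F i).
Proof. by move=> mF; apply: bigcapT_measurable. Qed.

Lemma lebesgue_measurable_borel A : measurable (A : set (measurableTypeR R)) ->
  lebesgue_measurable A.
Proof. exact: sub_caratheodory. Qed.

Lemma lebesgue_measurable_open U : open U -> lebesgue_measurable U.
Proof. by move=> oU; apply: lebesgue_measurable_borel; exact: open_measurable. Qed.

Lemma lebesgue_measurable_closed K : closed K -> lebesgue_measurable K.
Proof. by move=> oU; apply: lebesgue_measurable_borel; exact: closed_measurable. Qed.

Lemma lambda_outer A : lambda A = ((wlength (idfun : R -> R))^*)%mu A.
Proof. by []. Qed.

Lemma lambda_le A B : A `<=` B -> (lambda A <= lambda B)%E.
Proof. by move=> AB; rewrite !lambda_outer le_outer_measure. Qed.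

Lemma lambda_ge0 A : (0 <= lambda A)%E.
Proof. by rewrite lambda_outer outer_measure_ge0. Qed.

Lemma lambda_borel A : lambda A = lebesgue_measure A.
Proof. by []. Qed.

Lemma lambda_segment a b : a <= b -> lambda `[a, b]%classic = (b - a)%:E.
Proof.
move=> ab; rewrite lambda_borel lebesgue_measure_itv /= lte_fin.
by case: ltgtP ab => // -> _; rewrite subrr.
Qed.

Lemma lambda_open_itv a b : a <= b -> lambda `]a, b[%classic = (b - a)%:E.
Proof.
move=> ab; rewrite lambda_borel lebesgue_measure_itv /= lte_fin.
by case: ltgtP ab => // -> _; rewrite subrr.
Qed.

Lemma lambda_fin_num a b A : A `<=` `[a, b]%classic -> lambda A \is a fin_num.
Proof.
move=> Aab; rewrite ge0_fin_numE ?lambda_ge0 //.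
apply: (le_lt_trans (lambda_le Aab)).
rewrite lambda_borel lebesgue_measure_itv /=.
by case: ifP => _; rewrite ?ltry.
Qed.

Lemma mes_ge0 A : 0 <= mes A.
Proof. exact/fine_ge0/lambda_ge0. Qed.

Lemma mes_le a b A B : A `<=` B -> B `<=` `[a, b]%classic -> mes A <= mes B.
Proof.
move=> AB Bab; apply: fine_le; last exact: lambda_le.
  exact: lambda_fin_num (subset_trans AB Bab).
exact: lambda_fin_num Bab.
Qed.

Lemma lambdaDI A B : lebesgue_measurable A -> lebesgue_measurable B ->
  lambda A = (lambda (A `\` B) + lambda (A `&` B))%E.
Proof. by move=> mA mB; exact: measureDI. Qed.

Lemma outer_open A (eta : R) : 0 < eta ->
  exists U, [/\ open U, A `<=` U & (lambda U <= lambda A + eta%:E)%E].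
Proof.
by rewrite lambda_outer => /(outer_measure_open_le A)[U [oU AU UA]]; exists U.
Qed.

Lemma lambda_null_sub A B : A `<=` B -> lambda B = 0%E -> lambda A = 0%E.
Proof. by move=> /lambda_le + B0; rewrite B0 => h; apply/eqP; rewrite eq_le h lambda_ge0. Qed.

Lemma null_Gdelta A : lambda A = 0%E -> exists V : nat -> set R,
  [/\ forall n, open (V n), forall n, A `<=` V n & lambda (\bigcap_n V n) = 0%E].
Proof.
move=> A0; have [V hV] := choice (fun n => outer_open A (inv_nat_gt0 R n)).
exists V; split=> [n|n|]; [by have [] := hV n|by have [] := hV n|].
apply/eqP; rewrite eq_le lambda_ge0 andbT; apply/lee_addgt0Pr => e e0; rewrite add0e.
have [n /ltW ne] := inv_nat_small e0.
have VnV : \bigcap_n V n `<=` V n by move=> t; apply.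
have [_ _] := hV n; rewrite A0 add0e => lV.
by apply: (le_trans (lambda_le VnV)); apply: (le_trans lV); rewrite lee_fin.
Qed.

Lemma lebesgue_measurable_null A : lambda A = 0%E -> lebesgue_measurable A.
Proof.
move=> /null_Gdelta[V [oV AV V0]]; apply: (@completed_lebesgue_measure_is_complete R).
exists (\bigcap_n V n); split=> //; last by move=> t At n _; exact: AV.
by apply: lebesgue_measurable_bigcap => n; exact: lebesgue_measurable_open.
Qed.

Lemma inner_closed a b A (eta : R) : 0 < eta -> A `<=` `[a, b]%classic ->
  lebesgue_measurable A ->
  exists K, [/\ closed K, K `<=` A & mes A - eta <= mes K].
Proof.
move=> e0 Aab mA; pose I := `[a, b]%classic : set R.
have mI : lebesgue_measurable I by apply: lebesgue_measurable_closed; exact: interval_closed.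
have [U [oU UA lU]] := outer_open (I `\` A) e0.
exists (I `\` U); split.
- apply: closedI; first exact: interval_closed.
  exact: open_closedC.
- by move=> x [Ix nUx]; apply: contrapT => nAx; apply: nUx; apply: UA.
have mU := lebesgue_measurable_open oU.
have e1 : lambda I = (lambda (I `\` U) + lambda (I `&` U))%E by exact: lambdaDI.
have e2 : lambda I = (lambda (I `\` A) + lambda A)%E.
  by rewrite (@lambdaDI I A) // (setIidr Aab).
have fI : lambda I \is a fin_num by exact: (@lambda_fin_num a b).
have fA : lambda A \is a fin_num by exact: (@lambda_fin_num a b).
have f1 : lambda (I `\` U) \is a fin_num by apply: (@lambda_fin_num a b) => x [].
have f2 : lambda (I `&` U) \is a fin_num by apply: (@lambda_fin_num a b) => x [].
have f3 : lambda (I `\` A) \is a fin_num by apply: (@lambda_fin_num a b) => x [].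
have : (lambda (I `&` U) <= lambda (I `\` A) + eta%:E)%E.
  by apply: le_trans lU; apply: lambda_le => x [].
move: e1 e2; rewrite -(fineK fI) -(fineK fA) -(fineK f1) -(fineK f2) -(fineK f3).
rewrite -!EFinD lee_fin => -[e1] [e2]; lra.
Qed.

Lemma length_le_open U P : lebesgue_measurable U ->
  (forall p, p \in P -> lft p < rgt p /\ `]lft p, rgt p[%classic `<=` U) ->
  pairwise nonoverlapping P ->
  ((\sum_(p <- P) itv_length p)%:E <= lambda U)%E.
Proof.
elim: P U => [|p P IH] U mU hP; first by rewrite big_nil lambda_ge0.
rewrite /= => /andP[pP oP].
have [plr pU] := hP p (mem_head _ _).
have mp : lebesgue_measurable `]lft p, rgt p[%classic.
  by apply: lebesgue_measurable_open; exact: interval_open.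
rewrite big_cons (lambdaDI mU mp) EFinD addeC leeD //.
  apply: IH => //; first exact: lebesgue_measurableD.
  move=> q qP; have [qlr qU] := hP q (@mem_behead _ (p :: P) _ qP).
  split=> // x qx; split; first exact: qU.
  move: qx; rewrite /= !in_itv /=; have := allP pP _ qP.
  by rewrite /nonoverlapping => /orP[]; lra.
rewrite setIC (setIidl pU) lambda_open_itv //; exact: ltW.
Qed.

Lemma length_ge_cover A P :
  (forall p, p \in P -> lft p < rgt p) ->
  A `<=` \bigcup_(p in [set` P]) `[lft p, rgt p]%classic ->
  (lambda A <= (\sum_(p <- P) itv_length p)%:E)%E.
Proof.
elim: P A => [|p P IH] A hP AP.
  rewrite big_nil; have -> : A = set0 by apply/seteqP; split=> // x /AP[].
  by rewrite lambda_outer outer_measure0.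
rewrite big_cons EFinD.
have plr := hP p (mem_head _ _).
apply: (@le_trans _ _ (lambda (A `&` `[lft p, rgt p]) + lambda (A `\` `[lft p, rgt p]))%E).
  rewrite -[X in (lambda X <= _)%E](@setUIDK _ A `[lft p, rgt p]%classic).
  by rewrite !lambda_outer outer_measureU2.
apply: leeD.
  by rewrite -lambda_segment ?(ltW plr) //; apply: lambda_le => x [].
apply: IH => [q qP|x [Ax px]]; first by apply: hP; rewrite inE qP orbT.
by have [q /=] := AP _ Ax; rewrite inE => /predU1P[->//|qP qx]; exists q.
Qed.

End LebesgueFacts.

Section GaugesFromMeasure.
Context {R : realType}.
Implicit Types (a b t e eta v : R) (g : R -> R) (A B K U : set R) (P : seq (R * R * R)).

Notation mes A := (fine (lambda A)).

Lemma open_radius U t : open U -> U t ->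
  exists2 e : R, 0 < e & forall x, t - e < x < t + e -> U x.
Proof.
move=> oU Ut; have /nbhs_ballP[e /= e0 eU] := open_nbhs_nbhs (conj oU Ut).
exists e => // x hx; apply: eU; rewrite /ball /= ltr_norml; lra.
Qed.

Lemma fine_itv (d : R -> R) P p x : fine_partition d P -> p \in P ->
  lft p <= x <= rgt p -> tagpt p - d (tagpt p) < x < tagpt p + d (tagpt p).
Proof. by move=> fP pP hx; have := fP p pP x; rewrite /= !in_itv /=; apply. Qed.

(** Countable partitions are encoded as index functions, so that fibres are
    disjoint and each tag knows its piece. *)
Definition fiber (I : Type) a b (J : R -> I) (i : I) : set R :=
  [set t | a <= t <= b /\ J t = i].

Lemma fiber_sub (I : Type) a b (J : R -> I) i : fiber a b J i `<=` `[a, b]%classic.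
Proof. by move=> t [h _]; rewrite /= in_itv. Qed.

Notation tagged_length J i P := (\sum_(p <- P | J (tagpt p) == i) itv_length p).

(** An interval of a fine partition stays inside an open set slightly larger
    than the fibre of its tag. *)
Lemma outer_gauge a b (J : R -> nat) (eta_ : nat -> R) : (forall i, 0 < eta_ i) ->
  exists d : R -> R, (forall t, 0 < d t) /\
    forall P, perron_in a b P -> fine_partition d P ->
      forall i, tagged_length J i P <= mes (fiber a b J i) + eta_ i.
Proof.
move=> eta0.
have /choice[U hU] : forall i, exists U, [/\ open U, fiber a b J i `<=` U &
    (lambda U <= lambda (fiber a b J i) + (eta_ i)%:E)%E].
  by move=> i; exact: outer_open.
have hd t : exists d : R, 0 < d /\ (a <= t <= b ->
    forall x, t - d < x < t + d -> U (J t) x).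
  have [tab|tab] := boolP (a <= t <= b); last by exists 1.
  have [oU UJ _] := hU (J t).
  by have [e e0 eU] := open_radius oU (UJ t (conj tab erefl)); exists e.
have [d {}hd] := choice hd.
exists d; split=> [t|P iP fP i]; first by have [] := hd t.
have [oU _ lU] := hU i.
rewrite -big_filter; set Q := [seq p <- P | J (tagpt p) == i].
have iQ : perron_in a b Q by exact: perron_in_filter.
have : ((\sum_(p <- Q) itv_length p)%:E <= lambda (U i))%E.
  apply: length_le_open iQ.2; first exact: lebesgue_measurable_open.
  move=> p pQ; have [h1 h2 h3 h4] := iQ.1 p pQ; split=> // x /=.
  move: pQ; rewrite mem_filter => /andP[/eqP Ji pP]; rewrite in_itv /= => hx.
  rewrite -Ji; apply: (hd _).2; first by lra.
  by apply: (fine_itv fP pP); lra.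
move=> /le_trans /(_ lU).
by rewrite -{1}(fineK (lambda_fin_num (@fiber_sub _ a b J i))) -EFinD lee_fin.
Qed.

(** Intervals tagged outside a fibre avoid a closed subset of almost full measure
    of this fibre, which is therefore covered by the intervals tagged in it. *)
Lemma inner_gauge a b (I : eqType) (J : R -> I) (s : seq I) (eta : R) : 0 < eta ->
  (forall i, i \in s -> lebesgue_measurable (fiber a b J i)) ->
  exists d : R -> R, (forall t, 0 < d t) /\
    forall P, perron_of a b P -> fine_partition d P ->
      forall i, i \in s -> mes (fiber a b J i) - eta <= tagged_length J i P.
Proof.
move=> eta0; elim: s => [_|i s IH ms]; first by exists (fun=> 1); split.
have [|d [d0 hd]] := IH; first by move=> j js; apply: ms; rewrite inE js orbT.
have [K [cK KJ lK]] := inner_closed eta0 (@fiber_sub _ a b J i) (ms i (mem_head _ _)).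
have he t : exists e : R, 0 < e /\ (J t <> i ->
    forall x, t - e < x < t + e -> ~ K x).
  have [Ji|Ji] := pselect (J t = i); first by exists 1; split.
  have nKt : (~` K) t by move=> /KJ[].
  by have [e e0 eK] := open_radius (closed_openC cK) nKt; exists e.
have [e {}he] := choice he.
exists (fun t => Num.min (d t) (e t)); split=> [t|P oP].
  by rewrite lt_min d0; have [->] := he t.
move=> /fine_partition_min[fd fe] j; rewrite inE => /predU1P[->|]; last exact: hd.
apply: (le_trans lK); rewrite -big_filter.
have KP : K `<=` \bigcup_(p in [set` [seq p <- P | J (tagpt p) == i]]) `[lft p, rgt p]%classic.
  move=> x Kx; have : `[a, b]%classic x by exact: fiber_sub (KJ _ Kx).
  rewrite -oP.2 => -[p /= pP px]; exists p => //=; rewrite mem_filter pP andbT.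
  apply/eqP; apply: contrapT => Ji; apply: ((he _).2 Ji x) => //.
  by apply: (fine_itv fe pP); move: px; rewrite in_itv.
have fK : lambda K \is a fin_num by exact: lambda_fin_num (subset_trans KJ (@fiber_sub _ a b J i)).
rewrite -lee_fin fineK //; apply: length_ge_cover KP => p.
by rewrite mem_filter => /andP[_ /(oP.1.1 p)[]].
Qed.

Lemma sum_by_tag (I : eqType) (J : R -> I) (s : seq I) (f : R * R * R -> R) P :
  uniq s -> (forall p, p \in P -> J (tagpt p) \in s) ->
  \sum_(p <- P) f p = \sum_(i <- s) \sum_(p <- P | J (tagpt p) == i) f p.
Proof.
move=> us Js; under [RHS]eq_bigr do rewrite big_mkcond.
rewrite exchange_big /= big_seq [RHS]big_seq; apply: eq_bigr => p pP.
rewrite (bigD1_seq (J (tagpt p))) ?Js //= eqxx big1 ?addr0 // => i.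
by rewrite eq_sym => /negbTE ->.
Qed.

Notation riemann g P := (\sum_(p <- P) g (tagpt p) * itv_length p).

Lemma riemann_ge a b (I : eqType) (J : R -> I) (s : seq I) (c : I -> R) g P :
  uniq s -> perron_in a b P -> (forall t, a <= t <= b -> 0 <= g t) ->
  (forall i t, i \in s -> fiber a b J i t -> c i <= g t) ->
  \sum_(i <- s) c i * tagged_length J i P <= riemann g P.
Proof.
move=> us iP g0 cg.
have tP p : p \in P -> a <= tagpt p <= b /\ 0 < itv_length p.
  by move=> /iP.1[h1 h2 h3 h4]; rewrite /itv_length; split; lra.
rewrite [leRHS](bigID (fun p => J (tagpt p) \in s)) /= -[leLHS]addr0 lerD //; last first.
  by rewrite big_seq_cond sumr_ge0 // => p /andP[/tP[h1 /ltW h2] _]; rewrite mulr_ge0 ?g0.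
rewrite -[leRHS]big_filter [leRHS](@sum_by_tag I J s _ _ us) //; last by move=> p; rewrite mem_filter => /andP[].
rewrite big_seq [leRHS]big_seq ler_sum // => i si.
rewrite mulr_sumr big_filter_cond big_mkcond [leRHS]big_mkcond /= big_seq [leRHS]big_seq.
apply: ler_sum => p /tP[h1 /ltW h2].
case: ifP => [/eqP Ji|]; last by rewrite andbF.
by rewrite Ji si ler_wpM2r ?cg.
Qed.

Lemma riemann_le a b (I : eqType) (J : R -> I) (s : seq I) (c : I -> R) g P :
  uniq s -> perron_in a b P -> (forall p, p \in P -> J (tagpt p) \in s) ->
  (forall i t, i \in s -> fiber a b J i t -> g t <= c i) ->
  riemann g P <= \sum_(i <- s) c i * tagged_length J i P.
Proof.
move=> us iP Js cg; rewrite [leLHS](@sum_by_tag I J s _ _ us) //.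
rewrite big_seq [leRHS]big_seq ler_sum // => i si.
rewrite mulr_sumr big_seq_cond [leRHS]big_seq_cond; apply: ler_sum => p /andP[pP /eqP Ji].
have [h1 h2 h3 h4] := iP.1 p pP.
rewrite ler_wpM2r ?cg //; first by rewrite /itv_length; lra.
by split=> //; lra.
Qed.

(** A fine partition devotes to the i-th fibre nearly its measure or more; as g
    is nonnegative, the tags in other fibres can be dropped. *)
Lemma HK_integral_ge_sum a b (I : eqType) (J : R -> I) (s : seq I) (c : I -> R) g v :
  a < b -> uniq s -> (forall i, i \in s -> lebesgue_measurable (fiber a b J i)) ->
  (forall t, a <= t <= b -> 0 <= g t) -> (forall i, i \in s -> 0 <= c i) ->
  (forall i t, i \in s -> fiber a b J i t -> c i <= g t) ->
  is_HK_integral a b g v ->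
  \sum_(i <- s) c i * mes (fiber a b J i) <= v.
Proof.
move=> ab us ms g0 c0 cg gv; apply/ler_addgt0Pr => e e0.
have e2 : 0 < e / 2 by rewrite divr_gt0.
pose C := \sum_(i <- s) c i + 1.
have C0 : 0 < C by rewrite ltr_wpDl // big_seq sumr_ge0.
have [d [d0 hd]] := inner_gauge (divr_gt0 e2 C0) ms.
have [P [oP fP hP]] := HK_partition ab gv (fun t _ => d0 t) e2.
have h1 := riemann_ge us oP.1 g0 cg.
have h2 : \sum_(i <- s) c i * mes (fiber a b J i) - e / 2 <=
    \sum_(i <- s) c i * tagged_length J i P.
  apply: (@le_trans _ _ (\sum_(i <- s) c i * (mes (fiber a b J i) - e / 2 / C))).
    under [leRHS]eq_bigr do rewrite mulrBr.
    rewrite sumrB lerD2l lerN2 -mulr_suml mulrCA ger_pMr // ler_pdivrMr //.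
    by rewrite mul1r lerDl.
  rewrite big_seq [leRHS]big_seq ler_sum // => i si; rewrite ler_wpM2l ?c0 //; exact: hd.
move: hP; rewrite ltr_norml => /andP[h3 h4]; lra.
Qed.

Lemma fiber_points a b (J : R -> nat) : exists pt : nat -> R, forall i,
  fiber a b J i !=set0 -> fiber a b J i (pt i).
Proof.
have h i : exists t, fiber a b J i !=set0 -> fiber a b J i t.
  by have [[t Jt]|no] := pselect (fiber a b J i !=set0); [exists t|exists 0].
by have [pt hpt] := choice h; exists pt.
Qed.

(** A step function below g, read off the values of g at one point of each
    fibre, when g oscillates by at most e on the fibres that are not
    negligible. *)
Definition lower_step a b g e (J : R -> nat) (pt : nat -> R) i :=
  if mes (fiber a b J i) == 0 then 0 else Num.max 0 (g (pt i) - e).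

Lemma lower_step_ge0 a b g e J pt i : 0 <= lower_step a b g e J pt i.
Proof. by rewrite /lower_step; case: ifP => // _; rewrite le_max lexx. Qed.

Lemma lower_step_le a b g e J pt i t : 0 <= g t ->
  (mes (fiber a b J i) != 0 -> `|g t - g (pt i)| <= e) -> lower_step a b g e J pt i <= g t.
Proof.
move=> g0 osc; rewrite /lower_step; case: (eqVneq (mes _) 0) osc => // ne /(_ isT).
by rewrite ge_max g0 /= ler_norml; lra.
Qed.

Lemma lower_step_ge a b g e J pt i t : mes (fiber a b J i) != 0 ->
  `|g t - g (pt i)| <= e -> g t <= lower_step a b g e J pt i + (e + e).
Proof.
rewrite /lower_step => /negbTE -> ; rewrite ler_norml => /andP[_ h].
have : g (pt i) - e <= Num.max 0 (g (pt i) - e) by rewrite le_max lexx orbT.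
lra.
Qed.

Lemma sum_half_le (e : R) N : 0 <= e -> \sum_(i <- iota 0 N) e / 2 ^+ i.+1 <= e.
Proof.
move=> e0; have -> : \sum_(i <- iota 0 N) e / 2 ^+ i.+1 = e - e / 2 ^+ N.
  elim: N => [|N IH]; first by rewrite big_nil expr0 divr1 subrr.
  rewrite -addn1 iotaD big_cat /= IH add0n big_seq1 addn1 exprS; field.
  by rewrite expf_neq0.
by rewrite gerBl divr_ge0 // exprn_ge0.
Qed.

Lemma mes_fibers_le a b (I : eqType) (J : R -> I) (s : seq I) : a < b -> uniq s ->
  (forall i, i \in s -> lebesgue_measurable (fiber a b J i)) ->
  \sum_(i <- s) mes (fiber a b J i) <= b - a.
Proof.
move=> ab us ms; under eq_bigr do rewrite -[mes _]mul1r.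
apply: (@HK_integral_ge_sum _ _ _ J _ (fun=> 1) (fun=> 1)) => //.
by rewrite -[b - a]mul1r; exact: is_HK_integral_cst.
Qed.

(** The bounds C are needed on negligible fibres, where the step function c
    carries no information about g. *)
Definition upper_step a b g e (J : R -> nat) (c C : nat -> R) := forall i,
  [/\ 0 <= c i, forall t, fiber a b J i t -> g t <= C i
    & mes (fiber a b J i) != 0 -> forall t, fiber a b J i t -> g t <= c i + e].

(** Upper bounds: although the upper Lebesgue sum may be infinite, a partition
    has finitely many tags and so meets finitely many fibres.  The gauge depends
    on the bounds C only, so that it serves a whole family of functions. *)
Lemma riemann_le_gauge a b e (J : R -> nat) (C : nat -> R) eta :
  0 < eta -> 0 <= e -> a < b ->
  (forall i, lebesgue_measurable (fiber a b J i)) -> (forall i, 0 <= C i) ->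
  exists d : R -> R, (forall t, 0 < d t) /\
    forall P, perron_in a b P -> fine_partition d P -> exists N, forall g c,
      upper_step a b g e J c C ->
      riemann g P <= \sum_(i <- iota 0 N) c i * mes (fiber a b J i) + e * (b - a) + eta.
Proof.
move=> eta0 e0 ab mJ C0.
pose eta_ i : R := eta / 2 ^+ i.+1 / (C i + 1).
have C1 i : 0 < C i + 1 by rewrite ltr_wpDl.
have eta_0 i : 0 < eta_ i by rewrite !divr_gt0 // exprn_gt0.
have [d [d0 hd]] := outer_gauge a b J eta_0.
exists d; split=> // P iP fP.
pose N := (\max_(p <- P) (J (tagpt p)).+1)%N; exists N => g c gc.
have JN p : p \in P -> J (tagpt p) \in iota 0 N.
  by move=> pP; rewrite mem_iota add0n /= /N; apply: (@leq_bigmax_seq _ P xpredT (fun p => (J (tagpt p)).+1)).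
pose D i := if mes (fiber a b J i) == 0 then C i else Num.min (C i) (c i + e).
have gD i t : i \in iota 0 N -> fiber a b J i t -> g t <= D i.
  move=> _ Jt; have [c0 gC gce] := gc i; rewrite /D.
  by case: eqP gce => [_ _|_ gce]; rewrite ?gC // le_min gC //= gce.
apply: (le_trans (riemann_le (iota_uniq _ _) iP JN gD)).
have hs : \sum_(i <- iota 0 N) mes (fiber a b J i) <= b - a.
  by apply: mes_fibers_le => //; exact: iota_uniq.
have := sum_half_le N (ltW eta0).
have : \sum_(i <- iota 0 N) e * mes (fiber a b J i) <= e * (b - a).
  by rewrite -mulr_sumr ler_wpM2l.
move=> h1 h2; apply: (le_trans _ (lerD (lerD (lexx _) h1) h2)).
rewrite -!big_split /= ler_sum // => i _.
have [c0 _ _] := gc i; have := hd P iP fP i.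
set T := tagged_length J i P; set m := mes _ => hT.
have m0 : 0 <= m by exact: mes_ge0.
have T0 : 0 <= T.
  by rewrite /T big_seq_cond sumr_ge0 // => p /andP[/iP.1[q1 q2 q3 q4] _]; rewrite /itv_length; lra.
have Ce : C i * eta_ i <= eta / 2 ^+ i.+1.
  rewrite /eta_ mulrCA ger_pMr ?divr_gt0 ?exprn_gt0 // ler_pdivrMr // mul1r lerDl //.
rewrite /D -/m; case: (eqVneq m 0) => [m00|_].
  rewrite m00 add0r in hT; rewrite m00 !mulr0 !add0r.
  by apply: le_trans Ce; rewrite ler_wpM2l.
set D' := Num.min _ _.
have D0 : 0 <= D' by rewrite le_min C0 addr_ge0.
have DC : D' <= C i by rewrite ge_min lexx.
have Dc : D' <= c i + e by rewrite ge_min lexx orbT.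
apply: (@le_trans _ _ (D' * m + D' * eta_ i)).
  by rewrite -mulrDr ler_wpM2l.
rewrite -mulrDl lerD //; first by rewrite ler_wpM2r.
by apply: le_trans Ce; rewrite ler_wpM2r // ltW.
Qed.

(** Comparison with an integrable function: the Riemann sums of fine partitions
    are squeezed between a finite lower Lebesgue sum, bounded by the integral of
    h, and the corresponding upper sum.  The step bounds, available for every e,
    play the part of the measurability of g. *)
Lemma HK_integrable_step a b g h w : a < b ->
  (forall t, a <= t <= b -> 0 <= g t <= h t) -> is_HK_integral a b h w ->
  (forall e, 0 < e -> exists J c C,
    [/\ forall i, lebesgue_measurable (fiber a b J i),
        forall i t, fiber a b J i t -> c i <= g t,
        forall i, 0 <= C i
      & upper_step a b g e J c C]) ->
  HK_integrable a b g.
Proof.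
move=> ab gh hw step.
have band e : exists S : R, 0 < e -> forall eta, 0 < eta -> exists d : R -> R,
    (forall t, 0 < d t) /\ forall P, perron_of a b P -> fine_partition d P ->
    S - eta <= riemann g P <= S + e * (b - a) + eta.
  have [e0|e0] := ltP 0 e; last by exists 0.
  have [J [c [C [mJ cg C0 gC]]]] := step _ e0.
  pose sig N := \sum_(i <- iota 0 N) c i * mes (fiber a b J i).
  have c0 i : 0 <= c i by have [] := gC i.
  have sw N : sig N <= w.
    apply: (HK_integral_ge_sum ab (iota_uniq 0 N) (g := h)) => //.
      by move=> t /gh; lra.
    by move=> i t _ Jt; apply: (le_trans (cg i t Jt)); have /gh/andP[] := Jt.1.
  have hS : has_sup (range sig).
    by split; [exists (sig 0%N); exists 0%N|exists w => _ [N _ <-]].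
  exists (sup (range sig)) => _ eta eta0; have eta2 : 0 < eta / 2 by rewrite divr_gt0.
  have [_ [N _ <-] hN] := sup_adherent eta2 hS.
  pose K := \sum_(i <- iota 0 N) c i + 1.
  have K0 : 0 < K by rewrite ltr_wpDl // sumr_ge0.
  have [d [d0 hd]] := @inner_gauge a b _ J (iota 0 N) _ (divr_gt0 eta2 K0) (fun i _ => mJ i).
  have [d' [d'0 hd']] := riemann_le_gauge eta0 (ltW e0) ab mJ C0.
  exists (fun t => Num.min (d t) (d' t)); split=> [t|P oP]; first by rewrite lt_min d0 d'0.
  move=> /fine_partition_min[fd fd']; apply/andP; split.
    apply: le_trans (riemann_ge (iota_uniq 0 N) oP.1 _ (fun i t _ => cg i t)); last first.
      by move=> t /gh/andP[].
    apply: (@le_trans _ _ (\sum_(i <- iota 0 N) c i * (mes (fiber a b J i) - eta / 2 / K))).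
      under [leRHS]eq_bigr do rewrite mulrBr.
      rewrite sumrB -mulr_suml.
      have : (\sum_(i <- iota 0 N) c i) * (eta / 2 / K) <= eta / 2.
        by rewrite mulrCA ger_pMr // ler_pdivrMr // mul1r lerDl.
      by move: hN; rewrite -/(sig N); lra.
    rewrite big_seq [leRHS]big_seq ler_sum // => i si; rewrite ler_wpM2l ?c0 //; exact: hd.
  have [M hM] := hd' P oP.1 fd'.
  apply: (le_trans (hM g c gC)); rewrite !lerD2r.
  by apply: sup_upper_bound => //; exists M.
have [S {}band] := choice band.
have SS e e' : 0 < e -> 0 < e' -> S e <= S e' + e' * (b - a).
  move=> e0 e'0; apply/ler_addgt0Pr => eta eta0; have eta2 : 0 < eta / 2 by rewrite divr_gt0.
  have [d [d0 hd]] := band e e0 _ eta2; have [d' [d'0 hd']] := band e' e'0 _ eta2.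
  have [P [oP /fine_partition_min[fd fd']]] := cousin ab (gauge_min (fun t _ => d0 t) (fun t _ => d'0 t)).
  have /andP[h1 h2] := hd P oP fd; have /andP[h3 h4] := hd' P oP fd'; lra.
pose v := sup [set S e | e in [set e | 0 < e]].
have hS : has_sup [set S e | e in [set e | 0 < e]].
  split; first by exists (S 1); exists 1 => /=.
  by exists (S 1 + 1 * (b - a)) => _ [e /= e0 <-]; exact: SS.
exists v => eps eps0.
have ba : 0 < b - a by rewrite subr_gt0.
have ba1 : 0 < b - a + 1 by rewrite ltr_wpDl // ltW.
pose e := eps / 2 / (b - a + 1); have e0 : 0 < e by rewrite !divr_gt0.
have eb : e * (b - a) < eps / 2.
  by rewrite /e -mulrA gtr_pMr ?divr_gt0 // mulrC ltr_pdivrMr // mul1r ltrDl.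
have [d [d0 hd]] := band e e0 _ (divr_gt0 eps0 (@ltr0Sn _ 1)).
exists d; split=> [t _ //|P oP fP]; have /andP[h1 h2] := hd P oP fP.
have Sv : S e <= v by apply: sup_upper_bound => //; exists e.
have vS : v <= S e + e * (b - a).
  by apply: ge_sup; [case: hS|move=> _ [e' /= e'0 <-]; exact: SS].
rewrite ltr_norml; lra.
Qed.

End GaugesFromMeasure.

(** * Interval functions of negligible variation *)

Section NullVariation.
Context {R : realType} (K : Type).
Implicit Types (om : K -> R * R * R -> R) (E : set R) (P : seq (R * R * R)).

(** The parameter k lets a single gauge serve a whole family of functions of
    tagged intervals. *)
Definition variation_le om E (eta : R) := exists d : R -> R, (forall t, 0 < d t) /\
  forall P k, perron_in 0 1 P -> fine_partition d P ->
    (forall p, p \in P -> E (tagpt p)) -> \sum_(p <- P) om k p <= eta.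

Definition null_variation om E := forall eta, 0 < eta -> variation_le om E eta.

Lemma variation_le_sub om E E' eta eta' : E `<=` E' -> eta' <= eta ->
  variation_le om E' eta' -> variation_le om E eta.
Proof.
move=> EE ee [d [d0 hd]]; exists d; split=> // P k iP fP EP.
by apply: le_trans ee; apply: hd => // p /EP /EE.
Qed.

Lemma null_variation_sub om E E' : E `<=` E' -> null_variation om E' -> null_variation om E.
Proof. by move=> EE h eta /h; exact: variation_le_sub. Qed.

Lemma variation_le_fun om om' E eta :
  (forall k p, 0 <= lft p -> lft p < rgt p -> rgt p <= 1 -> lft p <= tagpt p <= rgt p ->
    E (tagpt p) -> om k p <= om' k p) ->
  variation_le om' E eta -> variation_le om E eta.
Proof.
move=> oo [d [d0 hd]]; exists d; split=> // P k iP fP EP.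
apply: le_trans (hd P k iP fP EP); rewrite big_seq [leRHS]big_seq ler_sum // => p pP.
by have [h1 h2 h3 h4] := iP.1 p pP; apply: oo => //; exact: EP.
Qed.

Lemma null_variation_fun om om' E :
  (forall k p, 0 <= lft p -> lft p < rgt p -> rgt p <= 1 -> lft p <= tagpt p <= rgt p ->
    E (tagpt p) -> om k p <= om' k p) ->
  null_variation om' E -> null_variation om E.
Proof. by move=> oo h eta /h; exact: variation_le_fun. Qed.

Lemma variation_leD om om' E eta eta' : variation_le om E eta ->
  variation_le om' E eta' -> variation_le (fun k p => om k p + om' k p) E (eta + eta').
Proof.
move=> [d [d0 hd]] [d' [d'0 hd']]; exists (fun t => Num.min (d t) (d' t)).
split=> [t|P k iP /fine_partition_min[fd fd'] EP]; first by rewrite lt_min d0 d'0.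
by rewrite big_split lerD ?hd ?hd'.
Qed.

(** Each point is assigned to one of the sets and gets the gauge of that set for
    the error eta / 2 ^ (i + 1). *)
Lemma null_variation_bigcup om (E : nat -> set R) :
  (forall i, null_variation om (E i)) -> null_variation om (\bigcup_i E i).
Proof.
move=> nE eta eta0.
have eta_0 i : 0 < eta / 2 ^+ i.+1 by rewrite divr_gt0 ?exprn_gt0.
have [d hd] := choice (fun i => nE i _ (eta_0 i)).
have hJ t : exists i, (\bigcup_i E i) t -> E i t.
  by have [[i _ Ei]|nE'] := pselect ((\bigcup_i E i) t); [exists i|exists 0%N].
have [J {}hJ] := choice hJ.
exists (fun t => d (J t) t); split=> [t|P k iP fP EP]; first by have [] := hd (J t).
pose N := (\max_(p <- P) (J (tagpt p)).+1)%N.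
have JN p : p \in P -> J (tagpt p) \in iota 0 N.
  by move=> pP; rewrite mem_iota add0n /= /N; apply: (@leq_bigmax_seq _ P xpredT (fun p => (J (tagpt p)).+1)).
rewrite [leLHS](@sum_by_tag R _ J _ _ _ (iota_uniq 0 N)) //.
apply: le_trans (sum_half_le N (ltW eta0)); apply: ler_sum => i _.
rewrite -big_filter; have [_] := hd i; apply; first exact: perron_in_filter.
  move=> p; rewrite mem_filter => /andP[/eqP <- pP] x /(fP p pP).
  by [].
by move=> p; rewrite mem_filter => /andP[/eqP <- /EP /hJ].
Qed.

Lemma null_variation_set0 om : null_variation om set0.
Proof.
move=> eta eta0; exists (fun=> 1); split=> // -[|p P] k _ _ h.
  by rewrite big_nil ltW.
by have := h p (mem_head _ _).
Qed.

Lemma null_variation_bigcup_count om (I : countType) (D : set I) (E : I -> set R) :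
  (forall i, D i -> null_variation om (E i)) -> null_variation om (\bigcup_(i in D) E i).
Proof.
move=> nE.
pose W n : set R := if unpickle n is Some i then [set t | D i /\ E i t] else set0.
apply: (@null_variation_sub _ _ (\bigcup_n W n)).
  by move=> t [i Di Eit]; exists (pickle i) => //; rewrite /W pickleK.
apply: null_variation_bigcup => n; rewrite /W.
case: unpickle => [i|]; last exact: null_variation_set0.
have [Di|nDi] := pselect (D i); first by apply: null_variation_sub (nE i Di) => t [].
by apply: null_variation_sub (@null_variation_set0 om) => t [].
Qed.

Lemma variation_leU om E E' eta eta' : variation_le om E eta ->
  variation_le om E' eta' -> variation_le om (E `|` E') (eta + eta').
Proof.
move=> [d [d0 hd]] [d' [d'0 hd']].
exists (fun t => if t \in E then d t else d' t); split=> [t|P k iP fP EP].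
  by case: ifP.
rewrite (bigID (fun p => tagpt p \in E)) /= lerD //.
  rewrite -big_filter; apply: hd; first exact: perron_in_filter.
    by move=> p; rewrite mem_filter => /andP[pE pP] x /(fP p pP); rewrite pE.
  by move=> p; rewrite mem_filter => /andP[/set_mem].
rewrite -big_filter; apply: hd'; first exact: perron_in_filter.
  by move=> p; rewrite mem_filter => /andP[/negbTE pE pP] x /(fP p pP); rewrite pE.
by move=> p; rewrite mem_filter => /andP[/negP pE /EP[/mem_set//|]].
Qed.

Lemma null_variationU om E E' : null_variation om E -> null_variation om E' ->
  null_variation om (E `|` E').
Proof.
move=> nE nE' eta eta0; rewrite (splitr eta).
by apply: variation_leU; [apply: nE|apply: nE']; rewrite divr_gt0.
Qed.

(** On the part of N where M is at most i + 1, intervals of a fine partition have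
    small total length. *)
Lemma null_variation_length (N : set R) (M : R -> R) : N `<=` `[0, 1]%classic ->
  lambda N = 0%E -> null_variation (fun _ p => M (tagpt p) * itv_length p) N.
Proof.
move=> N01 N0.
pose E i := [set t | N t /\ M t <= i.+1%:R].
apply: (@null_variation_sub _ _ (\bigcup_i E i)).
  move=> t Nt; exists (Num.truncn (M t)) => //; split=> //.
  by rewrite ltW // truncnS_gt.
apply: null_variation_bigcup => i eta eta0.
pose J (t : R) : nat := if t \in E i then 0%N else 1%N.
have e0 : 0 < eta / i.+1%:R by rewrite divr_gt0.
have [d [d0 hd]] := @outer_gauge R 0 1 J (fun=> eta / i.+1%:R) (fun _ => e0).
exists d; split=> // P k iP fP EP.
have J0 p : p \in P -> J (tagpt p) = 0%N by move=> /EP /mem_set; rewrite /J => ->.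
have f0 : lambda (fiber 0 1 J 0%N) = 0%E.
  apply/eqP; rewrite eq_le lambda_ge0 andbT -N0; apply: lambda_le => t [_].
  by rewrite /J; case: ifP => // /set_mem[].
have := hd P iP fP 0%N; rewrite f0 /= add0r => h.
apply: (@le_trans _ _ (\sum_(p <- P | J (tagpt p) == 0%N) i.+1%:R * itv_length p)).
  rewrite big_seq [leRHS]big_seq_cond.
  rewrite [leRHS](eq_bigl (fun p => p \in P)); last first.
    by move=> p; apply: andb_idr => /J0 ->.
  apply: ler_sum => p pP; have [h1 h2 h3 h4] := iP.1 p pP.
  by rewrite ler_wpM2r ?(EP p pP).2 // /itv_length; lra.
by rewrite -mulr_sumr mulrC -ler_pdivlMr.
Qed.

End NullVariation.

(** * A Baire category argument on closed subsets of the line *)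

Section Baire.
Context {R : realType}.
Implicit Types (E Z : set R) (x r : R).

(** The V n shrink to a null set containing a countable dense subset of E. *)
Lemma null_comeagre E : exists V : nat -> set R,
  [/\ forall n, open (V n),
      forall n x r, E x -> 0 < r -> exists y, [/\ E y, V n y & `|y - x| < r]
    & lambda (\bigcap_n V n) = 0%E].
Proof.
have hpick (q : rat * rat) : exists y : R, (exists x, E x /\ ratr q.1 < x < ratr q.2) ->
    E y /\ ratr q.1 < y < ratr q.2.
  by have [[y hy]|h] := pselect (exists x, E x /\ ratr q.1 < x < ratr q.2); [exists y|exists 0].
have [pick_ {}hpick] := choice hpick.
pose D := range pick_.
have D0 : lambda D = 0%E.
  rewrite lambda_borel; apply: countable_lebesgue_measure0.
  by apply: (sub_countable (card_image_le _ _)); exact: countableP.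
have [V [oV DV V0]] := null_Gdelta D0; exists V; split=> //.
move=> n x r Ex r0.
have [|a] := @rat_in_itvoo R (x - r) x; first by lra.
rewrite in_itv /= => /andP[a1 a2].
have [|b] := @rat_in_itvoo R x (x + r); first by lra.
rewrite in_itv /= => /andP[b1 b2].
have [|Ey /andP[y1 y2]] := hpick (a, b); first by exists x; rewrite a2 b1.
exists (pick_ (a, b)); split=> //; first by apply: DV; exists (a, b).
by rewrite ltr_norml; move: y1 y2 => /=; lra.
Qed.

(** Otherwise one could choose nested intervals centred in E, the n-th one inside
    V n and away from Z n; their common point would contradict the inclusion. *)
Lemma baire_closed E (V Z : nat -> set R) : closed E -> E !=set0 ->
  (forall n, open (V n)) ->
  (forall n x r, E x -> 0 < r -> exists y, [/\ E y, V n y & `|y - x| < r]) ->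
  E `&` \bigcap_n V n `<=` \bigcup_n Z n ->
  exists n x r, [/\ E x, 0 < r & forall y s, E y -> `|y - x| < r -> 0 < s ->
    exists z, Z n z /\ `|z - y| < s].
Proof.
move=> cE [x0 Ex0] oO dO EOZ; apply: contrapT => H.
pose nxt n (q q' : R * R) := [/\ E q'.1, 0 < q'.2, q'.2 <= n.+1%:R^-1
  & forall w, `|w - q'.1| <= q'.2 -> [/\ `|w - q.1| <= q.2, V n w & ~ Z n w]].
have step (nq : nat * (R * R)) : exists q', E nq.2.1 -> 0 < nq.2.2 -> nxt nq.1 nq.2 q'.
  case: nq => n [x r] /=; have [[Ex r0]|h] := pselect (E x /\ 0 < r); last first.
    by exists (x, r) => Ex r0; case: h.
  have [y [s [Ey yx s0 hZ]]] : exists y s, [/\ E y, `|y - x| < r, 0 < s &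
      forall z, Z n z -> s <= `|z - y|].
    apply: contrapT => h; apply: H; exists n, x, r; split=> // y s Ey yx s0.
    apply: contrapT => h'; apply: h; exists y, s; split=> // z Zz.
    by rewrite leNgt; apply/negP => zy; apply: h'; exists z.
  pose r1 := Num.min s (r - `|y - x|).
  have r10 : 0 < r1 by rewrite lt_min s0 subr_gt0.
  have [y' [Ey' Oy' yy']] := dO n y r1 Ey r10.
  have [rho rho0 hrho] := open_radius (oO n) Oy'.
  pose r2 := Num.min (rho / 2) (Num.min ((r1 - `|y' - y|) / 2) n.+1%:R^-1).
  have r20 : 0 < r2 by rewrite !lt_min !divr_gt0 ?subr_gt0 //= invr_gt0.
  have r2rho : r2 <= rho / 2 by rewrite ge_min lexx.
  have r2r1 : r2 <= (r1 - `|y' - y|) / 2 by rewrite !ge_min lexx !orbT.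
  have r1s : r1 <= s by rewrite ge_min lexx.
  have r1r : r1 <= r - `|y - x| by rewrite ge_min lexx orbT.
  exists (y', r2) => _ _; split=> //=; first by rewrite !ge_min lexx !orbT.
  move=> w wy'.
  have wy : `|w - y| < r1.
    rewrite (le_lt_trans (ler_distD y' _ _)) //; lra.
  split; first by rewrite (le_trans (ler_distD y _ _)) //; lra.
    by apply: hrho; move: wy'; rewrite ler_norml => /andP[]; lra.
  by move=> /hZ; lra.
have [f hf] := choice step.
pose q := fix q n := if n is n'.+1 then f (n', q n') else (x0, 1 : R).
have hq n : E (q n).1 /\ 0 < (q n).2.
  elim: n => [|n [h1 h2]]; first by split.
  by have [h3 h4 _ _] := hf (n, q n) h1 h2.
have nq n : nxt n (q n) (q n.+1) by have [h1 h2] := hq n; exact: hf (n, q n) h1 h2.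
have nest m n w : (m <= n)%N -> `|w - (q n).1| <= (q n).2 -> `|w - (q m).1| <= (q m).2.
  elim: n => [|n IH]; first by rewrite leqn0 => /eqP ->.
  rewrite leq_eqVlt => /predU1P[->//|]; rewrite ltnS => /IH {}IH hw.
  by apply: IH; have [_ _ _ /(_ _ hw)[]] := nq n.
pose S := range (fun n => (q n).1 - (q n).2).
have Sub m : ubound S ((q m).1 + (q m).2).
  move=> _ [n _ <-].
  have h1 k : `|(q k).1 - (q k).2 - (q k).1| <= (q k).2.
    by rewrite addrC addKr normrN gtr0_norm // (hq k).2.
  have [mn|nm] := leqP m n.
    by have := nest _ _ _ mn (h1 n); rewrite ler_norml => /andP[]; lra.
  have h2 : `|(q m).1 - (q m).1| <= (q m).2 by rewrite subrr normr0 ltW // (hq m).2.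
  have := nest _ _ _ (ltnW nm) h2; rewrite ler_norml => /andP[h3 h4].
  have := (hq m).2; lra.
have hS : has_sup S by split; [exists ((q 0%N).1 - (q 0%N).2); exists 0%N|exists ((q 0%N).1 + (q 0%N).2); exact: Sub].
pose w := sup S.
have hw n : `|w - (q n).1| <= (q n).2.
  rewrite ler_norml; apply/andP; split.
    have : (q n).1 - (q n).2 <= w by apply: sup_upper_bound => //; exists n.
    lra.
  have : w <= (q n).1 + (q n).2 by apply: ge_sup; [case: hS|exact: Sub].
  lra.
have Ew : E w.
  apply: contrapT => nEw; have [e e0 he] := open_radius (closed_openC cE) nEw.
  have [n hn] := inv_nat_small e0.
  apply: (he (q n.+1).1); last by have [] := hq n.+1.
  have [_ _ h2 _] := nq n; have {h2}h2 := le_lt_trans h2 hn.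
  have := hw n.+1; rewrite ler_norml; move: (q n.+1) h2 => [u v] /= h2 /andP[h3 h4]; lra.
have [] // := EOZ w.
  by split=> // n _; have [_ _ _ /(_ _ (hw n.+1))[]] := nq n.
by move=> n _; have [_ _ _ /(_ _ (hw n.+1))[]] := nq n.
Qed.

End Baire.

(** * Gaps of a closed set *)

Section Gaps.
Context {R : realType}.
Implicit Types (A : set R) (gm : R * R) (s : seq (R * R)).

Definition gap A c0 d0 gm := [/\ A gm.1, A gm.2, gm.1 < gm.2,
  c0 <= gm.1 <= d0 /\ c0 <= gm.2 <= d0 & forall x, A x -> ~ (gm.1 < x < gm.2)].

Lemma gap_exists A c0 d0 x : closed A -> A c0 -> A d0 -> c0 <= x <= d0 -> ~ A x ->
  exists gm, gap A c0 d0 gm /\ gm.1 < x < gm.2.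
Proof.
move=> cA Ac Ad /andP[cx xd] nAx.
have [e e0 he] := open_radius (closed_openC cA) nAx.
pose L := A `&` [set y | c0 <= y <= x]; pose U := A `&` [set y | x <= y <= d0].
have hL : has_sup L by split; [exists c0; split=> //=; rewrite lexx|exists x => y [_ /andP[]]].
have hU : has_inf U by split; [exists d0; split=> //=; rewrite lexx andbT|exists x => y [_ /andP[]]].
have AL : A (sup L).
  apply: contrapT => nA; have [r r0 hr] := open_radius (closed_openC cA) nA.
  have [y [Ay yx] hy] := sup_adherent r0 hL.
  have := @sup_upper_bound _ _ hL y (conj Ay yx) => h.
  by apply: (hr y) => //; lra.
have AU : A (inf U).
  apply: contrapT => nA; have [r r0 hr] := open_radius (closed_openC cA) nA.
  have [y [Ay yx] hy] := inf_adherent r0 hU.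
  have := ge_inf hU.2 (conj Ay yx) => h.
  by apply: (hr y) => //; lra.
have sLx : c0 <= sup L <= x.
  rewrite (@sup_upper_bound _ _ hL c0) /=; last by split=> //=; rewrite lexx.
  by apply: ge_sup; [case: hL|move=> y [_ /andP[]]].
have sUx : x <= inf U <= d0.
  apply/andP; split; first by apply: lb_le_inf; [case: hU|move=> y [_ /andP[]]].
  by apply: ge_inf; [case: hU|split=> //=; rewrite lexx andbT].
have nL : sup L <> x by move=> h; apply: nAx; rewrite -h.
have nU : inf U <> x by move=> h; apply: nAx; rewrite -h.
exists (sup L, inf U) => /=; split.
  split=> //=; first by lra.
    by split; lra.
  move=> y Ay /andP[Ly yU]; have [yx|xy] := leP y x.
    have : y <= sup L by apply: sup_upper_bound => //; split=> //=; lra.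
    lra.
  have : inf U <= y by apply: ge_inf; [case: hU|split=> //=; lra].
  lra.
by lra.
Qed.

Lemma gap_disjoint A c0 d0 c1 d1 gm gm' : gap A c0 d0 gm -> gap A c1 d1 gm' ->
  gm != gm' -> (gm.2 <= gm'.1) || (gm'.2 <= gm.1).
Proof.
move: gm gm' => [a b] [a' b'] [/= Aa Ab ab _ gA] [/= Aa' Ab' ab' _ gA'] ne.
have [h1|h1] := leP b a'; first by [].
have [//|h2] := leP b' a.
have ha : ~ (a < a' < b) by exact: gA.
have ha' : ~ (a' < a < b') by exact: gA'.
have hb : ~ (a < b' < b) by exact: gA.
have hb' : ~ (a' < b < b') by exact: gA'.
exfalso; move/eqP: ne; apply; congr (_, _).
  by apply/eqP; rewrite eq_le !leNgt; apply/andP; split; apply/negP => h; [apply: ha'|apply: ha]; rewrite h.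
by apply/eqP; rewrite eq_le !leNgt; apply/andP; split; apply/negP => h; [apply: hb|apply: hb']; rewrite h ?andbT.
Qed.

End Gaps.

Section GapEstimate.
Context {R : realType}.
Implicit Types (A : set R) (gm : R * R) (s : seq (R * R)) (g : R -> R) (F : R -> R -> R).

Notation riemann g P := (\sum_(p <- P) g (tagpt p) * itv_length p).

(** The intervals tagged in one gap are nonoverlapping parts of it, so that their
    total is at most the value of F on this gap. *)
Lemma sum_in_gaps A c0 d0 F (P : seq (R * R * R)) (G : R -> R * R) :
  additive_on c0 d0 F -> (forall u v, c0 <= u -> u < v -> v <= d0 -> 0 <= F u v) ->
  perron_in c0 d0 P ->
  (forall p, p \in P -> [/\ gap A c0 d0 (G (tagpt p)), (G (tagpt p)).1 <= lft p
     & rgt p <= (G (tagpt p)).2]) ->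
  \sum_(p <- P) F (lft p) (rgt p) <=
  \sum_(gm <- undup (map (G \o @tagpt R) P)) F gm.1 gm.2.
Proof.
move=> FA F0 iP hG.
have uG := undup_uniq (map (G \o @tagpt R) P).
rewrite [leLHS](@sum_by_tag R _ G _ _ _ uG); last first.
  by move=> p pP; rewrite mem_undup (map_f (G \o @tagpt R)).
rewrite big_seq [leRHS]big_seq ler_sum // => gm.
rewrite mem_undup => /mapP[q qP /= ->{gm}].
have [[_ _ lt12 [cd1 cd2] _] _ _] := hG q qP.
rewrite -big_filter; apply: perron_in_sum_le => //.
- by apply: additive_on_sub FA; lra.
- by move=> u v h1 h2 h3; apply: F0 => //; lra.
have [mP oP] := perron_in_filter (fun p => G (tagpt p) == G (tagpt q)) iP.
split=> // p pP; have [h1 h2 h3 h4] := mP p pP.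
move: pP; rewrite mem_filter => /andP[/eqP <- pP].
by have [_ h5 h6] := hG p pP.
Qed.

(** A partition of [u, v], fine enough to keep the intervals tagged outside A
    within gaps, splits the integral in two.  Where the tags lie in A the integrand
    is close to c and Saks-Henstock applies; the remaining intervals are bounded by
    the totals over the gaps, where nothing is known about g. *)
Lemma gap_estimate A c0 d0 g F (c e m u v eta : R) :
  closed A -> A c0 -> A d0 -> HK_primitive c0 d0 g F ->
  (forall t, c0 <= t <= d0 -> 0 <= g t) -> 0 <= c <= m -> 0 <= e ->
  (forall t, A t -> `|g t - c| <= e) ->
  c0 <= u -> u < v -> v <= d0 -> 0 < eta ->
  exists s, [/\ uniq s,
    forall gm, gm \in s -> [/\ gap A c0 d0 gm, gm.1 < v & u < gm.2]
    & `|F u v - c * (v - u)| <= e * (v - u) + eta +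
        \sum_(gm <- s) (F gm.1 gm.2 + m * (gm.2 - gm.1))].
Proof.
move=> cA Ac Ad gF g0 cm e0 gc cu uv vd eta0.
have FA := HK_primitive_additive gF.
have F0 x y : c0 <= x -> x < y -> y <= d0 -> 0 <= F x y.
  move=> h1 h2 h3; apply: is_HK_integral_ge0 h2 _ (gF x y h1 h2 h3) => t ht.
  by apply: g0; lra.
have gFuv : HK_primitive u v g F by exact: HK_primitive_sub gF.
have eta2 : 0 < eta / 2 by rewrite divr_gt0.
have [d [gd hd]] := gF u v cu uv vd _ eta2.
have hG t : exists gm, c0 <= t <= d0 -> ~ A t -> gap A c0 d0 gm /\ gm.1 < t < gm.2.
  have [[h1 h2]|h] := pselect (c0 <= t <= d0 /\ ~ A t); last first.
    by exists (0, 0) => h1 h2; case: h.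
  by have [gm hgm] := gap_exists cA Ac Ad h1 h2; exists gm.
have [G {}hG] := choice hG.
pose d' t := if t \in A then d t else Num.min (d t) (Num.min (t - (G t).1) ((G t).2 - t)).
have gd' : gauge u v d'.
  move=> t tuv; rewrite /d'; case: ifPn => [_|/negP tA]; first exact: gd.
  have [|_ h] := hG t _ (fun h => tA (mem_set h)); first by lra.
  by rewrite !lt_min gd //=; lra.
have [P [oP fP']] := cousin uv gd'.
have fP : fine_partition d P.
  apply: fine_partition_le fP' => p _; rewrite /d'.
  by case: ifP => // _; rewrite ge_min lexx.
pose on := [seq p <- P | tagpt p \in A]; pose off := [seq p <- P | tagpt p \notin A].
have ion : perron_in u v on by apply: perron_in_filter; case: oP.
have ioff : perron_in u v off by apply: perron_in_filter; case: oP.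
have split_sum (f : R * R * R -> R) : \sum_(p <- P) f p = \sum_(p <- on) f p + \sum_(p <- off) f p.
  by rewrite (bigID (fun p => tagpt p \in A)) /= !big_filter.
have hoff p : p \in off -> [/\ gap A c0 d0 (G (tagpt p)), (G (tagpt p)).1 <= lft p,
    rgt p <= (G (tagpt p)).2 & (G (tagpt p)).1 < tagpt p < (G (tagpt p)).2].
  move=> pof; have [h1 h2 h3 h4] := ioff.1 p pof.
  move: pof; rewrite mem_filter => /andP[tA pP].
  have [|h5 h6] := hG (tagpt p) _ (fun h => negP tA (mem_set h)); first by lra.
  have hx x : lft p <= x <= rgt p -> (G (tagpt p)).1 < x < (G (tagpt p)).2.
    move=> /(fine_itv fP' pP); rewrite /d' (negbTE tA).
    set t := tagpt p; set a := (G t).1; set b := (G t).2.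
    have : Num.min (d t) (Num.min (t - a) (b - t)) <= t - a by rewrite !ge_min lexx orbT.
    have : Num.min (d t) (Num.min (t - a) (b - t)) <= b - t by rewrite !ge_min lexx !orbT.
    move: (Num.min _ _) => z; lra.
  split=> //; [have := hx (lft p)|have := hx (rgt p)]; lra.
exists (undup (map (G \o @tagpt R) off)); split; first exact: undup_uniq.
  move=> gm; rewrite mem_undup => /mapP[p pof /= ->].
  have [h1 h2 h3 h4] := hoff p pof; have [h5 h6 h7 h8] := ioff.1 p pof.
  by split=> //; lra.
have hon : `|\sum_(p <- on) (g (tagpt p) * itv_length p - F (lft p) (rgt p))| <= eta / 2.
  apply: (Saks_Henstock uv gFuv gd) => //; last exact: fine_partition_filter.
  by move=> Q oQ fQ; apply/ltW/hd.
have hon2 : `|\sum_(p <- on) (g (tagpt p) - c) * itv_length p| <= e * (v - u).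
  apply: (le_trans (ler_norm_sum _ _ _)).
  apply: (@le_trans _ _ (\sum_(p <- on) e * itv_length p)).
    rewrite big_seq [leRHS]big_seq ler_sum // => p pon.
    have [h1 h2 h3 h4] := ion.1 p pon.
    have l0 : 0 <= itv_length p by rewrite /itv_length; lra.
    rewrite normrM (ger0_norm l0) ler_wpM2r // gc //.
    by move: pon; rewrite mem_filter => /andP[/set_mem].
  by rewrite -mulr_sumr ler_wpM2l // perron_in_length_le.
have ioff' : perron_in c0 d0 off.
  by case: ioff => mo oo; split=> // p /mo[h1 h2 h3 h4]; split=> //; lra.
have hoff' p : p \in off -> [/\ gap A c0 d0 (G (tagpt p)), (G (tagpt p)).1 <= lft p
     & rgt p <= (G (tagpt p)).2] by move=> /hoff[].
have B1 := sum_in_gaps FA F0 ioff' hoff'.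
have L0 x y : c0 <= x -> x < y -> y <= d0 -> 0 <= y - x by move=> _ h _; lra.
have B2 := sum_in_gaps (@additive_on_length R c0 d0) L0 ioff' hoff'.
have E1 := perron_of_sum uv (HK_primitive_additive gFuv) oP.
have E2 := perron_of_sum uv (@additive_on_length R u v) oP.
rewrite big_split /= -mulr_sumr.
have P1 : 0 <= \sum_(p <- off) F (lft p) (rgt p).
  by rewrite big_seq sumr_ge0 // => p /ioff'.1[h1 h2 h3 _]; exact: F0.
have P2 : 0 <= \sum_(p <- off) (rgt p - lft p).
  by rewrite big_seq sumr_ge0 // => p /ioff'.1[h1 h2 h3 _]; lra.
have B3 : c * \sum_(p <- off) (rgt p - lft p) <=
   m * \sum_(i <- undup (map (G \o @tagpt R) off)) (i.2 - i.1) by case/andP: cm => c0' cm'; apply: ler_pM.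
have P3 : 0 <= c * \sum_(p <- off) (rgt p - lft p) by case/andP: cm => c0' _; exact: mulr_ge0.
move: hon hon2; rewrite sumrB.
under [X in `|X| <= e * _]eq_bigr do rewrite mulrBl.
rewrite sumrB -mulr_sumr -E1 (split_sum (fun p => F (lft p) (rgt p))).
have -> : c * (v - u) = c * \sum_(p <- on) (rgt p - lft p) + c * \sum_(p <- off) (rgt p - lft p).
  by rewrite -mulrDr -(split_sum (fun p => rgt p - lft p)) E2.
move: B1 P1 B3 P3; rewrite /itv_length; move: (e * (v - u)) => ev.
move: (c * _) (c * \sum_(p <- off) _) (m * _) => x y z.
move: (\sum_(p <- off) F _ _) (\sum_(gm <- undup _) F _ _) => x1 x2.
move: (\sum_(p <- on) F _ _) (\sum_(p <- on) g _ * _) => x3 x4.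
rewrite !ler_norml => B1 P1 B3 P3 /andP[h1 h2] /andP[h3 h4].
apply/andP; split; lra.
Qed.

End GapEstimate.

(** * Variational Henstock integrability of families of functions *)

Lemma sub_mem_pairwise (I : eqType) (r r' : rel I) (s : seq I) :
  (forall x y, x \in s -> y \in s -> r x y -> r' x y) -> pairwise r s -> pairwise r' s.
Proof.
move=> rr; apply: (@sub_in_pairwise _ (mem s)); last exact/allP.
by move=> x y xs ys; exact: rr.
Qed.

Section Core.
Context {R : realType} (T : Type) (g : T -> R -> R) (F : T -> R -> R -> R)
  (phi : R -> R -> R) (M : R -> R).
Context (g0 : forall th (t : R), 0 <= t <= 1 -> 0 <= g th t).
Context (M_ge0 : forall t : R, 0 <= t <= 1 -> 0 <= M t).
Context (gM : forall th (t : R), 0 <= t <= 1 -> g th t <= M t).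
Context (gF : forall th, HK_primitive 0 1 (g th) (F th)).
Context (Fphi : forall th (u v : R), 0 <= u -> u < v -> v <= 1 -> F th u v <= phi u v).
Context (phi_ge0 : forall u v : R, 0 <= u -> u < v -> v <= 1 -> 0 <= phi u v).
Context (phi_mono : forall u v u' v' : R, 0 <= u' -> u' <= u -> u < v -> v <= v' -> v' <= 1 ->
  phi u v <= phi u' v').
Context (phi_null : forall N : set R, N `<=` `[0, 1]%classic -> lebesgue_measurable N ->
  lambda N = 0%E -> null_variation (fun (_ : unit) p => phi (lft p) (rgt p)) N).
Implicit Types (E A : set R) (k : R * R * R -> T) (p : R * R * R) (e : R).

Lemma F_ge0 th u v : 0 <= u -> u < v -> v <= 1 -> 0 <= F th u v.
Proof.
move=> u0 uv v1; apply: is_HK_integral_ge0 uv _ (gF th u0 uv v1) => t ht.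
by apply: g0; lra.
Qed.

(** The index th may depend on the tagged interval: this amounts to taking the
    supremum over th inside the sums. *)
Definition henstock_error k p :=
  `|F (k p) (lft p) (rgt p) - g (k p) (tagpt p) * itv_length p|.

(** On a null set the two terms of the error are small separately: F is dominated
    by phi, whose variation vanishes there, and g by M. *)
Lemma null_variation_null N : N `<=` `[0, 1]%classic -> lebesgue_measurable N ->
  lambda N = 0%E -> null_variation henstock_error N.
Proof.
move=> N01 mN N0 eta eta0; rewrite (splitr eta); have eta2 : 0 < eta / 2 by rewrite divr_gt0.
apply: (variation_le_fun _ (variation_leD (om := fun (_ : R * R * R -> T) p => phi (lft p) (rgt p))
   (om' := fun _ p => M (tagpt p) * itv_length p) _ _)).
- move=> k p h1 h2 h3 h4 _; rewrite /henstock_error.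
  have t01 : 0 <= tagpt p <= 1 by lra.
  have l0 : 0 <= itv_length p by rewrite /itv_length; lra.
  have F0 := F_ge0 (k p) h1 h2 h3; have Fp := Fphi (k p) h1 h2 h3.
  have gl0 : 0 <= g (k p) (tagpt p) * itv_length p by rewrite mulr_ge0 ?g0.
  have glM : g (k p) (tagpt p) * itv_length p <= M (tagpt p) * itv_length p.
    by rewrite ler_wpM2r ?gM.
  rewrite ler_norml; lra.
- have [d [d0 hd]] := phi_null N01 mN N0 eta2.
  by exists d; split=> // P _; exact: hd P tt.
- exact: null_variation_length.
Qed.

Lemma null_variation_set1 c : 0 <= c <= 1 -> null_variation henstock_error [set c].
Proof.
move=> c01; apply: null_variation_null.
- by move=> t ->; rewrite /= in_itv.
- by apply: lebesgue_measurable_borel; exact: measurable_set1.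
- by rewrite lambda_borel lebesgue_measure_set1.
Qed.

Lemma null_variation_seq (xs : seq R) : (forall x, x \in xs -> 0 <= x <= 1) ->
  null_variation henstock_error [set` xs].
Proof.
elim: xs => [_|x xs IH hx].
  by apply: (@null_variation_sub _ _ _ _ [set 0]) => //; apply: null_variation_set1; lra.
apply: (@null_variation_sub _ _ _ _ ([set x] `|` [set` xs])).
  by move=> y /=; rewrite inE => /predU1P.
apply: null_variationU; first by apply: null_variation_set1; apply: hx; exact: mem_head.
by apply: IH => y yxs; apply: hx; rewrite inE yxs orbT.
Qed.

Lemma radius_avoid (s : seq (R * R)) (t : R) :
  (forall gm, gm \in s -> ~ (gm.1 <= t <= gm.2)) -> exists2 r : R, 0 < r &
  forall x, t - r < x < t + r -> forall gm, gm \in s -> ~ (gm.1 <= x <= gm.2).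
Proof.
elim: s => [_|gm s IH hs]; first by exists 1.
have [|r r0 hr] := IH; first by move=> gm' h; apply: hs; rewrite inE h orbT.
have [r' r'0 hr'] : exists2 r' : R, 0 < r' & forall x, t - r' < x < t + r' -> ~ (gm.1 <= x <= gm.2).
  have [tg|gt] := ltP t gm.1; first by exists (gm.1 - t); [lra|move=> x hx; lra].
  have [gt'|tg] := ltP gm.2 t; first by exists (t - gm.2); [lra|move=> x hx; lra].
  by exfalso; apply: (hs gm (mem_head _ _)); rewrite gt tg.
exists (Num.min r r'); first by rewrite lt_min r0.
have h1 : Num.min r r' <= r by rewrite ge_min lexx.
have h2 : Num.min r r' <= r' by rewrite ge_min lexx orbT.
move=> x hx gm'; rewrite inE => /predU1P[->|].
  by apply: hr'; move: hx h2; move: (Num.min r r') => z; lra.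
by apply: hr; move: hx h1; move: (Num.min r r') => z; lra.
Qed.

Definition henstock_excess e k p := henstock_error k p - 2 * e * itv_length p.

Lemma null_variation_excess e E : 0 <= e -> null_variation henstock_error E ->
  null_variation (henstock_excess e) E.
Proof.
move=> e0; apply: null_variation_fun => k p h1 h2 h3 _ _.
rewrite /henstock_excess lerBlDr lerDl !mulr_ge0 // /itv_length; lra.
Qed.

(** A bound for the contribution of a gap to the errors, cf. gap_estimate. *)
Definition gap_weight c0 (gm : R * R) := phi gm.1 gm.2 + M c0 * (gm.2 - gm.1).

Lemma length_split (c : R) (P : seq (R * R * R)) : perron_in 0 1 P ->
  \sum_(p <- P | tagpt p < rgt p) c * (rgt p - tagpt p) +
  \sum_(p <- P | lft p < tagpt p) c * (tagpt p - lft p) = c * \sum_(p <- P) itv_length p.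
Proof.
move=> iP; rewrite big_mkcond [X in _ + X]big_mkcond -big_split /= mulr_sumr.
rewrite big_seq [RHS]big_seq; apply: eq_bigr => p pP; have [h1 h2 h3 /andP[h4 h5]] := iP.1 p pP.
rewrite !lt_neqAle h4 h5 !andbT /itv_length.
case: (eqVneq (tagpt p) (rgt p)) => [->|_] /=.
  by case: (eqVneq (lft p) (rgt p)) => [->|_] /=; rewrite ?subrr ?mulr0 add0r.
by case: (eqVneq (lft p) (tagpt p)) => [->|_] /=; ring.
Qed.

(** Splitting the tagged intervals at their tags, so that each tag becomes an
    end point. *)
Lemma henstock_error_split (c0 : R) e k (P : seq (R * R * R)) : perron_in 0 1 P ->
  (forall p, p \in P -> `|g (k p) (tagpt p) - g (k p) c0| <= e) ->
  \sum_(p <- P) henstock_error k p <=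
    \sum_(p <- P | tagpt p < rgt p) `|F (k p) (tagpt p) (rgt p) - g (k p) c0 * (rgt p - tagpt p)| +
    \sum_(p <- P | lft p < tagpt p) `|F (k p) (lft p) (tagpt p) - g (k p) c0 * (tagpt p - lft p)| +
    e * \sum_(p <- P) itv_length p.
Proof.
move=> iP gA; rewrite [X in X + _ + _]big_mkcond [X in _ + X + _]big_mkcond /=.
rewrite mulr_sumr -!big_split /=.
rewrite big_seq [leRHS]big_seq; apply: ler_sum => p pP.
have [h1 h2 h3 /andP[h4 h5]] := iP.1 p pP.
have FA := HK_primitive_additive (gF (k p)).
have l0 : 0 <= itv_length p by rewrite /itv_length subr_ge0 ltW.
have := ler_wpM2r l0 (gA p pP).
rewrite -{1}(ger0_norm l0) -normrM mulrBl /henstock_error distrC => h6.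
apply: (@le_trans _ _ (`|F (k p) (lft p) (rgt p) - g (k p) c0 * itv_length p| + e * itv_length p)).
  by apply: (le_trans _ (lerD (lexx _) h6)); apply: (le_trans _ (ler_normD _ _)); rewrite addrA subrK.
rewrite lerD2r !lt_neqAle h4 h5 !andbT /itv_length.
case: (eqVneq (tagpt p) (rgt p)) => [->|tr] /=.
  by rewrite (lt_eqF h2) /= add0r.
case: (eqVneq (lft p) (tagpt p)) => [->|lt] /=; first by rewrite addr0.
rewrite (FA (lft p) (tagpt p) (rgt p)) ?lt_neqAle ?lt ?tr //.
apply: (le_trans _ (ler_normD _ _)); set c := g (k p) c0.
have -> : c * (rgt p - lft p) = c * (rgt p - tagpt p) + c * (tagpt p - lft p) by ring.
by rewrite [F _ (lft p) _ + _]addrC addrACA -opprD.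
Qed.

(** The half-intervals [lo p, hi p] meet each gap at most once and avoid the
    gaps in s0; the errors on them are controlled by the weights of gaps not
    in s0. *)
Lemma half_interval_sum A c0 d0 e (s0 : seq (R * R)) (P : seq (R * R * R)) (lo hi : R * R * R -> R) k (eta mu_ : R) :
  closed A -> A c0 -> A d0 -> 0 <= c0 -> c0 < d0 -> d0 <= 1 -> 0 <= e ->
  (forall t t' th, A t -> A t' -> `|g th t - g th t'| <= e) ->
  0 < eta ->
  (forall p, p \in P -> [/\ c0 <= lo p, lo p < hi p & hi p <= d0]) ->
  pairwise (fun p q => `[< forall gm, gap A c0 d0 gm -> gm.1 < hi p -> lo p < gm.2 ->
     gm.1 < hi q -> lo q < gm.2 -> False >]) P ->
  (forall p gm, p \in P -> gap A c0 d0 gm -> gm.1 < hi p -> lo p < gm.2 -> gm \notin s0) ->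
  (forall s, uniq s -> (forall gm, gm \in s -> gap A c0 d0 gm) ->
     (forall gm, gm \in s -> gm \notin s0) -> \sum_(gm <- s) gap_weight c0 gm <= mu_) ->
  \sum_(p <- P) `|F (k p) (lo p) (hi p) - g (k p) c0 * (hi p - lo p)| <=
  \sum_(p <- P) (e + eta) * (hi p - lo p) + mu_.
Proof.
move=> cA Ac Ad c00 cd d01 e0 osc eta0 loP pwP ns0 hmu.
have hs p : exists s, p \in P -> [/\ uniq s,
    forall gm, gm \in s -> [/\ gap A c0 d0 gm, gm.1 < hi p & lo p < gm.2]
    & `|F (k p) (lo p) (hi p) - g (k p) c0 * (hi p - lo p)| <=
      (e + eta) * (hi p - lo p) + \sum_(gm <- s) gap_weight c0 gm].
  have [pP|_] := boolP (p \in P); last by exists [::].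
  have [h1 h2 h3] := loP p pP.
  have gF' : HK_primitive c0 d0 (g (k p)) (F (k p)) by apply: HK_primitive_sub (gF (k p)).
  have g0' (t : R) : c0 <= t <= d0 -> 0 <= g (k p) t by move=> h; apply: g0; lra.
  have cm : 0 <= g (k p) c0 <= M c0 by rewrite g0 ?gM; lra.
  have osc' t : A t -> `|g (k p) t - g (k p) c0| <= e by move=> At; exact: osc.
  have eta' : 0 < eta * (hi p - lo p) by rewrite mulr_gt0 // subr_gt0.
  have [s [us hs bs]] := gap_estimate cA Ac Ad gF' g0' cm e0 osc' h1 h2 h3 eta'.
  exists s => _; split=> //; apply: (le_trans bs); rewrite mulrDl lerD2l.
  rewrite big_seq [leRHS]big_seq ler_sum // => gm /hs[[_ _ lt12 [i1 i2] _] _ _].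
  by rewrite /gap_weight lerD2r Fphi //; lra.
have [s {}hs] := choice hs.
apply: (@le_trans _ _ (\sum_(p <- P) ((e + eta) * (hi p - lo p) + \sum_(gm <- s p) gap_weight c0 gm))).
  by rewrite big_seq [leRHS]big_seq ler_sum // => p /hs[].
rewrite big_split lerD2l /= -[leLHS](big_map s xpredT (fun x => \sum_(gm <- x) gap_weight c0 gm)) -big_flatten.
apply: hmu.
- elim: P pwP hs {loP ns0} => // p P IH /= /andP[/allP pP pwP] hs.
  have [us_ hp _] := hs p (mem_head _ _).
  rewrite cat_uniq us_ IH // ?andbT; last by move=> q qP; apply: hs; rewrite inE qP orbT.
  apply/hasPn => gm /flatten_mapP[q qP gq]; apply/negP => gp.
  have [h1 h2 h3] := hp gm gp.
  have [_ hq _] := hs q (mem_behead (s := p :: P) qP); have [_ h5 h6] := hq gm gq.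
  by have /asboolP /(_ gm h1 h2 h3 h5 h6) := pP q qP.
- by move=> gm /flatten_mapP[p pP gp]; have [_ /(_ gm gp)[]] := hs p pP.
- move=> gm /flatten_mapP[p pP gp]; have [_ /(_ gm gp)[h1 h2 h3] _] := hs p pP.
  exact: ns0 pP h1 h2 h3.
Qed.

(** All but finitely many gaps have a small total weight.  The end points of the
    remaining ones form a null set, and away from them a fine enough gauge keeps
    the intervals tagged in A off these gaps.  Tags are not interior to gaps: once
    the intervals are split at their tags, two right halves, or two left halves, do
    not meet the same gap, so that each weight is counted once for each side. *)
Lemma null_variation_gap_sums A c0 d0 e (B : R) :
  closed A -> A `<=` `[c0, d0]%classic -> A c0 -> A d0 ->
  0 <= c0 -> c0 < d0 -> d0 <= 1 -> 0 <= e ->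
  (forall t t' th, A t -> A t' -> `|g th t - g th t'| <= e) ->
  (forall s : seq (R * R), uniq s -> (forall gm, gm \in s -> gap A c0 d0 gm) ->
    \sum_(gm <- s) (phi gm.1 gm.2 + (gm.2 - gm.1)) <= B) ->
  null_variation (henstock_excess e) A.
Proof.
move=> cA A01 Ac Ad c00 cd d01 e0 osc gapB eta eta0; pose m := M c0.
have m0 : 0 <= m by apply: M_ge0; lra.
pose W := [set x | exists s, [/\ uniq s, forall gm, gm \in s -> gap A c0 d0 gm
  & x = \sum_(gm <- s) gap_weight c0 gm]].
have ubW : ubound W ((1 + m) * B).
  move=> _ [s [us hs ->]]; apply: (@le_trans _ _ ((1 + m) * \sum_(gm <- s) (phi gm.1 gm.2 + (gm.2 - gm.1)))).
    rewrite mulr_sumr big_seq [leRHS]big_seq ler_sum // => gm /hs[_ _ lt12 [i1 i2] _].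
    have p0 : 0 <= phi gm.1 gm.2 by apply: phi_ge0 => //; lra.
    have mp0 : 0 <= m * phi gm.1 gm.2 by rewrite mulr_ge0.
    rewrite /gap_weight -/m [leRHS]mulrDr !mulrDl !mul1r; apply: lerD; first by rewrite lerDl.
    by rewrite lerDr subr_ge0 ltW.
  by rewrite ler_wpM2l ?gapB // addr_ge0.
have hW : has_sup W.
  split; last by exists ((1 + m) * B).
  by exists 0; exists [::]; split=> //; rewrite big_nil.
have mu0 : 0 < eta / 8 by rewrite divr_gt0.
(* a finite set of gaps carrying almost all of the total weight *)
have [_ [s0 [us0 hs0 ->]] near_sup] := sup_adherent mu0 hW.
have hmu s : uniq s -> (forall gm, gm \in s -> gap A c0 d0 gm) ->
     (forall gm, gm \in s -> gm \notin s0) -> \sum_(gm <- s) gap_weight c0 gm <= eta / 8.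
  move=> us hs ns.
  have : \sum_(gm <- s ++ s0) gap_weight c0 gm <= sup W.
    apply: sup_upper_bound => //; exists (s ++ s0); split=> //.
      by rewrite cat_uniq us us0 andbT; apply/hasPn => gm gs0; apply/negP => /ns; rewrite gs0.
    by move=> gm; rewrite mem_cat => /orP[/hs|/hs0].
  rewrite big_cat /=; lra.
pose xs := [:: c0, d0 & map fst s0 ++ map snd s0].
have hxs x : x \in xs -> 0 <= x <= 1.
  rewrite !inE mem_cat => /predU1P[->|/predU1P[->|/orP[]/mapP[gm /hs0[_ _ _ [i1 i2] _] ->]]]; lra.
have v1 := null_variation_excess e0 (null_variation_seq hxs).
have eta2 : 0 < eta / 2 by rewrite divr_gt0.
apply: (@variation_le_sub _ _ _ _ ([set` xs] `|` (A `\` [set` xs])) _ (eta / 2 + eta / 2)).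
- by move=> t At; case: (pselect ([set` xs] t)) => ?; [left|right].
- by rewrite -splitr.
apply: variation_leU (v1 _ eta2) _.
have hr t : exists r : R, 0 < r /\ ((A `\` [set` xs]) t -> forall x, t - r < x < t + r ->
    c0 <= x <= d0 /\ forall gm, gm \in s0 -> ~ (gm.1 <= x <= gm.2)).
  have [[At tx]|] := pselect ((A `\` [set` xs]) t); last by exists 1.
  have tc : t <> c0 by move=> h; apply: tx; rewrite /= h mem_head.
  have td : t <> d0 by move=> h; apply: tx; rewrite /= h !inE eqxx orbT.
  have : `[c0, d0]%classic t by exact: A01.
  rewrite /= in_itv /= => tcd.
  have [gm gs ht|r r0 hr] := @radius_avoid s0 t.
    have [_ _ _ _ /(_ t At)] := hs0 _ gs; apply.
    have t1 : t <> gm.1.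
      by move=> h; apply: tx; rewrite /= h !inE mem_cat map_f ?orbT.
    have t2 : t <> gm.2.
      by move=> h; apply: tx; rewrite /= h !inE mem_cat (map_f snd) ?orbT.
    lra.
  exists (Num.min r (Num.min (t - c0) (d0 - t))); split=> [|_ x].
    rewrite !lt_min r0 /=; lra.
  have h1 : Num.min r (Num.min (t - c0) (d0 - t)) <= r by rewrite ge_min lexx.
  have h2 : Num.min r (Num.min (t - c0) (d0 - t)) <= t - c0 by rewrite !ge_min lexx orbT.
  have h3 : Num.min r (Num.min (t - c0) (d0 - t)) <= d0 - t by rewrite !ge_min lexx !orbT.
  move: (Num.min r _) h1 h2 h3 => z h1 h2 h3 hx; split; first by lra.
  by apply: hr; lra.
have [d {}hd] := choice hr.
exists d; split=> [t|P k iP fP AP]; first by have [] := hd t.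
have Px p x : p \in P -> lft p <= x <= rgt p ->
    c0 <= x <= d0 /\ forall gm, gm \in s0 -> ~ (gm.1 <= x <= gm.2).
  move=> pP hx; have [_] := hd (tagpt p); apply; first exact: AP.
  exact: fine_itv fP pP hx.
have lenP : \sum_(p <- P) itv_length p <= 1.
  by rewrite -[leRHS]subr0; apply: perron_in_length_le => //; exact: ltr01.
pose PR := [seq p <- P | tagpt p < rgt p]; pose PL := [seq p <- P | lft p < tagpt p].
have [_ oR] : perron_in 0 1 PR by exact: perron_in_filter.
have [_ oL] : perron_in 0 1 PL by exact: perron_in_filter.
have inR p : p \in PR -> p \in P /\ tagpt p < rgt p by rewrite mem_filter => /andP[].
have inL p : p \in PL -> p \in P /\ lft p < tagpt p by rewrite mem_filter => /andP[].
have gap_tag p gm : p \in P -> gap A c0 d0 gm -> ~ (gm.1 < tagpt p < gm.2).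
  by move=> pP [_ _ _ _]; apply; have [] := AP p pP.
have sumR : \sum_(p <- PR) `|F (k p) (tagpt p) (rgt p) - g (k p) c0 * (rgt p - tagpt p)| <=
    \sum_(p <- PR) (e + eta / 8) * (rgt p - tagpt p) + eta / 8.
  have := @half_interval_sum A c0 d0 e s0 PR (@tagpt R) (@rgt R) k (eta / 8) (eta / 8) cA Ac Ad c00 cd d01 e0 osc mu0.
  apply=> //.
  - move=> p /inR[pP tr]; have [h1 h2 h3 h4] := iP.1 p pP.
    have [|/andP[h5 _] _] := Px p (tagpt p) pP; first by [].
    by have [|/andP[_ h6] _] := Px p (rgt p) pP; [rewrite (ltW h2) lexx|split].
  - apply: sub_mem_pairwise oR.
    move=> p q /inR[pP tpr] /inR[qP tqr] npq; apply/asboolP => gm hg p1 p2 q1 q2.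
    have h1 := gap_tag _ _ pP hg; have h2 := gap_tag _ _ qP hg.
    have [_ _ _ tp] := iP.1 p pP; have [_ _ _ tq] := iP.1 q qP.
    by move: npq => /orP[]; lra.
  - move=> p gm /inR[pP tpr] hg h1 h2; apply/negP => gs0.
    have h3 := gap_tag _ _ pP hg; have [_ _ _ tp] := iP.1 p pP.
    have [|_ /(_ gm gs0)] := Px p gm.1 pP; first by lra.
    by have [_ _ lt12 _ _] := hg; lra.
have sumL : \sum_(p <- PL) `|F (k p) (lft p) (tagpt p) - g (k p) c0 * (tagpt p - lft p)| <=
    \sum_(p <- PL) (e + eta / 8) * (tagpt p - lft p) + eta / 8.
  have := @half_interval_sum A c0 d0 e s0 PL (@lft R) (@tagpt R) k (eta / 8) (eta / 8) cA Ac Ad c00 cd d01 e0 osc mu0.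
  apply=> //.
  - move=> p /inL[pP tr]; have [h1 h2 h3 h4] := iP.1 p pP.
    have [|/andP[_ h5] _] := Px p (tagpt p) pP; first by [].
    by have [|/andP[h6 _] _] := Px p (lft p) pP; [rewrite (ltW h2) lexx|split].
  - apply: sub_mem_pairwise oL.
    move=> p q /inL[pP tpr] /inL[qP tqr] npq; apply/asboolP => gm hg p1 p2 q1 q2.
    have h1 := gap_tag _ _ pP hg; have h2 := gap_tag _ _ qP hg.
    have [_ _ _ tp] := iP.1 p pP; have [_ _ _ tq] := iP.1 q qP.
    by move: npq => /orP[]; lra.
  - move=> p gm /inL[pP tpr] hg h1 h2; apply/negP => gs0.
    have h3 := gap_tag _ _ pP hg; have [_ _ _ tp] := iP.1 p pP.
    have [|_ /(_ gm gs0)] := Px p gm.2 pP; first by lra.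
    by have [_ _ lt12 _ _] := hg; lra.
have gA p : p \in P -> `|g (k p) (tagpt p) - g (k p) c0| <= e.
  by move=> pP; apply: osc Ac; have [] := AP p pP.
have := henstock_error_split iP gA.
have sumT := length_split (e + eta / 8) iP.
rewrite !big_filter in sumR sumL.
have -> : \sum_(p <- P) henstock_excess e k p =
    \sum_(p <- P) henstock_error k p - 2 * e * \sum_(p <- P) itv_length p.
  by rewrite sumrB -mulr_sumr.
have l0 : 0 <= eta / 8 * \sum_(p <- P) itv_length p by rewrite mulr_ge0 ?(ltW mu0) // big_seq sumr_ge0 // => p /iP.1[h1 h2 h3 h4]; rewrite /itv_length; lra.
have l1 : eta / 8 * \sum_(p <- P) itv_length p <= eta / 8 by rewrite ger_pMr.
move: sumR sumL sumT l1.
move: (\sum_(p <- P | tagpt p < rgt p) `|_|) (\sum_(p <- P | lft p < tagpt p) `|_|) => x y.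
move: (\sum_(p <- P | tagpt p < rgt p) _) (\sum_(p <- P | lft p < tagpt p) _) => z x'.
move: (\sum_(p <- P) henstock_error k p) (\sum_(p <- P) itv_length p) => y' z'.
rewrite mulrDl -mulrA => h1 h2 h3 h4 h5; lra.
Qed.

(** Baire's theorem, applied to the negligibility of the variation of phi on a
    negligible comeagre subset: in some neighbourhood the gaps of E have bounded
    total weight. *)
Lemma gap_sums_bounded E : closed E -> E `<=` `[0, 1]%classic -> E !=set0 ->
  exists x r : R, [/\ E x, 0 < r &
    forall (c0 d0 : R) (s : seq (R * R)), x - r < c0 -> d0 < x + r -> uniq s ->
      (forall gm, gm \in s -> gap E c0 d0 gm) ->
      \sum_(gm <- s) (phi gm.1 gm.2 + (gm.2 - gm.1)) <= 1 + 1].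
Proof.
move=> cE E01 E0; have [V [oV dV V0]] := null_comeagre E.
pose N := E `&` \bigcap_n V n.
have N0 : lambda N = 0%E.
  by apply/eqP; rewrite eq_le lambda_ge0 andbT -V0; apply: lambda_le => t [].
have mN : lebesgue_measurable N.
  apply: lebesgue_measurableI; first exact: lebesgue_measurable_closed.
  by apply: lebesgue_measurable_bigcap => n; exact: lebesgue_measurable_open.
have N01 : N `<=` `[0, 1]%classic by move=> t [/E01].
have [dl [dl0 hd]] := phi_null N01 mN N0 ltr01.
pose Z (n : nat) := [set t | N t /\ n.+1%:R^-1 < dl t].
have [|n [x [r [Ex r0 dZ]]]] := @baire_closed R E V Z cE E0 oV dV.
  by move=> t Nt; have [m hm] := inv_nat_small (dl0 t); exists m.
have [q q0 qq] : exists2 q : R, 0 < q & q + q = n.+1%:R^-1.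
  by exists (n.+1%:R^-1 / 2); rewrite -?splitr // divr_gt0 // invr_gt0.
exists x, (Num.min r q); split=> //; first by rewrite lt_min r0.
have : Num.min r q <= r by rewrite ge_min lexx.
have : Num.min r q <= q by rewrite ge_min lexx orbT.
move: (Num.min r q) => r' r'q r'r c d s xc dx us hs.
have [rho [rho0 rhoc rhos]] : exists rho : R, [/\ 0 < rho, rho <= c - (x - r') &
    forall gm, gm \in s -> rho <= gm.2 - gm.1].
  elim: s hs {us} => [_|gm s IH hs]; first by exists (c - (x - r')); rewrite subr_gt0; split.
  have [|rho [h1 h2 h3]] := IH; first by move=> gm' h; apply: hs; rewrite inE h orbT.
  have [_ _ lt12 _ _] := hs gm (mem_head _ _).
  exists (Num.min rho (gm.2 - gm.1)); split.
  - by rewrite lt_min h1 subr_gt0.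
  - by rewrite (le_trans _ h2) // ge_min lexx.
  - move=> gm'; rewrite inE => /predU1P[->|/h3]; first by rewrite ge_min lexx orbT.
    by apply: le_trans; rewrite ge_min lexx.
have hz (gm : R * R) : exists z : R, gm \in s -> Z n z /\ `|z - gm.1| < rho.
  have [gs|_] := boolP (gm \in s); last by exists 0.
  have [E1 _ lt12 [/andP[i1 i2] i3] _] := hs gm gs.
  have xr : `|gm.1 - x| < r by rewrite ltr_norml; lra.
  by have [z hz] := dZ gm.1 rho E1 xr rho0; exists z.
have [z {}hz] := choice hz.
have zP gm : gm \in s -> [/\ [/\ E (z gm), q + q < dl (z gm) & N (z gm)], z gm <= gm.1,
    gm.1 - rho < z gm & [/\ c <= gm.1, gm.1 < gm.2, gm.2 <= d & E gm.2]].
  move=> gs; have [[Nz]] := hz gm gs; rewrite -qq => dz; rewrite ltr_norml => /andP[h1 h2].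
  have [E1 E2 lt12 [/andP[i1 i2] /andP[i3 i4]] g12] := hs gm gs.
  have Ez : E (z gm) by case: Nz.
  have h3 := rhos gm gs; have h4 := g12 _ Ez.
  by split=> //; lra.
pose P := [seq (z gm, gm.2, z gm) | gm <- s].
have iP : perron_in 0 1 P.
  split=> [p /mapP[gm gs ->]|].
    have [[h1 h2 h3] h4 h5 [h6 h7 h8 h9]] := zP gm gs.
    have := E01 _ h1; have := E01 _ h9; rewrite /= !in_itv /= /lft /rgt /tagpt /= => h10 h11.
    by split; lra.
  rewrite pairwise_map; apply: sub_mem_pairwise (_ : pairwise (fun u v => u != v) s).
    move=> gm gm' gs gs' ne; rewrite /= /nonoverlapping /lft /rgt /=.
    have [[E1 d1 N1] le1 ge1 [c1 lt1 d1' _]] := zP gm gs.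
    have [[E2 d2 N2] le2 ge2 [c2 lt2 d2' _]] := zP gm' gs'.
    have [_ _ _ _ g1] := hs gm gs; have [_ _ _ _ g2] := hs gm' gs'.
    have h1 := g1 _ E2; have h2 := g2 _ E1.
    have r1 := rhos gm gs; have r2 := rhos gm' gs'.
    have := gap_disjoint (hs gm gs) (hs gm' gs') ne.
    by move=> /orP[h|h]; apply/orP; [left|right]; lra.
  by rewrite -uniq_pairwise.
have fP : fine_partition dl P.
  move=> p /mapP[gm gs ->] y; have [[h1 h2 h3] h4 h5 [h6 h7 h8 h9]] := zP gm gs.
  rewrite /= !in_itv /= /lft /rgt /tagpt /=; lra.
have := hd P tt iP fP.
have h1 := perron_in_length_le ltr01 iP; rewrite subr0 in h1.
move=> h2.
have {}h2 : \sum_(p <- P) phi (lft p) (rgt p) <= 1.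
  by apply: h2 => p /mapP[gm gs ->]; have [[]] := zP gm gs.
apply: le_trans (lerD h2 h1); rewrite -big_split big_map big_seq [leRHS]big_seq /=.
apply: ler_sum => gm gs; have [[E1 d1 N1] le1 ge1 [c1 lt1 d1' E2]] := zP gm gs.
have := E01 _ E1; have := E01 _ E2; rewrite /= !in_itv /= => /andP[_ h3] /andP[h4 _].
apply: lerD; last by rewrite /itv_length /rgt /lft /= lerD2l lerN2.
by apply: phi_mono.
Qed.

(** The rational intervals on which the excess has null variation cover an open
    set.  If E were not contained in it, the remaining closed set would have, near
    some point, gaps of bounded total weight, and the previous lemmas would
    produce one more such rational interval around this point. *)
Lemma null_variation_closed E e : closed E -> E `<=` `[0, 1]%classic -> 0 <= e ->
  (forall t t' th, E t -> E t' -> `|g th t - g th t'| <= e) ->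
  null_variation (henstock_excess e) E.
Proof.
move=> cE E01 e0 osc.
pose I (q : rat * rat) : set R := `]ratr q.1, ratr q.2[%classic.
pose good q := null_variation (henstock_excess e) (E `&` I q).
pose U := \bigcup_(q in good) I q.
have oU : open U by apply: bigcup_open => q _; exact: interval_open.
have vU : null_variation (henstock_excess e) (E `&` U).
  rewrite setI_bigcupr.
  exact: (@null_variation_bigcup_count _ _ _ (rat * rat)%type).
pose E' := E `\` U.
have [E'0|E'0] := pselect (E' !=set0); last first.
  apply: null_variation_sub vU => t Et; split=> //; apply: contrapT => nUt.
  by apply: E'0; exists t.
exfalso.
have cE' : closed E' by apply: closedI => //; exact: open_closedC.
have E'01 : E' `<=` `[0, 1]%classic by move=> t [/E01].
have [x [r [[Ex nUx] r0 hB]]] := gap_sums_bounded cE' E'01 E'0.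
have [|a] := @rat_in_itvoo R (x - r) x; first by rewrite ltrBlDr ltrDl.
rewrite in_itv /= => /andP[a1 a2].
have [|b] := @rat_in_itvoo R x (x + r); first by rewrite ltrDl.
rewrite in_itv /= => /andP[b1 b2].
pose A := E' `&` `[ratr a, ratr b]%classic.
have cA : closed A by apply: closedI => //; exact: interval_closed.
have Ax : A x by split=> //; rewrite /= in_itv /= !ltW.
have hs : has_sup A by split; [exists x|exists (ratr b) => y [_ /=]; rewrite in_itv => /andP[]].
have hi : has_inf A by split; [exists x|exists (ratr a) => y [_ /=]; rewrite in_itv => /andP[]].
have As : A (sup A).
  apply: contrapT => nA; have [rr rr0 hr] := open_radius (closed_openC cA) nA.
  have [y Ay hy] := sup_adherent rr0 hs; have h := sup_upper_bound hs Ay.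
  by apply: (hr y) => //; rewrite hy (le_lt_trans h) // ltrDl.
have Ai : A (inf A).
  apply: contrapT => nA; have [rr rr0 hr] := open_radius (closed_openC cA) nA.
  have [y Ay hy] := inf_adherent rr0 hi; have h := ge_inf hi.2 Ay.
  by apply: (hr y) => //; rewrite hy (lt_le_trans _ h) // ltrBlDr ltrDl.
have A_sub : A `<=` `[inf A, sup A]%classic.
  by move=> y Ay; rewrite /= in_itv /= ge_inf //=; [exact: sup_upper_bound|case: hi].
have [s1 s2] : 0 <= inf A /\ sup A <= 1.
  have [/E'01 + _] := Ai; have [/E'01 + _] := As.
  by rewrite /= !in_itv /= => /andP[_ ->] /andP[->].
have vA : null_variation (henstock_excess e) A.
  have [is_|si] := ltP (inf A) (sup A); last first.
    apply: (@null_variation_sub _ _ _ _ [set inf A]).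
      move=> y /A_sub; rewrite /= in_itv /= => /andP[h1 h2]; apply/eqP.
      by rewrite eq_le h1 (le_trans h2 si).
    apply: null_variation_excess => //; apply: null_variation_set1.
    rewrite s1 (le_trans _ s2) //; have := A_sub _ As.
    by rewrite /= in_itv /= => /andP[].
  apply: (@null_variation_gap_sums A (inf A) (sup A) e (1 + 1)) => //.
    by move=> t t' th [[Et _] _] [[Et' _] _]; exact: osc.
  move=> s us hgap; apply: (hB (inf A) (sup A) s) => //.
  - by have [_] := Ai; rewrite /= in_itv /= => /andP[h _]; exact: lt_le_trans h.
  - by have [_] := As; rewrite /= in_itv /= => /andP[_ h]; exact: le_lt_trans h _.
  - move=> gm /hgap[[E1 I1] [E2 I2] lt12 i12 g12]; split=> // y E'y /andP[h1 h2].
    apply: (g12 y); last by rewrite h1 h2.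
    split=> //; move: I1 I2; rewrite /= !in_itv /= => /andP[h3 _] /andP[_ h4].
    by rewrite (le_trans h3 (ltW h1)) (le_trans (ltW h2) h4).
apply: nUx; exists (a, b); last by rewrite /I /= in_itv /= a2 b1.
apply: (@null_variation_sub _ _ _ _ ((E `&` U) `|` A)); last exact: null_variationU.
move=> y [Ey]; rewrite /I /= in_itv /= => /andP[h1 h2].
have [Uy|nUy] := pselect (U y); [by left|right].
by split=> //; rewrite /= in_itv /= !ltW.
Qed.

(** The partition does not depend on the index th. *)
Definition small_oscillation (J : R -> nat) e := forall i,
  lebesgue_measurable (fiber 0 1 J i) /\
  (lambda (fiber 0 1 J i) = 0%E \/
   forall t t' th, fiber 0 1 J i t -> fiber 0 1 J i t' -> `|g th t - g th t'| <= e).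

(** Up to a null set, each fibre is a countable union of closed sets, to which
    null_variation_closed applies. *)
Theorem henstock_error_small :
  (forall e, 0 < e -> exists J, small_oscillation J e) ->
  forall eta : R, 0 < eta -> variation_le henstock_error `[0, 1]%classic eta.
Proof.
move=> hJ eta eta0; have eta4 : 0 < eta / 4 by rewrite divr_gt0.
have [J Jsmall] := hJ _ eta4.
have : null_variation (henstock_excess (eta / 4)) `[0, 1]%classic.
  apply: (@null_variation_sub _ _ _ _ (\bigcup_i fiber 0 1 J i)).
    by move=> t; rewrite /= in_itv /= => ht; exists (J t).
  apply: null_variation_bigcup => i; have [mA] := Jsmall i.
  have A01 := @fiber_sub R _ 0 1 J i.
  move: (fiber 0 1 J i) mA A01 => A mA A01 [A0|osc].
    by apply: null_variation_excess (ltW eta4) _; exact: null_variation_null.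
  have [K hK] := choice (fun n => inner_closed (inv_nat_gt0 R n) A01 mA).
  apply: (@null_variation_sub _ _ _ _ ((\bigcup_n K n) `|` (A `\` \bigcup_n K n))).
    by move=> t At; case: (pselect ((\bigcup_n K n) t)) => ?; [left|right].
  apply: null_variationU.
    apply: null_variation_bigcup => n; have [cK KA _] := hK n.
    apply: null_variation_closed => //; [exact: subset_trans A01|exact: ltW|].
    by move=> t t' th /KA At /KA At'; exact: osc.
  apply: null_variation_excess (ltW eta4) _; apply: null_variation_null.
  - by move=> t [/A01].
  - apply: lebesgue_measurableD => //; apply: lebesgue_measurable_bigcup => n.
    by apply: lebesgue_measurable_closed; have [] := hK n.
  - apply/eqP; rewrite eq_le lambda_ge0 andbT; apply/lee_addgt0Pr => e e0; rewrite add0e.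
    have [n hn] := inv_nat_small e0.
    apply: (@le_trans _ _ (lambda (A `\` K n))).
      by apply: lambda_le => t [At nK]; split=> // Kt; apply: nK; exists n.
    have [cK KA lK] := hK n.
    have := lambdaDI mA (lebesgue_measurable_closed cK); rewrite (setIidr KA).
    have fA := lambda_fin_num A01; have fK := lambda_fin_num (subset_trans KA A01).
    have fD : lambda (A `\` K n) \is a fin_num by apply: (@lambda_fin_num R 0 1) => t [/A01].
    rewrite -(fineK fA) -(fineK fK) -(fineK fD) -EFinD => -[eq1].
    rewrite lee_fin; move: lK; rewrite eq1 => lK; apply: ltW; apply: le_lt_trans hn.
    by move: lK; rewrite lerBlDr [X in X <= _]addrC lerD2l.
move=> /(_ _ (divr_gt0 eta0 (@ltr0Sn _ 1))); move=> [d [d0 hd]].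
exists d; split=> // P k iP fP EP; have := hd P k iP fP EP.
rewrite /henstock_excess sumrB -mulr_sumr lerBlDr => /le_trans; apply.
have := perron_in_length_le ltr01 iP; rewrite subr0 => h.
have -> : 2 * (eta / 4) = eta / 2 by field.
by rewrite [leRHS]splitr lerD2l ger_pMr // divr_gt0.
Qed.

End Core.

(** * The Hahn-Banach theorem and weak compactness *)

Section HahnBanach.
Context {R : realType} {V : lmodType R}.
Implicit Types (q : V -> R) (x y : V).

Definition sublinear q :=
  (forall x y, q (x + y) <= q x + q y) /\ (forall (r : R) x, 0 <= r -> q (r *: x) = r * q x).

Lemma sublinear0 q : sublinear q -> q 0 = 0.
Proof. by move=> [_ h]; have := h 0 0 (lexx _); rewrite scale0r mul0r. Qed.

Lemma sublinearN q x : sublinear q -> - q (- x) <= q x.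
Proof.
move=> sq; have [h _] := sq.
by have := h x (- x); rewrite subrr (sublinear0 sq) -subr_ge0 subr0 addrC -lerBlDl sub0r.
Qed.

Lemma sublinear_of q : (forall x y, q (x + y) <= q x + q y) -> q 0 = 0 ->
  (forall (r : R) x, 0 < r -> q (r *: x) <= r * q x) -> sublinear q.
Proof.
move=> qD q0 qZ; split=> // r x; rewrite le_eqVlt => /predU1P[<-|r0].
  by rewrite scale0r mul0r.
apply/eqP; rewrite eq_le qZ //=; have ri : 0 < r^-1 by rewrite invr_gt0.
by have := qZ _ (r *: x) ri; rewrite scalerA mulVf ?gt_eqF // scale1r mulrC ler_pdivlMr // mulrC.
Qed.

(** Moving q as far down as possible in the direction of y. *)
Definition lowered q y x := inf [set q (x + t *: y) - t * q y | t in [set t : R | 0 <= t]].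

Lemma lowered_le q y x t : sublinear q -> 0 <= t -> lowered q y x <= q (x + t *: y) - t * q y.
Proof.
move=> sq t0; apply: ge_inf; last by exists t.
exists (- q (- x)) => _ [s /= s0 <-]; have [h1 h2] := sq.
have := h1 (x + s *: y) (- x); rewrite addrAC subrr add0r h2 //; lra.
Qed.

Lemma lowered_ge q y x (m : R) : 
  (forall t, 0 <= t -> m <= q (x + t *: y) - t * q y) -> m <= lowered q y x.
Proof.
move=> h; apply: lb_le_inf; first by exists (q (x + 0 *: y) - 0 * q y); exists 0 => /=.
by move=> _ [t /= t0 <-]; exact: h.
Qed.

Lemma sublinear_lowered q y : sublinear q -> sublinear (lowered q y).
Proof.
move=> sq; have [h1 h2] := sq; apply: sublinear_of => [x z||r x r0].
- rewrite -lerBlDl; apply: lowered_ge => t t0; rewrite lerBlDl -lerBlDr.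
  apply: lowered_ge => s s0; rewrite lerBlDr.
  apply: (le_trans (lowered_le y (x + z) sq (addr_ge0 s0 t0))).
  rewrite scalerDl mulrDl addrACA; have := h1 (x + s *: y) (z + t *: y); lra.
- apply/eqP; rewrite eq_le; apply/andP; split.
    by have := lowered_le y 0 sq (lexx (0 : R)); rewrite scale0r addr0 mul0r subr0 (sublinear0 sq).
  by apply: lowered_ge => t t0; rewrite add0r h2 // subrr.
- rewrite mulrC -ler_pdivrMr //; apply: lowered_ge => t t0.
  rewrite ler_pdivrMr // mulrC mulrBr -(h2 _ _ (ltW r0)) scalerDr scalerA mulrA.
  by apply: lowered_le => //; rewrite mulr_ge0 // ltW.
Qed.

(** Hahn-Banach: a minimal sublinear functional is linear, since lowering it
    in any direction does not change it. *)
Theorem Hahn_Banach p : sublinear p -> exists f : V -> R,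
  [/\ forall x y, f (x + y) = f x + f y, forall (r : R) x, f (r *: x) = r * f x
    & forall x, f x <= p x].
Proof.
move=> sp.
pose T := {q : V -> R | sublinear q /\ forall x, q x <= p x}.
pose rl (q q' : T) := `[< forall x, sval q' x <= sval q x >].
have t0 : T by exists p.
have [||A tA|[q [sq qp]] qmin] := @ZL_preorder T t0 rl.
- by move=> q; apply/asboolP.
- by move=> q q' q'' /asboolP h1 /asboolP h2; apply/asboolP => x; exact: le_trans (h2 x) (h1 x).
- have [[a0 Aa0]|A0] := pselect (A !=set0); last by exists t0 => s As; case: A0; exists s.
  pose m x := inf [set sval q x | q in A].
  have hlb x : has_lbound [set sval q x | q in A].
    exists (- p (- x)) => _ [[q [sq qp]] _ <-] /=.
    by apply: le_trans (sublinearN x sq); rewrite lerN2.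
  have mle (q : T) x : A q -> m x <= sval q x by move=> Aq; apply: ge_inf; [exact: hlb|exists q].
  have mge x (c : R) : (forall q : T, A q -> c <= sval q x) -> c <= m x.
    move=> h; apply: lb_le_inf; first by exists (sval a0 x); exists a0.
    by move=> _ [q Aq <-]; exact: h.
  have sm : sublinear m.
    apply: sublinear_of => [x y||r x r0].
    - rewrite -lerBlDl; apply: (mge) => q Aq; rewrite lerBlDl -lerBlDr.
      apply: (mge) => q' Aq'; rewrite lerBlDr.
      have [/asboolP h|/asboolP h] := tA q q' Aq Aq'.
        apply: (le_trans (mle _ _ Aq')); have [[h1 _] _] := svalP q'.
        by apply: (le_trans (h1 x y)); rewrite lerD2l.
      apply: (le_trans (mle _ _ Aq)); have [[h1 _] _] := svalP q.
      by apply: (le_trans (h1 x y)); rewrite lerD2r.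
    - have q0 (q : T) : sval q 0 = 0 by apply: sublinear0; have [] := svalP q.
      apply/eqP; rewrite eq_le; apply/andP; split; last by apply: (mge) => q _; rewrite q0.
      by apply: (le_trans (mle _ _ Aa0)); rewrite q0.
    - rewrite mulrC -ler_pdivrMr //; apply: (mge) => q Aq; rewrite ler_pdivrMr // mulrC.
      by have [[_ h] _] := svalP q; rewrite -(h _ _ (ltW r0)); exact: mle.
  have mp x : m x <= p x by apply: (le_trans (mle _ _ Aa0)); have [_] := svalP a0.
  by exists (exist _ m (conj sm mp)) => q Aq; apply/asboolP => x; exact: mle.
- have qlow y x : q x <= lowered q y x.
    have sl := sublinear_lowered y sq.
    have lq z : lowered q y z <= q z.
      by have := lowered_le y z sq (lexx (0 : R)); rewrite scale0r addr0 mul0r subr0.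
    have lp z : lowered q y z <= p z by exact: le_trans (lq z) (qp z).
    have /qmin /asboolP/= : rl (exist _ q (conj sq qp)) (exist _ _ (conj sl lp)) by apply/asboolP.
    by apply.
  have qN y : q (- y) = - q y.
    apply/eqP; rewrite eq_le -[X in _ && X]lerN2 opprK; apply/andP; split.
      apply: (le_trans (qlow y (- y))).
      have := lowered_le y (- y) sq (@ler01 R).
      by rewrite scale1r addNr (sublinear0 sq) mul1r sub0r.
    by have := sublinearN (- y) sq; rewrite opprK lerNl.
  have [h1 h2] := sq; exists q; split=> // [x y|r x].
    apply/eqP; rewrite eq_le h1 /=; have := h1 (x + y) (- y).
    by rewrite addrK qN lerBrDr.
  have [r0|r0] := leP 0 r; first exact: h2.
  by rewrite -[r]opprK scaleNr qN h2 ?mulNr // oppr_ge0 ltW.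
Qed.

End HahnBanach.

Section Dual.
Context {R : realType} {X : completeNormedModType R}.
Implicit Types (u v w : dual X) (x y a b : X) (A B : set X).

Lemma pairingD u x y : pairing u (x + y) = pairing u x + pairing u y.
Proof. exact: linearD. Qed.
Lemma pairingB u x y : pairing u (x - y) = pairing u x - pairing u y.
Proof. exact: linearB. Qed.
Lemma pairingN u x : pairing u (- x) = - pairing u x.
Proof. exact: linearN. Qed.
Lemma pairingZ u (r : R) x : pairing u (r *: x) = r * pairing u x.
Proof. exact: linearZ. Qed.
Lemma pairing0 u : pairing u 0 = 0.
Proof. exact: linear0. Qed.

Definition bounded_functional (f : X -> R) (C : R) :=
  [/\ forall x y, f (x + y) = f x + f y, forall (r : R) x, f (r *: x) = r * f x
    & forall x, `|f x| <= C * `|x|].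

Lemma dual_of (f : X -> R) (C : R) : bounded_functional f C ->
  exists u, forall x, pairing u x = f x.
Proof.
move=> [fD fZ fC].
have lf : linear (f : X -> R^o) by move=> r x y; rewrite fD fZ.
pose F : {linear X -> R^o} := HB.pack (f : X -> R^o) (GRing.isLinear.Build R X R^o _ f lf).
have cF : continuous F.
  apply: bounded_linear_continuous; apply/linear_boundedP.
  exists C; split; first exact: num_real.
  move=> r Cr x; apply: (le_trans (fC x)); rewrite ler_wpM2r //; exact: ltW.
by exists (exist _ F cF).
Qed.

Lemma pairing_bounded u : exists C, bounded_functional (pairing u) C.
Proof.
have : bounded_near (sval u) (nbhs 0) by apply: continuous_linear_bounded; exact: svalP u 0.
move=> /linear_boundedP[C [_ hC]]; exists (C + 1); split; [exact: pairingD|exact: pairingZ|].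
by move=> x; apply: hC; rewrite ltrDl.
Qed.

Definition dual_ball u := forall x, `|pairing u x| <= `|x|.

Lemma dualD u v : exists w, forall x, pairing w x = pairing u x + pairing v x.
Proof.
have [C [h1 h2 h3]] := pairing_bounded u; have [D [k1 k2 k3]] := pairing_bounded v.
apply: (@dual_of _ (C + D)); split=> [x y|r x|x].
- by rewrite h1 k1 addrACA.
- by rewrite h2 k2 mulrDr.
- by apply: (le_trans (ler_normD _ _)); rewrite mulrDl lerD.
Qed.

Lemma dualZ (r : R) u : exists w, forall x, pairing w x = r * pairing u x.
Proof.
have [C [h1 h2 h3]] := pairing_bounded u.
apply: (@dual_of _ (`|r| * C)); split=> [x y|s x|x].
- by rewrite h1 mulrDr.
- by rewrite h2 mulrCA.
- by rewrite normrM -mulrA ler_wpM2l.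
Qed.

Lemma dual_ball_scale u : exists2 C : R, 0 < C & exists2 v, dual_ball v &
  forall x, pairing u x = C * pairing v x.
Proof.
have [C [_ _ hC]] := pairing_bounded u.
pose D := `|C| + 1; have D0 : 0 < D by rewrite ltr_wpDl.
exists D => //; have [v hy] := dualZ D^-1 u; exists v => x; last first.
  by rewrite hy mulrA divff ?mul1r // gt_eqF.
rewrite hy normrM gtr0_norm ?invr_gt0 // mulrC ler_pdivrMr // mulrC.
apply: (le_trans (hC x)); rewrite ler_wpM2r // /D.
by rewrite (le_trans (ler_norm C)) // lerDl.
Qed.

Lemma convex_setE A : convex_set (A : set (convex_lmodType X)) <->
  forall a b (l : R), 0 <= l <= 1 -> A a -> A b -> A (l *: a + (1 - l) *: b).
Proof.
split=> [cA a b l /andP[l0 l1] Aa Ab|h a b l /set_mem Aa /set_mem Ab].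
  have := cA a b (Itv01 l0 l1 : {i01 R}) (mem_set Aa) (mem_set Ab).
  by move=> /set_mem.
apply/mem_set; apply: (h a b l%:num) => //.
by apply/andP; split; [exact: ge0|exact: le1].
Qed.

(** Separation of a point from a convex set at distance at least rho, with the
    largest possible gap for a functional of norm one.  The required functionals
    are exactly the linear ones below the sublinear functional used here. *)
Lemma separation A x (rho : R) : A !=set0 -> convex_set (A : set (convex_lmodType X)) -> 0 <= rho ->
  (forall a, A a -> rho <= `|a - x|) ->
  exists2 u, dual_ball u & forall a, A a -> pairing u a + rho <= pairing u x.
Proof.
move=> [a0 Aa0] cA rho0 Ax.
have tri (v w : X) : `|w| <= `|v - w| + `|v|.
  by rewrite addrC -{1}(subKr v w); exact: ler_normB.
pose S y := [set r : R | exists (t : R) (a : X), [/\ 0 <= t, A a & r = `|y - t *: (a - x)| - t * rho]].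
have Slb y (t : R) a : 0 <= t -> A a -> - `|y| <= `|y - t *: (a - x)| - t * rho.
  move=> t0 Aa; have h1 : t * rho <= `|t *: (a - x)| by rewrite normrZ (ger0_norm t0) ler_wpM2l ?Ax.
  have h2 := tri y (t *: (a - x)).
  lra.
pose q y := inf (S y).
have hlb y : has_lbound (S y) by exists (- `|y|) => _ [t [a [t0 Aa ->]]]; exact: Slb.
have qle y (t : R) a : 0 <= t -> A a -> q y <= `|y - t *: (a - x)| - t * rho.
  by move=> t0 Aa; apply: ge_inf; [exact: hlb|exists t, a].
have qge y (m : R) : (forall (t : R) a, 0 <= t -> A a -> m <= `|y - t *: (a - x)| - t * rho) -> m <= q y.
  move=> h; apply: lb_le_inf; first by exists (`|y - 0 *: (a0 - x)| - 0 * rho), 0, a0.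
  by move=> _ [t [a [t0 Aa ->]]]; exact: h.
have q_norm y : q y <= `|y| by have := qle y _ _ (lexx (0 : R)) Aa0; rewrite scale0r subr0 mul0r subr0.
have q0 : q 0 = 0.
  apply/eqP; rewrite eq_le; have := q_norm 0; rewrite normr0 => -> /=.
  by apply: qge => t a t0 Aa; have := Slb 0 t a t0 Aa; rewrite normr0 oppr0.
have sq : sublinear q.
  apply: sublinear_of => // [y z|r y r0]; last first.
    rewrite mulrC -ler_pdivrMr //; apply: (qge) => t a t0 Aa.
    rewrite ler_pdivrMr // mulrC mulrBr -{2}(gtr0_norm r0) -normrZ scalerBr scalerA mulrA.
    by apply: qle => //; rewrite mulr_ge0 // ltW.
  rewrite -lerBlDl; apply: (qge) => t b t0 Ab; rewrite lerBlDl -lerBlDr.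
  apply: (qge) => s a s0 Aa; rewrite lerBlDr.
  have [st0|stn0] := eqVneq (s + t) 0.
    have s00 : s = 0 by lra.
    have t00 : t = 0 by lra.
    rewrite s00 t00 !scale0r !mul0r !subr0; apply: (le_trans (q_norm _)); exact: ler_normD.
  have stp : 0 < s + t by rewrite lt_neqAle eq_sym stn0 addr_ge0.
  have l01 : 0 <= s / (s + t) <= 1.
    by rewrite divr_ge0 ?addr_ge0 //= ler_pdivrMr // mul1r lerDl.
  have Ac : A ((s / (s + t)) *: a + (1 - s / (s + t)) *: b) by exact: (convex_setE A).1.
  apply: (le_trans (qle _ (s + t) _ (ltW stp) Ac)).
  have -> : (s + t) *: ((s / (s + t)) *: a + (1 - s / (s + t)) *: b - x) =
     s *: (a - x) + t *: (b - x).
    rewrite scalerBr scalerDr !scalerA.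
    have -> : (s + t) * (s / (s + t)) = s by field.
    have -> : (s + t) * (1 - s / (s + t)) = t by field.
    by rewrite scalerDl !scalerBr opprD addrACA.
  rewrite opprD addrACA mulrDl; have := ler_normD (y - s *: (a - x)) (z - t *: (b - x)); lra.
have [f [fD fZ fq]] := Hahn_Banach sq.
have fN y : f (- y) = - f y by rewrite -scaleN1r fZ mulN1r.
have fb : bounded_functional f 1.
  split=> // y; rewrite mul1r ler_norml (le_trans (fq y) (q_norm y)) andbT.
  by rewrite lerNl -fN (le_trans (fq _)) // (le_trans (q_norm _)) // normrN.
have [u hu] := dual_of fb; exists u.
  by move=> y; rewrite hu; have [_ _ /(_ y)] := fb; rewrite mul1r.
move=> a Aa; have := le_trans (fq (a - x)) (qle (a - x) 1 a ler01 Aa).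
rewrite !hu scale1r subrr normr0 mul1r sub0r fD fN; lra.
Qed.

Lemma norming x : exists2 u, dual_ball u & pairing u x = `|x|.
Proof.
have [] := @separation [set 0] x `|x|.
- by exists 0.
- by apply/convex_setE => a b l _ -> ->; rewrite !scaler0 addr0.
- by [].
- by move=> a ->; rewrite sub0r normrN.
move=> u hu h; exists u => //; apply/eqP; rewrite eq_le.
have := h 0 erefl; rewrite pairing0 add0r => ->.
by rewrite andbT (le_trans (ler_norm _)).
Qed.

Lemma norm_le_dual x (r : R) : (forall u, dual_ball u -> pairing u x <= r) -> `|x| <= r.
Proof. by move=> h; have [u hu <-] := norming x; exact: h. Qed.

Lemma pairing_inj x y : (forall u, pairing u x = pairing u y) -> x = y.
Proof.
move=> h; apply/eqP; rewrite -subr_eq0 -normr_le0.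
by apply: norm_le_dual => u _; rewrite pairingB h subrr.
Qed.

End Dual.

Section WeakTopology.
Context {R : realType} {X : completeNormedModType R}.
Implicit Types (u v w : dual X) (x y a b : X) (A B : set X).

Lemma weak_cvgP (F : set_system X) a : Filter F ->
  (F --> (a : weak_space X)) <-> (forall u, pairing u x @[x --> F] --> pairing u a).
Proof.
move=> FF; split=> [/cvg_sup h u|h].
  move=> B hB; apply: (h u).
  exact: (@initial_continuous X R^o (sval u : X -> R^o) a B hB).
apply/cvg_sup => u V /=; rewrite (@nbhsE (initial_topology (sval u : X -> R^o))) => -[B [[C oC <-] Ca] BV].
rewrite nbhs_filterE; apply: filterS BV _; apply: (h u).
exact: open_nbhs_nbhs.
Qed.

Lemma pairing_weak_continuous u : continuous (pairing u : weak_space X -> R).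
Proof.
move=> a; have FF : Filter (nbhs (a : weak_space X)) by exact: nbhs_filter.
by have [+ _] := @weak_cvgP (nbhs (a : weak_space X)) a FF; apply.
Qed.

Lemma weakly_compactP A : weakly_compact A <->
  forall F : set_system X, UltraFilter F -> F A ->
    exists2 a, A a & forall u, pairing u x @[x --> F] --> pairing u a.
Proof.
rewrite /weakly_compact compact_ultra; split=> h F UF FA.
  by have [a [Aa /weak_cvgP]] := h F UF FA; exists a.
by have [a Aa ha] := h F UF FA; exists a; split=> //; apply/weak_cvgP.
Qed.

Lemma support_attained u A : weakly_compact A -> A !=set0 ->
  exists2 a, A a & support_fun u A = pairing u a.
Proof.
move=> cA A0.
have [|a /set_mem Aa ha] := @compact_EVT_max (weak_space X) R (pairing u) A A0 cA.
  by apply: continuous_subspaceT; exact: pairing_weak_continuous.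
exists a => //; apply/eqP; rewrite eq_le; apply/andP; split.
  apply: ge_sup; first by exists (pairing u a); exists a.
  by move=> _ [b Ab <-]; apply: ha; exact: mem_set.
apply: sup_upper_bound; last by exists a.
split; first by exists (pairing u a); exists a.
by exists (pairing u a) => _ [b Ab <-]; apply: ha; exact: mem_set.
Qed.

Lemma support_ge u A a : weakly_compact A -> A a -> pairing u a <= support_fun u A.
Proof.
move=> cA Aa; have A0 : A !=set0 by exists a.
have [|b /set_mem Ab hb] := @compact_EVT_max (weak_space X) R (pairing u) A A0 cA.
  by apply: continuous_subspaceT; exact: pairing_weak_continuous.
apply: sup_upper_bound; last by exists a.
split; first by exists (pairing u a); exists a.
by exists (pairing u b) => _ [c Ac <-]; apply: hb; exact: mem_set.
Qed.

Lemma support_le u A (r : R) : A !=set0 -> (forall a, A a -> pairing u a <= r) ->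
  support_fun u A <= r.
Proof.
move=> [a Aa] h; apply: ge_sup; first by exists (pairing u a); exists a.
by move=> _ [b Ab <-]; exact: h.
Qed.

Lemma filter_limit_unique (F : set_system X) (f : X -> R) (l l' : R) : ProperFilter F ->
  f x @[x --> F] --> l -> (forall e : R, 0 < e -> F [set x | `|f x - l'| <= e]) -> l = l'.
Proof.
move=> PF fl fl'; apply/eqP; rewrite -subr_eq0 -normr_le0; apply/ler_addgt0Pl => e e0.
rewrite addr0; have e2 : 0 < e / 2 by rewrite divr_gt0.
have h1 : F [set x | `|l - f x| < e / 2] by move/cvgrPdist_lt: fl; apply.
have [x [/= h2 h3]] := filter_ex (filterI h1 (fl' _ e2)).
by rewrite (le_trans (ler_distD (f x) _ _)) // [leRHS]splitr lerD // ltW.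
Qed.

(** An ultrafilter on A that converges to x in norm has a weak limit in A, which
    must be x since the dual separates points. *)
Lemma weakly_compact_closed A x : weakly_compact A ->
  (forall e : R, 0 < e -> exists2 a, A a & `|x - a| < e) -> A x.
Proof.
move=> /weakly_compactP cA h.
pose B e := [set a | A a /\ `|x - a| < e].
have PF : ProperFilter (filter_from [set e : R | 0 < e] B).
  apply: filter_from_proper; last by move=> e /h[a Aa ax]; exists a.
  apply: filter_from_filter; first by exists 1 => /=.
  move=> e e' /= e0 e'0; exists (Num.min e e'); first by rewrite /= lt_min e0.
  by move=> a [Aa]; rewrite lt_min => /andP[h1 h2]; split.
have [G [UG FG]] := ultraFilterLemma PF.
have [|a Aa ha] := cA G UG; first by apply: FG; exists 1 => //= a [].
suff -> : x = a by [].
apply: pairing_inj => u; symmetry; apply: (@filter_limit_unique G (pairing u) _ _ ultra_proper (ha u)) => e e0.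
have [C [_ _ hC]] := pairing_bounded u.
have C0 : 0 < `|C| + 1 by rewrite ltr_wpDl.
apply: FG; exists (e / (`|C| + 1)); first by rewrite /= divr_gt0.
move=> y [Ay]; rewrite ltr_pdivlMr // => xy /=; rewrite -pairingB distrC in xy *.
apply: (le_trans (hC _)); apply: (le_trans _ (ltW xy)); rewrite mulrC ler_wpM2l //.
by rewrite (le_trans (ler_norm C)) // lerDl.
Qed.

(** Uniform boundedness: if A were unbounded, a gliding hump would produce a
    continuous functional unbounded on A. *)
Lemma weakly_compact_bounded A : weakly_compact A -> exists M : R, forall a, A a -> `|a| <= M.
Proof.
move=> cA; have [[M hM]|unb] := pselect (exists M : R, forall a, A a -> `|a| <= M); first by exists M.
exfalso.
have ha (n : nat) : exists a, A a /\ 3 ^+ n * n%:R <= `|a|.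
  apply: contrapT => h; apply: unb; exists (3 ^+ n * n%:R) => a Aa.
  by rewrite leNgt; apply/negP => /ltW na; apply: h; exists a.
have [a {}ha] := choice ha.
have hn n := norming (a n).
have step (nf : nat * (X -> R)) : exists f' : X -> R, forall C, bounded_functional nf.2 C ->
   [/\ bounded_functional f' (C + 3^-1 ^+ nf.1), forall x, `|f' x - nf.2 x| <= 3^-1 ^+ nf.1 * `|x|
     & 3^-1 ^+ nf.1 * `|a nf.1| <= `|f' (a nf.1)|].
  case: nf => n f /=; have [v hv hva] := norming (a n).
  set r : R := 3^-1 ^+ n; have r0 : 0 < r by rewrite exprn_gt0 // invr_gt0.
  have main (s : R) C : `|s| = r -> bounded_functional f C ->
      bounded_functional (fun x => f x + s * pairing v x) (C + r) /\
      forall x, `|f x + s * pairing v x - f x| <= r * `|x|.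
    move=> sr [fD fZ fC]; split; last by move=> x; rewrite addrAC subrr add0r normrM sr ler_wpM2l // ltW.
    split=> [x y|k x|x].
    - by rewrite fD pairingD; ring.
    - by rewrite fZ pairingZ; ring.
    - apply: (le_trans (ler_normD _ _)); rewrite mulrDl lerD //.
      by rewrite normrM sr ler_wpM2l // ltW.
  have [h|h] := leP 0 (f (a n)).
    exists (fun x => f x + r * pairing v x) => C bf.
    have [h1 h2] := main r C (gtr0_norm r0) bf; split=> //.
    by rewrite hva ger0_norm ?lerDr // addr_ge0 // mulr_ge0 // ltW.
  exists (fun x => f x + (- r) * pairing v x) => C bf.
  have [|h1 h2] := main (- r) C _ bf; first by rewrite normrN gtr0_norm.
  split=> //; rewrite hva mulNr ler0_norm; last by rewrite subr_le0 (le_trans (ltW h)) // mulr_ge0 // ltW.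
  by rewrite opprB lerDl oppr_ge0 ltW.
have [st {}hst] := choice step.
pose f := fix f n := if n is m.+1 then st (m, f m) else (fun=> 0 : R).
have fb n : exists C, bounded_functional (f n) C.
  elim: n => [|n [C hC]]; last by have [h _ _] := hst (n, f n) C hC; exists (C + 3^-1 ^+ n).
  by exists 0; split=> [x y|r x|x] /=; rewrite ?addr0 ?mulr0 ?normr0 ?mul0r.
have fS n : [/\ forall x, `|f n.+1 x - f n x| <= 3^-1 ^+ n * `|x|
     & 3^-1 ^+ n * `|a n| <= `|f n.+1 (a n)|].
  by have [C hC] := fb n; have [_ h1 h2] := hst (n, f n) C hC.
(* the sum of 3^-1 ^+ k over k >= n; at n + 1 it is half of 3^-1 ^+ n, so that the
   n-th hump prevails over all later ones *)
pose tail (n : nat) : R := 3^-1 ^+ n * (3 / 2).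
have tailS n : 3^-1 ^+ n + tail n.+1 = tail n by rewrite /tail exprS; field; rewrite ?expf_neq0.
have tail0 n : 0 <= tail n by rewrite /tail mulr_ge0 ?exprn_ge0 ?invr_ge0 // divr_ge0.
have fmn m n x : `|f (m + n)%N x - f m x| <= (tail m - tail (m + n)%N) * `|x|.
  elim: n => [|n IH]; first by rewrite addn0 !subrr normr0 mul0r.
  rewrite addnS (le_trans (ler_distD (f (m + n)%N x) _ _)) //.
  have [h _] := fS (m + n)%N; have := lerD (h x) IH; rewrite -mulrDl => /le_trans; apply.
  by rewrite ler_wpM2r // -(tailS (m + n)%N); lra.
(* the pointwise limit, squeezed between f n - tail n and f n + tail n *)
have hl x : exists l : R, forall n, `|l - f n x| <= tail n * `|x|.
  pose S := range (fun n => f n x - tail n * `|x|).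
  have hub m : ubound S (f m x + tail m * `|x|).
    move=> _ [n _ <-].
    have [mn|nm] := leqP m n.
      have := fmn m (n - m)%N x; rewrite subnKC // ler_norml mulrBl => /andP[_ h].
      have := mulr_ge0 (tail0 n) (normr_ge0 x); lra.
    have := fmn n (m - n)%N x; rewrite subnKC 1?ltnW // ler_norml mulrBl => /andP[h _].
    have := mulr_ge0 (tail0 m) (normr_ge0 x); lra.
  have hS : has_sup S by split; [exists (f 0%N x - tail 0%N * `|x|), 0%N|exists (f 0%N x + tail 0%N * `|x|); exact: hub].
  exists (sup S) => n; rewrite ler_norml; apply/andP; split.
    have : f n x - tail n * `|x| <= sup S by apply: sup_upper_bound => //; exists n.
    lra.
  have : sup S <= f n x + tail n * `|x| by apply: ge_sup; [case: hS|exact: hub].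
  lra.
have [l {}hl] := choice hl.
have tail_lim (r c : R) : 0 <= c -> (forall n, r <= tail n * c) -> r <= 0.
  move=> c0 h; apply/ler_addgt0Pr => e e0; rewrite add0r.
  pose n := (Num.truncn (3 / 2 * c / e)).+1.
  apply: (le_trans (h n)); rewrite /tail -mulrA exprVn mulrC ler_pdivrMr ?exprn_gt0 //.
  have h1 : 3 / 2 * c / e < n%:R by exact: truncnS_gt.
  have h2 : (n%:R : R) <= 3 ^+ n by rewrite -natrX ler_nat ltnW // ltn_expl.
  by have := lt_le_trans h1 h2; rewrite ltr_pdivrMr // [e * _]mulrC => /ltW.
have lb : bounded_functional l (tail 0%N).
  split=> [x y|r x|x].
  - apply/eqP; rewrite -subr_eq0 -normr_le0; apply: (tail_lim _ (`|x + y| + `|x| + `|y|)).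
      by rewrite !addr_ge0.
    move=> n; have [C [fD _ _]] := fb n.
    have := hl (x + y) n; have := hl x n; have := hl y n; rewrite fD !ler_norml !mulrDr.
    move=> /andP[h1 h2] /andP[h3 h4] /andP[h5 h6]; apply/andP; split; lra.
  - apply/eqP; rewrite -subr_eq0 -normr_le0; apply: (tail_lim _ (`|r *: x| + `|r| * `|x|)).
      by rewrite addr_ge0 // mulr_ge0.
    move=> n; have [C [_ fZ _]] := fb n.
    have h1 := hl (r *: x) n; have h2 := ler_wpM2l (normr_ge0 r) (hl x n).
    rewrite fZ in h1; rewrite -normrM mulrBr in h2.
    have -> : l (r *: x) - r * l x = (l (r *: x) - r * f n x) - (r * l x - r * f n x) by ring.
    apply: (le_trans (ler_normB _ _)); rewrite mulrDr [tail n * (_ * _)]mulrCA; exact: lerD.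
  - by have := hl x 0%N; rewrite /= subr0.
have [u hu] := dual_of lb; have [u' hu'] := dualZ (-1) u.
pose K := Num.max (support_fun u A) (support_fun u' A).
have uK b : A b -> `|pairing u b| <= K.
  move=> Ab; have h1 := support_ge u cA Ab; have h2 := support_ge u' cA Ab.
  rewrite hu' mulN1r in h2; rewrite ler_norml lerNl /K !le_max h2 h1 orbT //.
have [n hn2] : exists n : nat, 2 * K < n%:R.
  by exists (Num.truncn (2 * K)).+1; exact: truncnS_gt.
have [An an] := ha n; have := uK _ An; rewrite hu.
have [_ h1] := fS n; have h2 := hl (a n) n.+1.
have h3 : `|f n.+1 (a n)| <= `|l (a n)| + tail n.+1 * `|a n|.
  by rewrite -lerBlDl (le_trans _ h2) // distrC lerB_dist.
have e1 : tail n.+1 * `|a n| = 3^-1 ^+ n / 2 * `|a n| by rewrite /tail exprS; move: (3^-1 ^+ n) => z; congr (_ * _); field.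
have h4 : n%:R / 2 <= 3^-1 ^+ n / 2 * `|a n|.
  rewrite mulrAC ler_pM2r ?invr_gt0 // exprVn mulrC ler_pdivlMr ?exprn_gt0 //.
  by rewrite mulrC.
have e2 : 3^-1 ^+ n * `|a n| = 3^-1 ^+ n / 2 * `|a n| + 3^-1 ^+ n / 2 * `|a n| by rewrite -mulrDl -splitr.
rewrite e2 in h1; rewrite e1 in h3; move: hn2 An h1 h3 h4.
move: (3^-1 ^+ n / 2 * `|a n|) (`|f n.+1 (a n)|) (`|l (a n)|) (n%:R : R) => z y x N.
clear; lra.
Qed.

End WeakTopology.

(** * Convex weakly compact sets and their support functions *)

Section Cwk.
Context {R : realType} {X : completeNormedModType R}.
Implicit Types (u v w : dual X) (x y a b : X) (A B C : set X).

Lemma mink_addP A B x : mink_add A B x <-> exists a b, [/\ A a, B b & x = a + b].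
Proof.
split=> [[a Aa [b Bb <-]]|[a [b [Aa Bb ->]]]]; first by exists a, b.
by exists a => //; exists b.
Qed.

Lemma weakly_compact_add A B : weakly_compact A -> weakly_compact B ->
  weakly_compact (mink_add A B).
Proof.
move=> cA cB; pose f (z : weak_space X * weak_space X) : weak_space X := (z.1 : X) + (z.2 : X).
have cf : continuous f.
  move=> z; have FF : Filter (f z0 @[z0 --> z]) by exact: fmap_filter.
  have [_ h] := @weak_cvgP R X _ (f z) FF; apply: h => u.
  suff : (fun z0 => pairing u z0.1 + pairing u z0.2) z0 @[z0 --> z] --> pairing u z.1 + pairing u z.2.
    have -> : (fun z0 => pairing u z0.1 + pairing u z0.2) = pairing u \o f.
      by apply/funext => z0; rewrite /= pairingD.
    by rewrite -pairingD.
  apply: cvgD.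
    apply: (@cvg_comp _ _ _ (fst : weak_space X * weak_space X -> _) (pairing u)); first exact: cvg_fst.
    exact: pairing_weak_continuous.
  apply: (@cvg_comp _ _ _ (snd : weak_space X * weak_space X -> _) (pairing u)); first exact: cvg_snd.
  exact: pairing_weak_continuous.
rewrite /weakly_compact.
have -> : mink_add A B = f @` (A `*` B).
  apply/seteqP; split=> x; first by move=> /mink_addP[a [b [Aa Bb ->]]]; exists (a, b).
  by move=> [[a b] [Aa Bb] <-]; apply/mink_addP; exists a, b.
apply: (@continuous_compact (weak_space X * weak_space X)%type (weak_space X) f).
  exact: continuous_subspaceT.
exact: compact_setX.
Qed.

Lemma weakly_compact_scale (r : R) A : weakly_compact A -> weakly_compact (mink_scale r A).
Proof.
move=> cA; pose f (x : weak_space X) : weak_space X := r *: (x : X).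
have cf : continuous f.
  move=> z; have Fz : Filter (nbhs (z : weak_space X)) by exact: nbhs_filter.
  have FF : Filter (f z0 @[z0 --> (z : weak_space X)]) by exact: fmap_filter.
  have [_ h] := @weak_cvgP R X _ (f z) FF; apply: h => u.
  suff : (fun z0 => r * pairing u z0) z0 @[z0 --> z] --> r * pairing u z.
    have -> : (fun z0 => r * pairing u z0) = pairing u \o f.
      by apply/funext => z0; rewrite /= pairingZ.
    by rewrite -pairingZ.
  by apply: cvgMr; exact: pairing_weak_continuous.
apply: (@continuous_compact (weak_space X) (weak_space X) f) => //.
exact: continuous_subspaceT.
Qed.

Lemma weakly_compact_set1 x : weakly_compact [set x].
Proof. exact: compact_set1. Qed.

Lemma cwk_add A B : cwk A -> cwk B -> cwk (mink_add A B).
Proof.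
move=> [[a Aa] vA cA] [[b Bb] vB cB]; split; last exact: weakly_compact_add.
  by exists (a + b); apply/mink_addP; exists a, b.
apply/convex_setE => x y l l01 /mink_addP[a1 [b1 [Aa1 Bb1 ->]]] /mink_addP[a2 [b2 [Aa2 Bb2 ->]]].
apply/mink_addP; exists (l *: a1 + (1 - l) *: a2), (l *: b1 + (1 - l) *: b2); split.
- exact: (convex_setE A).1.
- exact: (convex_setE B).1.
- by rewrite !scalerDr addrACA.
Qed.

Lemma cwk_scale (r : R) A : cwk A -> cwk (mink_scale r A).
Proof.
move=> [[a Aa] vA cA]; split; last exact: weakly_compact_scale.
  by exists (r *: a), a.
apply/convex_setE => _ _ l l01 [a1 Aa1 <-] [a2 Aa2 <-].
exists (l *: a1 + (1 - l) *: a2); first exact: (convex_setE A).1.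
by rewrite scalerDr !scalerA ![r * _]mulrC.
Qed.

Lemma cwk_set1 x : cwk [set x].
Proof.
split; [by exists x| |exact: weakly_compact_set1].
by apply/convex_setE => a b l _ -> ->; rewrite -scalerDl subrKC scale1r.
Qed.

Lemma support_add u A B : cwk A -> cwk B ->
  support_fun u (mink_add A B) = support_fun u A + support_fun u B.
Proof.
move=> cA cB; have [AB0 _ kAB] := cwk_add cA cB; have [A0 _ kA] := cA; have [B0 _ kB] := cB.
apply/eqP; rewrite eq_le; apply/andP; split.
  apply: support_le => // x /mink_addP[a [b [Aa Bb ->]]].
  by rewrite pairingD lerD ?support_ge.
have [a Aa ->] := support_attained u kA A0; have [b Bb ->] := support_attained u kB B0.
by rewrite -pairingD; apply: support_ge => //; apply/mink_addP; exists a, b.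
Qed.

Lemma support_scale u (r : R) A : 0 <= r -> cwk A ->
  support_fun u (mink_scale r A) = r * support_fun u A.
Proof.
move=> r0 cA; have [rA0 _ krA] := cwk_scale r cA; have [A0 _ kA] := cA.
apply/eqP; rewrite eq_le; apply/andP; split.
  by apply: support_le => // _ [a Aa <-]; rewrite pairingZ ler_wpM2l ?support_ge.
have [a Aa ->] := support_attained u kA A0.
by rewrite -pairingZ; apply: support_ge => //; exists a.
Qed.

Lemma support_set1 u x : support_fun u [set x] = pairing u x.
Proof.
by have [a -> ->] := support_attained u (@weakly_compact_set1 x) (ex_intro _ x erefl).
Qed.

(** For dist (a, B) > r, separation yields a functional of norm one by which
    the support functions differ by more than r. *)
Lemma dist_le_support A B a (r : R) : cwk A -> cwk B -> A a -> 0 <= r ->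
  (forall u, dual_ball u -> support_fun u A <= support_fun u B + r) ->
  (ereal_inf [set `|a - b|%:E | b in B] <= r%:E)%E.
Proof.
move=> [A0 vA kA] [[b0 Bb0] vB kB] Aa r0 h; rewrite leNgt; apply/negP => lt.
have [rho rrho hrho] : exists2 rho : R, r < rho & forall b, B b -> rho <= `|a - b|.
  have b0le : (ereal_inf [set `|a - b|%:E | b in B] <= `|a - b0|%:E)%E by apply: ereal_inf_lbound; exists b0.
  have fin : ereal_inf [set `|a - b|%:E | b in B] \is a fin_num.
    by rewrite fin_numE; apply/andP; split; apply/eqP => e; move: lt b0le; rewrite e.
  exists (fine (ereal_inf [set `|a - b|%:E | b in B])); first by rewrite -lte_fin fineK.
  by move=> b Bb; rewrite -lee_fin fineK //; apply: ereal_inf_lbound; exists b.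
have [|//||u hu hs] := @separation R X B a rho _ vB; first by exists b0.
  exact: le_trans r0 (ltW rrho).
  by move=> b Bb; rewrite distrC hrho.
have [b Bb sb] := support_attained u kB (ex_intro _ b0 Bb0).
have h1 := h u hu; have h2 := support_ge u kA Aa; have h3 := hs b Bb.
rewrite sb in h1; lra.
Qed.

Lemma near_point A B a (r r' : R) : cwk A -> cwk B -> A a -> 0 <= r -> r < r' ->
  (forall u, dual_ball u -> support_fun u A <= support_fun u B + r) ->
  exists2 b, B b & `|a - b| < r'.
Proof.
move=> cA cB Aa r0 rr h.
have : (ereal_inf [set `|a - b|%:E | b in B] < r'%:E)%E.
  by apply: le_lt_trans (dist_le_support cA cB Aa r0 h) _; rewrite lte_fin.
by move=> /ereal_inf_lt[_ [b Bb <-]]; rewrite lte_fin; exists b.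
Qed.

Lemma support_le_dist A B (r : R) u : cwk A -> cwk B -> dual_ball u ->
  (hausdorff_dist A B <= r%:E)%E -> support_fun u A <= support_fun u B + r.
Proof.
move=> [A0 vA kA] [B0 vB kB] hu; rewrite /hausdorff_dist ge_max => /andP[h _].
have [a Aa ->] := support_attained u kA A0.
have {}h : (ereal_inf [set `|a - b|%:E | b in B] <= r%:E)%E.
  by apply: le_trans h; apply: ereal_sup_ubound; exists a.
apply/ler_addgt0Pr => e e0.
have : (ereal_inf [set `|a - b|%:E | b in B] < (r + e)%:E)%E.
  by apply: (le_lt_trans h); rewrite lte_fin ltrDl.
move=> /ereal_inf_lt[_ [b Bb <-]]; rewrite lte_fin => abr.
have := hu (a - b); rewrite pairingB => h1; have := support_ge u kB Bb.
have := ler_norm (pairing u a - pairing u b); lra.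
Qed.

Lemma hausdorff_sym A B : hausdorff_dist A B = hausdorff_dist B A.
Proof.
rewrite /hausdorff_dist maxC; congr maxe; congr ereal_sup; apply/seteqP; split=> _ [a Aa <-];
  exists a => //; congr ereal_inf; apply/seteqP; split=> _ [b Bb <-]; exists b => //;
  by rewrite distrC.
Qed.

(** Hoermander's formula: the Hausdorff distance is the supremum over the dual
    ball of the differences of support functions. *)
Lemma hausdorff_leP A B (r : R) : cwk A -> cwk B -> 0 <= r ->
  (hausdorff_dist A B <= r%:E)%E <->
  forall u, dual_ball u -> `|support_fun u A - support_fun u B| <= r.
Proof.
move=> cA cB r0; split=> [h u hu|h].
  have h1 := support_le_dist cA cB hu h; rewrite hausdorff_sym in h.
  have h2 := support_le_dist cB cA hu h; rewrite ler_norml; lra.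
rewrite /hausdorff_dist ge_max; apply/andP; split; apply: ge_ereal_sup => _ [a Aa <-].
  by apply: (dist_le_support cA cB Aa r0) => u hu; have := h u hu; rewrite ler_norml; lra.
have -> : [set `|a0 - a|%:E | a0 in A] = [set `|a - a0|%:E | a0 in A].
  by apply/seteqP; split=> _ [b Ab <-]; exists b => //; rewrite distrC.
by apply: (dist_le_support cB cA Aa r0) => u hu; have := h u hu; rewrite ler_norml; lra.
Qed.

Lemma cwk_near A B : cwk A -> cwk B -> (forall u, dual_ball u -> support_fun u A <= support_fun u B) ->
  A `<=` B.
Proof.
move=> cA cB h a Aa; have [_ _ kB] := cB; apply: weakly_compact_closed => // e e0.
by apply: (near_point cA cB Aa (lexx 0) e0) => u hu; rewrite addr0 h.
Qed.

Lemma cwk_eq A B : cwk A -> cwk B -> (forall u, dual_ball u -> support_fun u A = support_fun u B) ->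
  A = B.
Proof.
by move=> cA cB h; apply/seteqP; split; apply: cwk_near => // u /h ->.
Qed.

End Cwk.

Lemma ultra_fmap (T U : Type) (f : T -> U) (F : set_system T) :
  UltraFilter F -> UltraFilter (fmap f F).
Proof.
move=> UF; have PF := @ultra_proper _ _ UF; split; first exact: fmap_proper_filter.
move=> G PG FG; apply/seteqP; split=> // A GA.
have [//|FnA] := in_ultra_setVsetC (f @^-1` A) UF.
have GnA : G (~` A) by exact: FG.
by have [x [Ax nAx]] := filter_ex (filterI GA GnA).
Qed.

Section CwkNorm.
Context {R : realType} {X : completeNormedModType R}.
Implicit Types (u v w : dual X) (x y a b : X) (A B C : set X) (e : R).

Definition snorm A : R := fine (set_norm A).

Lemma set_norm_leP A (r : R) : cwk A -> 0 <= r ->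
  (set_norm A <= r%:E)%E <-> forall u, dual_ball u -> `|support_fun u A| <= r.
Proof.
move=> cA r0; rewrite /set_norm (hausdorff_leP cA (cwk_set1 0) r0).
by split=> h u /h; rewrite support_set1 pairing0 subr0.
Qed.

Lemma support_norm_le A (r : R) u : cwk A -> (forall a, A a -> `|a| <= r) -> dual_ball u ->
  `|support_fun u A| <= r.
Proof.
move=> [A0 _ kA] h hu; have [a Aa ->] := support_attained u kA A0.
exact: le_trans (hu a) (h a Aa).
Qed.

Lemma set_norm_ge0 A : cwk A -> (0 <= set_norm A)%E.
Proof.
move=> [[a Aa] _ _]; rewrite /set_norm /hausdorff_dist le_max; apply/orP; left.
apply: (@le_trans _ _ (ereal_inf [set `|a - b|%:E | b in [set 0]])).
  by apply: le_ereal_inf_tmp => _ [b _ <-]; rewrite lee_fin.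
by apply: ereal_sup_ubound; exists a.
Qed.

Lemma set_norm_fin A : cwk A -> set_norm A \is a fin_num.
Proof.
move=> cA; have [A0 _ kA] := cA; have [M hM] := weakly_compact_bounded kA.
have M0 : 0 <= Num.max M 0 by rewrite le_max lexx orbT.
rewrite ge0_fin_numE ?set_norm_ge0 //; apply: (@le_lt_trans _ _ (Num.max M 0)%:E); last exact: ltry.
apply/(set_norm_leP cA M0) => u hu; apply: support_norm_le => // a Aa.
by rewrite le_max hM.
Qed.

Lemma snorm_ge0 A : cwk A -> 0 <= snorm A.
Proof. by move=> cA; apply: fine_ge0; exact: set_norm_ge0. Qed.

Lemma snorm_leP A (r : R) : cwk A -> 0 <= r ->
  snorm A <= r <-> forall u, dual_ball u -> `|support_fun u A| <= r.
Proof. by move=> cA r0; rewrite -lee_fin fineK ?set_norm_fin //; exact: set_norm_leP. Qed.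

Lemma support_le_snorm A u : cwk A -> dual_ball u -> `|support_fun u A| <= snorm A.
Proof. by move=> cA; apply: (snorm_leP cA (snorm_ge0 cA)).1. Qed.

Lemma norm_le_snorm A a : cwk A -> A a -> `|a| <= snorm A.
Proof.
move=> cA Aa; have [_ _ kA] := cA; apply: norm_le_dual => u hu.
apply: (le_trans (support_ge u kA Aa)); apply: (le_trans (ler_norm _)).
exact: support_le_snorm.
Qed.

Lemma snorm_sub A B : cwk A -> cwk B -> A `<=` B -> snorm A <= snorm B.
Proof.
move=> cA cB AB; apply/(snorm_leP cA (snorm_ge0 cB)) => u hu.
by apply: support_norm_le => // a /AB; exact: norm_le_snorm.
Qed.

(** Grothendieck's criterion: a closed set that can be approximated in norm by
    weakly compact subsets is weakly compact.  An ultrafilter on S is pushed into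
    these subsets; the resulting weak limits form a norm Cauchy sequence, whose
    limit is the weak limit of the ultrafilter. *)
Lemma weakly_compact_approx S :
  (forall e, 0 < e -> exists C, [/\ weakly_compact C, C `<=` S &
     forall x, S x -> exists c, C c /\ `|x - c| <= e]) ->
  (forall x, (forall e, 0 < e -> exists2 y, S y & `|x - y| < e) -> S x) ->
  weakly_compact S.
Proof.
move=> near Sclosed.
apply/weakly_compactP => F UF FS; have PF := @ultra_proper _ _ UF.
have hpi k : exists (C : set X) (pi_ : X -> X), [/\ weakly_compact C, C `<=` S &
    forall x, S x -> C (pi_ x) /\ `|x - pi_ x| <= k.+1%:R^-1].
  have [C [kC CS hC]] := near _ (inv_nat_gt0 R k); exists C.
  have hc x : exists c, S x -> C c /\ `|x - c| <= k.+1%:R^-1.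
    by have [/hC[c hc]|] := pselect (S x); [exists c|exists 0].
  by have [pi_ hpi] := choice hc; exists pi_.
have [C {}hpi] := choice hpi; have [pi_ {}hpi] := choice hpi.
have hp k : exists p, C k p /\ forall u, pairing u (pi_ k x) @[x --> F] --> pairing u p.
  have [/weakly_compactP kC _ hk] := hpi k.
  have UG := @ultra_fmap _ _ (pi_ k) F UF.
  have [|p Cp hp] := kC _ UG; last by exists p.
  by apply: (@filterS _ F _ S) FS => x Sx; have [] := hk x Sx.
have [p {}hp] := choice hp.
have hFp k u (e : R) : dual_ball u -> 0 < e ->
    F [set x | `|pairing u x - pairing u (p k)| <= k.+1%:R^-1 + e].
  move=> hu e0; have [_ /(_ u) /cvgrPdist_le /(_ e e0) hF] := hp k.
  apply: filterS (filterI FS hF) => x [Sx /= xe]; have [_ _ /(_ x Sx)[_ xpi]] := hpi k.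
  apply: (le_trans (ler_distD (pairing u (pi_ k x)) _ _)); apply: lerD.
    by rewrite -pairingB (le_trans (hu _)).
  by rewrite distrC.
have pp k m : `|p k - p m| <= k.+1%:R^-1 + m.+1%:R^-1.
  apply: norm_le_dual => u hu; apply/ler_addgt0Pr => e e0.
  have e2 : 0 < e / 2 by rewrite divr_gt0.
  have [x [h1 h2]] := filter_ex (filterI (hFp k u _ hu e2) (hFp m u _ hu e2)).
  rewrite pairingB; apply: (le_trans (ler_norm _)).
  apply: (le_trans (ler_distD (pairing u x) _ _)); rewrite distrC.
  by move: h1 h2 => /=; move: `|_| `|_| => z1 z2; rewrite {3}(splitr e) addrACA; exact: lerD.
have small (e : R) : 0 < e -> exists K, forall k, (K <= k)%N -> k.+1%:R^-1 <= e.
  move=> /inv_nat_small[K /ltW hK]; exists K => k Kk; apply: le_trans hK.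
  by rewrite lef_pV2 ?posrE // ler_nat.
have cp : cvgn p.
  apply/cauchy_cvgP; apply: cauchy_exP => e e0; have e3 : 0 < e / 3 by rewrite divr_gt0.
  have [K hK] := small _ e3; exists (p K); exists K => // m /= Km; rewrite -ball_normE /=.
  by apply: (le_lt_trans (pp K m)); apply: (le_lt_trans (lerD (hK _ (leqnn K)) (hK _ Km))); lra.
pose q : X := limn p.
have hq (e : R) : 0 < e -> exists k, `|q - p k| < e /\ k.+1%:R^-1 <= e.
  move=> e0; move/cvgrPdist_lt: cp => /(_ e e0)[K1 _ h1]; have [K2 h2] := small e e0.
  by exists (maxn K1 K2); split; [apply: h1; exact: leq_maxl|apply: h2; exact: leq_maxr].
exists q.
  apply: Sclosed => e /hq[k [qk _]]; exists (p k) => //.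
  by have [Cp _] := hp k; have [_ CS _] := hpi k; exact: CS.
have ball_cvg v : dual_ball v -> pairing v x @[x --> F] --> pairing v q.
  move=> hv; apply/cvgrPdist_le => e e0; have e3 : 0 < e / 3 by rewrite divr_gt0.
  have [k [qk ke]] := hq _ e3.
  apply: filterS (hFp k v _ hv e3) => x /= hx.
  apply: (le_trans (ler_distD (pairing v (p k)) _ _)).
  have h1 := hv (q - p k); rewrite pairingB in h1; rewrite distrC in hx.
  have h2 := le_trans hx (lerD ke (lexx _)); lra.
move=> u; have [c c0 [v hv huv]] := dual_ball_scale u.
rewrite huv; have -> : pairing u = fun x => c * pairing v x by apply/funext.
by apply: cvgMr; exact: ball_cvg.
Qed.

(** An increasing Cauchy sequence of sets converges to the closure of its
    union. *)
Theorem cwk_limit (C : nat -> set X) : (forall n, cwk (C n)) ->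
  (forall n, C n `<=` C n.+1) ->
  (forall e : R, 0 < e -> exists N, forall n u, (N <= n)%N -> dual_ball u ->
     support_fun u (C n) <= support_fun u (C N) + e) ->
  exists S, [/\ cwk S, forall n, C n `<=` S & forall e : R, 0 < e -> exists N,
     forall n u, (N <= n)%N -> dual_ball u -> support_fun u S <= support_fun u (C n) + e].
Proof.
move=> cC C1 Cauchy.
have Cmono m n : (m <= n)%N -> C m `<=` C n.
  elim: n => [|n IH]; first by rewrite leqn0 => /eqP ->.
  by rewrite leq_eqVlt => /predU1P[->//|]; rewrite ltnS => /IH h; exact: subset_trans (C1 n).
pose S := [set x | forall e : R, 0 < e -> exists n c, C n c /\ `|x - c| < e].
have CS n : C n `<=` S by move=> x Cx e e0; exists n, x; rewrite subrr normr0.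
have near (e : R) : 0 < e -> exists N, forall x, S x -> exists c, C N c /\ `|x - c| <= e.
  move=> e0; have e3 : 0 < e / 3 by rewrite divr_gt0.
  have [N hN] := Cauchy _ e3; exists N => x /(_ _ e3)[n [c [Cc xc]]].
  have Cc' : C (maxn n N) c by apply: Cmono Cc; exact: leq_maxl.
  have e33 : e / 3 < e / 3 + e / 3 by rewrite ltrDl.
  have [u hu|b Cb cb] := near_point (cC (maxn n N)) (cC N) Cc' (ltW e3) e33.
    by apply: hN => //; exact: leq_maxr.
  exists b; split=> //.
  by apply: (le_trans (ler_distD c _ _)); lra.
have cS : cwk S.
  split.
  - by have [[x Cx] _ _] := cC 0%N; exists x; exact: CS Cx.
  - apply/convex_setE => a b l /andP[l0 l1] Sa Sb e e0.
    have [n [c [Cc ac]]] := Sa e e0; have [m [d [Cd bd]]] := Sb e e0.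
    have [_ v _] := cC (maxn n m).
    exists (maxn n m), (l *: c + (1 - l) *: d); split.
      apply: (convex_setE _).1 => //; first by rewrite l0 l1.
        by apply: Cmono Cc; exact: leq_maxl.
      by apply: Cmono Cd; exact: leq_maxr.
    rewrite opprD addrACA -!scalerBr; apply: (le_lt_trans (ler_normD _ _)).
    rewrite !normrZ (ger0_norm l0) (@ger0_norm _ (1 - l)) ?subr_ge0 //.
    have [->|ln0] := eqVneq l 0; first by rewrite mul0r subr0 mul1r add0r.
    have lp : 0 < l by rewrite lt_neqAle eq_sym ln0.
    have -> : e = l * e + (1 - l) * e by ring.
    by rewrite ltr_leD ?ltr_pM2l // ler_wpM2l ?subr_ge0 // ltW.
  - apply: weakly_compact_approx => [e e0|x h e e0].
      have [N hN] := near e e0; have [_ _ kN] := cC N.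
      by exists (C N); split=> //; exact: CS.
    have e2 : 0 < e / 2 by rewrite divr_gt0.
    have [y Sy xy] := h _ e2; have [n [c [Cc yc]]] := Sy _ e2; exists n, c; split=> //.
    by rewrite (le_lt_trans (ler_distD y _ _)) // [ltRHS]splitr ltrD.
exists S; split=> // e /near[N hN]; exists N => n u Nn hu.
have [S0 _ kS] := cS; have [x Sx ->] := support_attained u kS S0.
have [c [Cc xc]] := hN x Sx; have [_ _ kn] := cC n.
have := support_ge u kn (Cmono _ _ Nn _ Cc); have := hu (x - c); rewrite pairingB.
have := ler_norm (pairing u x - pairing u c); lra.
Qed.

End CwkNorm.

Section Representation.
Context {R : realType} {X : completeNormedModType R} (K : set X) (xi : dual X -> R).
Context (cK : cwk K).
Context (xiD : forall u v w : dual X,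
  (forall x, pairing w x = pairing u x + pairing v x) -> xi w = xi u + xi v).
Context (xiZ : forall (r : R) (u v : dual X),
  (forall x, pairing v x = r * pairing u x) -> xi v = r * xi u).
Context (xiK : forall u, xi u <= support_fun u K).
Implicit Types (L : seq (dual X)) (u : dual X).

Lemma linear_combination (d : dual X -> R) L : exists y : dual X,
  (forall x, pairing y x = \sum_(u <- L) d u * pairing u x) /\
  xi y = \sum_(u <- L) d u * xi u.
Proof.
elim: L => [|u L [y [hy xy]]].
  have [|y hy] := @dual_of R X (fun=> 0) 0.
    by split=> *; rewrite ?addr0 ?mulr0 ?normr0 ?mul0r.
  exists y; split=> [x|]; rewrite big_nil //.
  have [v hv] := dualZ 0 y; have hyv x : pairing y x = 0 * pairing v x by rewrite hy mul0r.
  by rewrite (xiZ hyv) mul0r.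
have [v hv] := dualZ (d u) u; have [w hw] := dualD v y; exists w; split=> [x|].
  by rewrite big_cons hw hv hy.
by rewrite big_cons (xiD hw) (xiZ hv) xy.
Qed.

(** Finitely many values are attained simultaneously: at a point z0 of K
    minimizing the sum of squared errors, the first order condition says that
    the combination of the functionals with the errors as coefficients attains
    its maximum over K at z0, so that all errors vanish. *)
Lemma finite_representation L : exists z, K z /\ forall u, List.In u L -> pairing u z = xi u.
Proof.
have [K0 vK wK] := cK.
pose q (z : X) := \sum_(u <- L) (xi u - pairing u z) ^+ 2.
have cq : continuous (q : weak_space X -> R).
  rewrite /q; elim: (L) => [|u L' IH].
    rewrite (_ : (fun z => _) = fun=> 0); first exact: cst_continuous.
    by apply/funext => z; rewrite big_nil.
  rewrite (_ : (fun z => _) = fun z => (xi u - pairing u z) ^+ 2 + \sum_(u <- L') (xi u - pairing u z) ^+ 2).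
    move=> z; have Fz : Filter (nbhs (z : weak_space X)) by exact: nbhs_filter.
    have h : (xi u - pairing u y) @[y --> (z : weak_space X)] --> xi u - pairing u z.
      exact: (@cvgB _ _ _ _ Fz _ _ _ _ (cvg_cst _) (@pairing_weak_continuous R X u z)).
    have h2 : (xi u - pairing u y) * (xi u - pairing u y) @[y --> (z : weak_space X)] -->
      (xi u - pairing u z) * (xi u - pairing u z) by exact: (@cvgM _ _ _ Fz).
    exact: (@cvgD _ _ _ _ Fz _ _ _ _ h2 (IH z)).
  by apply/funext => z; rewrite big_cons.
have [|z0 /set_mem Kz0 hz0] := @compact_EVT_min (weak_space X) R q K K0 wK.
  exact: continuous_subspaceT.
exists z0; split=> //; pose d u := xi u - pairing u z0.
have [y [hy xy]] := linear_combination d L.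
have ymax z : K z -> pairing y z <= pairing y z0.
  move=> Kz; rewrite leNgt; apply/negP => lt.
  pose D := pairing y z - pairing y z0; have D0 : 0 < D by rewrite subr_gt0.
  pose B := \sum_(u <- L) (pairing u z - pairing u z0) ^+ 2.
  have B0 : 0 <= B by apply: sumr_ge0 => u _; exact: sqr_ge0.
  have key t : 0 <= t <= 1 -> 2 * t * D <= t ^+ 2 * B.
    move=> t01; have Kt : K (t *: z + (1 - t) *: z0) by exact: (convex_setE K).1.
    have := hz0 _ (mem_set Kt).
    have -> : q (t *: z + (1 - t) *: z0) = q z0 - 2 * t * D + t ^+ 2 * B.
      rewrite /q /D !hy -sumrB !mulr_sumr -sumrB -big_split; apply: eq_bigr => u _ /=.
      by rewrite pairingD !pairingZ /d; ring.
    lra.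
  pose t := D / (D + B + 1).
  have DB : 0 < D + B + 1 by lra.
  have t0 : 0 < t by rewrite divr_gt0.
  have t1 : t <= 1 by rewrite ler_pdivrMr //; lra.
  have := key t; rewrite (ltW t0) t1 => /(_ isT).
  rewrite mulrAC [_ * D * t]mulrC expr2 -mulrA ler_pM2l //.
  have : t * B <= D by rewrite /t mulrAC ler_pdivrMr // ler_pM2l //; lra.
  lra.
have sum0 : \sum_(u <- L) d u ^+ 2 <= 0.
  have : xi y <= pairing y z0.
    by apply: (le_trans (xiK y)); apply: support_le => // z; exact: ymax.
  rewrite xy hy -subr_ge0 -sumrB -oppr_le0 -sumrN.
  by rewrite (eq_bigr (fun u => d u ^+ 2)) // => u _; rewrite /d; ring.
elim: L sum0 {q cq hz0 hy xy} => // v L' IH.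
rewrite big_cons => sum0 u.
have h1 : 0 <= d v ^+ 2 by exact: sqr_ge0.
have h2 : 0 <= \sum_(u <- L') d u ^+ 2 by apply: sumr_ge0 => w _; exact: sqr_ge0.
case=> [<-|]; last by apply: IH; lra.
have /eqP : d v ^+ 2 = 0 by lra.
by rewrite expf_eq0 /= subr_eq0 => /eqP ->.
Qed.

(** The points of K representing xi on a finite set of functionals form nonempty
    sets directed by inclusion; weak compactness provides a common point. *)
Theorem representation : exists z, K z /\ forall u, pairing u z = xi u.
Proof.
have [K0 vK wK] := cK.
pose B L := [set z | K z /\ forall u, List.In u L -> pairing u z = xi u].
have PF : ProperFilter (filter_from [set: seq (dual X)] B).
  apply: filter_from_proper; last by move=> L _; exact: finite_representation.
  apply: filter_from_filter; first by exists [::].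
  move=> L L' _ _; exists (L ++ L') => // z [Kz hz].
  by split; split=> // u h; apply: hz; apply/List.in_app_iff; [left|right].
have [G [UG FG]] := ultraFilterLemma PF.
have [|z Kz hz] := (weakly_compactP K).1 wK G UG; first by apply: FG; exists [::] => // z [].
exists z; split=> // u; apply: (@filter_limit_unique _ _ G (pairing u) _ _ ultra_proper (hz u)) => e e0.
apply: FG; exists [:: u] => // x [_ h] /=; rewrite h /=; last by left.
by rewrite subrr normr0 ltW.
Qed.

End Representation.

(** * Sums over countable partitions *)

Section FiberMeasure.
Context {R : realType}.
Implicit Types (A B : set R).
Notation mes A := (fine (lambda A)).

Lemma mesDI A B : A `<=` `[0, 1]%classic -> lebesgue_measurable A -> lebesgue_measurable B ->
  mes A = mes (A `\` B) + mes (A `&` B).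
Proof.
move=> A01 mA mB; rewrite (lambdaDI mA mB) fineD //.
  by apply: (@lambda_fin_num R 0 1) => t [/A01].
by apply: (@lambda_fin_num R 0 1) => t [/A01].
Qed.

Lemma sum_mes_fibers_le A (J : R -> nat) (s : seq nat) : A `<=` `[0, 1]%classic ->
  lebesgue_measurable A -> uniq s ->
  (forall i, lebesgue_measurable (fiber 0 1 J i)) ->
  \sum_(i <- s) mes (fiber 0 1 J i `&` A) <= mes A.
Proof.
move=> A01 mA us mJ; elim: s A A01 mA us => [|i s IH] A A01 mA.
  by rewrite big_nil mes_ge0.
move=> /= /andP[nis us]; rewrite big_cons (mesDI A01 mA (mJ i)) addrC setIC.
rewrite lerD2r.
apply: le_trans (IH _ _ _ us); last 2 first.
- by move=> t [/A01].
- exact: lebesgue_measurableD.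
rewrite big_seq [leRHS]big_seq ler_sum // => j js.
apply: (@mes_le R 0 1); last by move=> t [_ [/A01]].
move=> t [Jt At]; split=> //; split=> // -[_ Ji].
by move: nis; rewrite -Ji (_ : J t = j) ?js //; case: Jt.
Qed.

Lemma mes_fibers_subadd (J : R -> nat) (s : seq nat) :
  (forall i, lebesgue_measurable (fiber 0 1 J i)) ->
  mes [set t | 0 <= t <= 1 /\ J t \in s] <= \sum_(i <- s) mes (fiber 0 1 J i).
Proof.
move=> mJ; elim: s => [|i s IH].
  rewrite big_nil (_ : [set t | _] = set0) /=; last by apply/seteqP; split=> // t [].
  by rewrite lambda_outer outer_measure0.
rewrite big_cons.
have sub (s' : seq nat) : [set t | 0 <= t <= 1 /\ J t \in s'] `<=` `[0, 1]%classic.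
  by move=> t [h _]; rewrite /= in_itv.
apply: le_trans (lerD (lexx _) IH).
have f1 := lambda_fin_num (sub (i :: s)); have f2 := lambda_fin_num (sub s).
have f3 := lambda_fin_num (@fiber_sub R _ 0 1 J i).
rewrite -lee_fin EFinD !fineK //.
apply: (@le_trans _ _ (lambda (fiber 0 1 J i `|` [set t | 0 <= t <= 1 /\ J t \in s]))).
  by apply: lambda_le => t [h]; rewrite inE => /predU1P[Ji|Js]; [left|right].
by rewrite !lambda_outer outer_measureU2.
Qed.

Lemma measurable_fibers_in (J : R -> nat) (s : seq nat) :
  (forall i, lebesgue_measurable (fiber 0 1 J i)) ->
  lebesgue_measurable [set t | 0 <= t <= 1 /\ J t \in s].
Proof.
move=> mJ; elim: s => [|i s IH].
  rewrite (_ : [set t | _] = set0); first exact: lebesgue_measurable0.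
  by apply/seteqP; split=> // t [].
rewrite (_ : [set t | _] = fiber 0 1 J i `|` [set t | 0 <= t <= 1 /\ J t \in s]).
  exact: lebesgue_measurableU.
apply/seteqP; split=> t.
  by move=> [h]; rewrite inE => /predU1P[Ji|Js]; [left|right].
by move=> [[h <-]|[h Js]]; split=> //; rewrite inE ?eqxx ?Js ?orbT.
Qed.

(** Countable additivity, read off a single partition into intervals: the
    remaining fibres have small total measure. *)
Lemma mes_tail (J : R -> nat) (eta : R) : 0 < eta ->
  (forall i, lebesgue_measurable (fiber 0 1 J i)) ->
  exists N, forall s, uniq s -> (forall i, i \in s -> (N <= i)%N) ->
    \sum_(i <- s) mes (fiber 0 1 J i) <= eta.
Proof.
move=> eta0 mJ.
have [d [d0 hd]] := @riemann_le_gauge R 0 1 0 J (fun=> 1) eta eta0 (lexx 0) ltr01 mJ (fun=> ler01).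
have [P [oP fP]] := cousin (@ltr01 R) (fun t _ => d0 t).
have [N hN] := hd P oP.1 fP; exists N => s us Ns.
have := hN (fun=> 1) (fun=> 1).
have -> : \sum_(p <- P) 1 * itv_length p = 1.
  under eq_bigr do rewrite mul1r.
  by rewrite (perron_of_sum ltr01 (@additive_on_length R 0 1) oP) subr0.
move=> /(_ _); rewrite mul0r addr0 => h1.
have {}h1 : 1 <= \sum_(i <- iota 0 N) mes (fiber 0 1 J i) + eta.
  rewrite -[X in _ <= X + _](eq_bigr _ (fun i _ => mul1r _)); apply: h1 => i; split=> //.
  by move=> _ t _; rewrite addr0.
have us' : uniq (iota 0 N ++ s).
  rewrite cat_uniq iota_uniq us andbT; apply/hasPn => i /Ns; rewrite mem_iota add0n /=.
  by rewrite leqNgt.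
have := mes_fibers_le ltr01 us' (fun i _ => mJ i); rewrite big_cat /= subr0; lra.
Qed.

End FiberMeasure.

Section Family.
Context {R : realType} (T : Type) (g : T -> R -> R) (F : T -> R).
Context (g0 : forall th (t : R), 0 <= t <= 1 -> 0 <= g th t).
Context (gF : forall th, is_HK_integral 0 1 (g th) (F th)).
Context (equi : forall eta : R, 0 < eta -> exists d : R -> R, (forall t, 0 < d t) /\
  forall P th, perron_of 0 1 P -> fine_partition d P ->
    F th <= \sum_(p <- P) g th (tagpt p) * itv_length p + eta).
Notation mes A := (fine (lambda A)).
Implicit Types (e eta : R) (J : R -> nat).

Definition good_index J e := forall i,
  [/\ lebesgue_measurable (fiber 0 1 J i),
      exists2 B : R, 0 <= B & forall th t, fiber 0 1 J i t -> g th t <= B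
    & mes (fiber 0 1 J i) != 0 ->
      forall th t t', fiber 0 1 J i t -> fiber 0 1 J i t' -> `|g th t - g th t'| <= e].

Context (indices : forall e, 0 < e -> exists J, good_index J e).

(** Uniformly in th, finitely many fibres carry almost the whole integral:
    those hit by the tags of a single partition that is fine for all th. *)
Lemma integral_le_sum J e eta : good_index J e -> 0 <= e -> 0 < eta ->
  exists N, forall th (c : nat -> R), (forall i, 0 <= c i) ->
    (forall i, mes (fiber 0 1 J i) != 0 -> forall t, fiber 0 1 J i t -> g th t <= c i + e) ->
    F th <= \sum_(i <- iota 0 N) c i * mes (fiber 0 1 J i) + e + eta.
Proof.
move=> gJ e0 eta0; have eta2 : 0 < eta / 2 by rewrite divr_gt0.
have [B hB] : exists B : nat -> R, forall i, 0 <= B i /\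
    forall th t, fiber 0 1 J i t -> g th t <= B i.
  have h i : exists b : R, 0 <= b /\ forall th t, fiber 0 1 J i t -> g th t <= b.
    by have [_ [b b0 hb] _] := gJ i; exists b.
  by have [B hB] := choice h; exists B.
have mJ i : lebesgue_measurable (fiber 0 1 J i) by have [] := gJ i.
have [d [d0 hd]] := equi eta2.
have [d' [d'0 hd']] := riemann_le_gauge eta2 e0 ltr01 mJ (fun i => proj1 (hB i)).
have [P [oP /fine_partition_min[fP fP']]] :=
  cousin ltr01 (gauge_min (fun t _ => d0 t) (fun t _ => d'0 t)).
have [N hN] := hd' P oP.1 fP'; exists N => th c c0 hc.
apply: (le_trans (hd P th oP fP)).
have := hN (g th) c; rewrite subr0 mulr1.
move=> h; rewrite [X in _ <= _ + X](splitr eta) addrA lerD2r; apply: h.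
by move=> i; split=> //; [exact: (hB i).2|exact: hc].
Qed.

(** Finitely many fibres of J, on which the family is bounded by M, nearly
    exhaust the integral.  A partition made of the fibres of JA in s and of the
    fibres of J outside of them yields a lower sum; compared with the integral, the
    fibres in s can gain over M times their measure no more than eta. *)
Lemma uniformly_integrable eta : 0 < eta -> exists2 M : R, 0 <= M &
  forall (JA : R -> nat) (s : seq nat) th (c : nat -> R),
    (forall i, lebesgue_measurable (fiber 0 1 JA i)) -> uniq s ->
    (forall i, 0 <= c i) -> (forall i t, i \in s -> fiber 0 1 JA i t -> c i <= g th t) ->
    \sum_(i <- s) c i * mes (fiber 0 1 JA i) <=
      M * \sum_(i <- s) mes (fiber 0 1 JA i) + eta.
Proof.
move=> eta0; have eta3 : 0 < eta / 3 by rewrite divr_gt0.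
have [J gJ] := indices eta3.
have mJ i : lebesgue_measurable (fiber 0 1 J i) by have [] := gJ i.
have g2J : good_index J (eta / 3 + eta / 3).
  move=> i; have [h1 h2 h3] := gJ i; split=> // ne th t t' ht ht'.
  by apply: (le_trans (h3 ne th t t' ht ht')); rewrite lerDl ltW.
have [N hN] := integral_le_sum g2J (addr_ge0 (ltW eta3) (ltW eta3)) eta3.
have [B hB] : exists B : nat -> R, forall i, 0 <= B i /\
    forall th t, fiber 0 1 J i t -> g th t <= B i.
  have h i : exists b : R, 0 <= b /\ forall th t, fiber 0 1 J i t -> g th t <= b.
    by have [_ [b b0 hb] _] := gJ i; exists b.
  by have [B hB] := choice h; exists B.
pose M := \sum_(i <- iota 0 N) B i.
have M0 : 0 <= M by apply: sumr_ge0 => i _; exact: (hB i).1.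
have BM i : i \in iota 0 N -> B i <= M.
  move=> iN; rewrite /M (bigD1_seq i) ?iota_uniq //= lerDl sumr_ge0 // => j _; exact: (hB j).1.
exists M => // JA s th c mJA us c0 cg.
have [pt hpt] := fiber_points 0 1 J.
have osc i t : mes (fiber 0 1 J i) != 0 -> fiber 0 1 J i t -> `|g th t - g th (pt i)| <= eta / 3.
  by move=> ne Jt; have [_ _] := gJ i; apply=> //; apply: hpt; exists t.
pose c' := lower_step 0 1 (g th) (eta / 3) J pt.
have c'0 i : 0 <= c' i by exact: lower_step_ge0.
have c'g i t : fiber 0 1 J i t -> c' i <= g th t.
  by move=> Jt; apply: lower_step_le => [|ne]; [apply: g0; case: Jt|exact: osc].
have c'B i : i \in iota 0 N -> c' i <= M.
  move=> iN; have [[t Jt]|no] := pselect (fiber 0 1 J i !=set0).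
    by apply: le_trans (BM i iN); apply: (le_trans (c'g i t Jt)); exact: (hB i).2.
  rewrite /c' /lower_step (_ : fiber 0 1 J i = set0) ?lambda_outer ?outer_measure0 ?eqxx //.
  by apply/seteqP; split=> // t Jt; apply: no; exists t.
have upper : F th <= \sum_(i <- iota 0 N) c' i * mes (fiber 0 1 J i) + eta.
  have e3 : eta = eta / 3 + eta / 3 + eta / 3 by field.
  rewrite [X in _ <= _ + X]e3 addrA; by apply: (hN th c' c'0) => i ne t Jt; apply: lower_step_ge => //; exact: osc.
pose AF := [set t | 0 <= t <= 1 /\ JA t \in s].
have AF01 : AF `<=` `[0, 1]%classic by move=> t [h _]; rewrite /= in_itv.
have mAF : lebesgue_measurable AF by exact: measurable_fibers_in.
pose Jc t : nat + nat := if JA t \in s then inl (JA t) else inr (J t).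
pose cc (i : nat + nat) := match i with inl n => c n | inr j => c' j end.
pose ss : seq (nat + nat) := map inl s ++ map inr (iota 0 N).
have fl i : i \in s -> fiber 0 1 Jc (inl i) = fiber 0 1 JA i.
  move=> si; apply/seteqP; split=> t [h Ji]; split=> //; move: Ji; rewrite /Jc.
    by case: ifP => // _ [].
  by move=> ->; rewrite si.
have fr j : fiber 0 1 Jc (inr j) = fiber 0 1 J j `\` AF.
  apply/seteqP; split=> t.
    move=> [h]; rewrite /Jc; case: ifPn => // ns [Jj]; split=> // -[_].
    by rewrite (negbTE ns).
  move=> [[h Jj] nAF]; split=> //; rewrite /Jc; case: ifP => [st|_]; last by rewrite Jj.
  by exfalso; apply: nAF.
have lower : \sum_(i <- ss) cc i * mes (fiber 0 1 Jc i) <= F th.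
  apply: (HK_integral_ge_sum ltr01 _ _ (g0 th) _ _ (gF th)).
  - rewrite cat_uniq !map_inj_uniq ?iota_uniq ?us; try by move=> ? ? [].
    by rewrite andbT; apply/hasPn => _ /mapP[j _ ->]; apply/negP => /mapP[i _].
  - move=> i; rewrite mem_cat => /orP[] /mapP[j sj ->]; first by rewrite fl.
    by rewrite fr; exact: lebesgue_measurableD.
  - by move=> [i|j] _ /=; [exact: c0|exact: c'0].
  - move=> i t; rewrite mem_cat => /orP[] /mapP[j sj ->]; first by rewrite fl //; exact: cg.
    by rewrite fr => -[Jt _]; exact: c'g.
move: lower; rewrite /ss big_cat !big_map /=.
have -> : \sum_(i <- s) c i * mes (fiber 0 1 Jc (inl i)) = \sum_(i <- s) c i * mes (fiber 0 1 JA i).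
  by rewrite big_seq [RHS]big_seq; apply: eq_bigr => i si; rewrite fl.
under [X in _ + X <= _ -> _]eq_bigr do rewrite fr.
move=> /le_trans /(_ upper).
have split_J : \sum_(i <- iota 0 N) c' i * mes (fiber 0 1 J i) <=
    \sum_(i <- iota 0 N) c' i * mes (fiber 0 1 J i `\` AF) + M * \sum_(i <- s) mes (fiber 0 1 JA i).
  apply: (@le_trans _ _ (\sum_(i <- iota 0 N) (c' i * mes (fiber 0 1 J i `\` AF) + M * mes (fiber 0 1 J i `&` AF)))).
    rewrite big_seq [leRHS]big_seq ler_sum // => i iN.
    by rewrite (mesDI (@fiber_sub R _ 0 1 J i) (mJ i) mAF) mulrDr lerD2l ler_wpM2r ?mes_ge0 ?c'B.
  rewrite big_split lerD2l -mulr_sumr ler_wpM2l //.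
  apply: (le_trans (sum_mes_fibers_le AF01 mAF (iota_uniq 0 N) mJ)).
  exact: mes_fibers_subadd.
move: split_J; set a1 := \sum_(i <- iota 0 N) _; set a2 := \sum_(i <- iota 0 N) _.
set a3 := \sum_(i <- s) c i * _; move: (M * _) => a4; lra.
Qed.

Section Points.
Context (J : R -> nat) (e : R) (gJ : good_index J e) (e0 : 0 <= e) (tp : nat -> R).
Context (tp01 : forall i, 0 <= tp i <= 1)
  (tpJ : forall i, fiber 0 1 J i !=set0 -> fiber 0 1 J i (tp i)).

Let mJ i : lebesgue_measurable (fiber 0 1 J i).
Proof. by have [] := gJ i. Qed.

Let osc i th t : mes (fiber 0 1 J i) != 0 -> fiber 0 1 J i t -> `|g th t - g th (tp i)| <= e.
Proof. by move=> ne Jt; have [_ _] := gJ i; apply=> //; apply: tpJ; exists t. Qed.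

Notation lower th := (lower_step 0 1 (g th) e J tp).

Let lower_le th i t : fiber 0 1 J i t -> lower th i <= g th t.
Proof. by move=> Jt; apply: lower_step_le => [|ne]; [apply: g0; case: Jt|exact: osc]. Qed.

Let weight_le_lower th i : mes (fiber 0 1 J i) * g th (tp i) <=
  lower th i * mes (fiber 0 1 J i) + e * mes (fiber 0 1 J i).
Proof.
rewrite -mulrDl [leLHS]mulrC /lower_step; case: (eqVneq (mes (fiber 0 1 J i)) 0) => [->|ne].
  by rewrite !mulr0.
by rewrite ler_wpM2r ?mes_ge0 // -lerBlDr le_max lexx orbT.
Qed.

Lemma sum_le_integral (s : seq nat) th : uniq s ->
  \sum_(i <- s) mes (fiber 0 1 J i) * g th (tp i) <= F th + e.
Proof.
move=> us; apply: (le_trans (ler_sum _ (fun i _ => weight_le_lower th i))).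
rewrite big_split; apply: lerD.
  apply: (HK_integral_ge_sum ltr01 us _ (g0 th) _ _ (gF th)) => [i _|i _|i t _].
  - exact: mJ.
  - exact: lower_step_ge0.
  - exact: lower_le.
rewrite -mulr_sumr -[leRHS]mulr1 ler_wpM2l //.
by have := mes_fibers_le ltr01 us (fun i _ => mJ i); rewrite subr0.
Qed.

Lemma integral_le_sum_points eta : 0 < eta -> exists N, forall th,
  F th <= \sum_(i <- iota 0 N) mes (fiber 0 1 J i) * g th (tp i) + e + eta.
Proof.
move=> eta0; have [N hN] := integral_le_sum gJ e0 eta0; exists N => th.
under eq_bigr do rewrite mulrC.
apply: (hN th (fun i => g th (tp i))) => [i|i ne t Jt]; first exact: g0.
by have := osc th ne Jt; rewrite ler_norml => /andP[_]; lra.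
Qed.

(** The far fibres have small total measure, hence by uniform integrability carry
    little of the integrals. *)
Lemma sum_points_tail eta : 0 < eta -> exists N, forall s, uniq s ->
  (forall i, i \in s -> (N <= i)%N) -> forall th,
  \sum_(i <- s) mes (fiber 0 1 J i) * g th (tp i) <= eta.
Proof.
move=> eta0; have eta2 : 0 < eta / 2 by rewrite divr_gt0.
have [M M0 hM] := uniformly_integrable eta2.
have K0 : 0 < M + e + 1 by rewrite ltr_wpDl // addr_ge0.
have [N hN] := mes_tail (divr_gt0 eta2 K0) mJ.
exists N => s us Ns th; apply: (le_trans (ler_sum _ (fun i _ => weight_le_lower th i))).
rewrite big_split -mulr_sumr [eta]splitr.
have := hM J s th (lower th) mJ us (lower_step_ge0 0 1 (g th) e J tp) (fun i t _ => @lower_le th i t).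
have := hN s us Ns; set m := \sum_(i <- s) mes _.
have m0 : 0 <= m by apply: sumr_ge0 => i _; exact: mes_ge0.
rewrite ler_pdivlMr //; move: (\sum_(i <- s) _) => x h1 h2.
have := h1; rewrite /=; nra.
Qed.

End Points.

End Family.

(** * Countable partitions adapted to measurable functions *)

Section Partitions.
Context {R : realType}.
Implicit Types (A B N : set R) (t : R).

Lemma ae_exception (Q : R -> Prop) : {ae @lambda R, forall t, 0 <= t <= 1 -> Q t} ->
  exists N, lambda N = 0%E /\ forall t, 0 <= t <= 1 -> ~ N t -> Q t.
Proof.
move=> [N [_ N0 hN]]; exists N; split=> // t t01 nNt; apply: contrapT => nQ.
by apply: nNt; apply: hN => /(_ t01).
Qed.

Lemma simple01_preimage (T : Type) (g : R -> T) (D : set T) : simple01 g ->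
  lebesgue_measurable (`[0, 1]%classic `&` g @^-1` D).
Proof.
move=> [fing mg].
rewrite (_ : _ `&` _ = \bigcup_(c in g @` `[0, 1]%classic `&` D) (`[0, 1]%classic `&` g @^-1` [set c])).
  apply: fin_bigcup_measurable => [|c _]; last exact: mg.
  by apply: sub_finite_set fing => c [].
apply/seteqP; split=> t.
  by move=> [t01 Dt]; exists (g t) => //; split=> //; exists t.
by move=> [c [_ Dc] [t01 gc]]; split=> //=; rewrite gc.
Qed.

Lemma simple01_comp (T U : Type) (h : T -> U) (g : R -> T) : simple01 g -> simple01 (h \o g).
Proof.
move=> sg; split=> [|c].
  by rewrite -image_comp; apply: finite_image; case: sg.
exact: (simple01_preimage (h @^-1` [set c]) sg).
Qed.

Lemma simple01_pair (T U : Type) (g : R -> T) (h : R -> U) : simple01 g -> simple01 h ->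
  simple01 (fun t => (g t, h t)).
Proof.
move=> [fg mg] [fh mh]; split=> [|[c d]].
  apply: (sub_finite_set _ (finite_setX fg fh)).
  by move=> _ [t t01 <-]; split; exists t.
rewrite (_ : _ `&` _ = (`[0, 1]%classic `&` g @^-1` [set c]) `&` (`[0, 1]%classic `&` h @^-1` [set d])).
  exact: lebesgue_measurableI.
apply/seteqP; split=> t /=; first by move=> [t01 [gc hd]].
by move=> [[t01 ->] [_ ->]].
Qed.

Lemma simple01_index (T : Type) (J : R -> nat) (h : nat -> T) :
  (forall i, lebesgue_measurable (fiber 0 1 J i)) -> finite_set (range h) ->
  simple01 (h \o J).
Proof.
move=> mJ fh; split=> [|c].
  by apply: sub_finite_set fh => _ [t _ <-]; exists (J t).
rewrite (_ : _ `&` _ = \bigcup_(i in h @^-1` [set c]) fiber 0 1 J i).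
  by apply: bigcup_measurable => i _; exact: mJ.
apply/seteqP; split=> t; first by move=> [t01 hc]; exists (J t); rewrite // /fiber /= -in_itv.
by move=> [i hi [t01 Ji]]; split; rewrite /= ?in_itv //= Ji.
Qed.

(** Each point is labelled by the first set of the cover that contains it. *)
Lemma cover_index (E : nat -> set R) : (forall i, lebesgue_measurable (E i)) ->
  (forall t, 0 <= t <= 1 -> exists i, E i t) ->
  exists J : R -> nat, forall i, lebesgue_measurable (fiber 0 1 J i) /\ fiber 0 1 J i `<=` E i.
Proof.
move=> mE covE.
have hJ t : exists i : nat, 0 <= t <= 1 -> E i t /\ forall j, (j < i)%N -> ~ E j t.
  have [t01|] := boolP (0 <= t <= 1); last by exists 0%N.
  have [i0 Ei0] := covE t t01.
  have ex : exists i, `[< E i t >] by exists i0; apply/asboolP.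
  exists (ex_minn ex) => _; case: ex_minnP => i /asboolP Ei imin; split=> // j ji Ej.
  by have := imin j; rewrite leqNgt ji => /(_ (asboolT Ej)).
have [J {}hJ] := choice hJ; exists J => i; split; last first.
  by move=> t [t01 Ji]; have [+ _] := hJ t t01; rewrite Ji.
rewrite (_ : fiber 0 1 J i = `[0, 1]%classic `&` E i `\` \bigcup_(j in `I_i) E j).
  apply: lebesgue_measurableD; last by apply: bigcup_measurable => j _; exact: mE.
  apply: lebesgue_measurableI => //; apply: lebesgue_measurable_closed.
  exact: interval_closed.
apply/seteqP; split=> t.
  move=> [t01 Ji]; have [E1 E2] := hJ t t01; rewrite Ji in E1 E2.
  by split; [split; rewrite /= ?in_itv|move=> [j /= ji]; exact: E2].
rewrite /= in_itv /= => -[[t01 Ei] nE]; split=> //; have [E1 E2] := hJ t t01.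
case: (ltngtP (J t) i) => // lt; exfalso; last exact: E2 lt Ei.
by apply: nE; exists (J t).
Qed.

(** Partition [0, 1] according to a moment n from which on the values u n t are
    pairwise D-close, and to the value u n t itself: on a fibre all points share
    the approximation u n t.  The exceptional null set is divided according to the
    size of b, so that b is bounded on its pieces. *)
Lemma simple01_partition (T : Type) (u : nat -> R -> T) (D : T -> T -> Prop) N (b : R -> R) :
  (forall n, simple01 (u n)) -> lambda N = 0%E ->
  (forall t, 0 <= t <= 1 -> ~ N t -> exists n, forall m m', (n <= m)%N -> (n <= m')%N ->
     D (u m t) (u m' t)) ->
  exists J : R -> nat, forall i, lebesgue_measurable (fiber 0 1 J i) /\
    ((lambda (fiber 0 1 J i) = 0%E /\ exists B : R, forall t, fiber 0 1 J i t -> b t <= B) \/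
     exists n, (forall t, fiber 0 1 J i t -> ~ N t /\
         forall m m', (n <= m)%N -> (n <= m')%N -> D (u m t) (u m' t)) /\
       forall t t', fiber 0 1 J i t -> fiber 0 1 J i t' -> u n t = u n t').
Proof.
move=> su N0 hu.
have hlab0 n : exists lab : T -> nat, {in u n @` `[0, 1]%classic &, injective lab}.
  by apply/countable_injP; apply: finite_set_countable; have [] := su n.
have [lab hlab] := choice hlab0.
pose Ev n := \bigcap_k (`[0, 1]%classic `&` [set t | (n <= k.1)%N -> (n <= k.2)%N -> D (u k.1 t) (u k.2 t)]).
have mEv n : lebesgue_measurable (Ev n).
  have -> : Ev n = \bigcap_k (if unpickle k is Some (m, m') then
     `[0, 1]%classic `&` (fun t => (u m t, u m' t)) @^-1` [set p | (n <= m)%N -> (n <= m')%N -> D p.1 p.2]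
     else `[0, 1]%classic).
    apply/seteqP; split=> t h.
      move=> k _; case: (unpickle k) => [[m m']|]; last by have [] := h (0, 0)%N.
      by have := h (m, m') I.
    move=> [m m'] _; have := h (pickle (m, m')) I; rewrite pickleK; exact.
  apply: lebesgue_measurable_bigcap => k; case: (unpickle k) => [[m m']|].
    by apply: simple01_preimage; apply: simple01_pair.
  by apply: lebesgue_measurable_closed; exact: interval_closed.
pose E i := match (unpickle i : option (nat + nat * nat)) with
  | None => set0
  | Some (inl k) => N `&` [set t | b t <= k%:R]
  | Some (inr (n, k)) => (Ev n `&` (`[0, 1]%classic `&` u n @^-1` [set c | lab n c = k])) `\` N
  end.
have mN' N' : N' `<=` N -> lebesgue_measurable N'.
  by move=> h; apply: lebesgue_measurable_null; exact: lambda_null_sub h N0.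
have [|t t01|J hJ] := @cover_index E.
- move=> i; rewrite /E; case: (unpickle i) => [[k|[n k]]|]; last exact: lebesgue_measurable0.
    by apply: mN' => t [].
  apply: lebesgue_measurableD; last exact: mN'.
  by apply: lebesgue_measurableI => //; exact: simple01_preimage.
- have [Nt|nNt] := pselect (N t).
    exists (pickle (inl (Num.truncn (b t)).+1 : nat + nat * nat)); rewrite /E pickleK; split=> //=.
    exact: ltW (truncnS_gt _).
  have [n hn] := hu t t01 nNt.
  exists (pickle (inr (n, lab n (u n t)) : nat + nat * nat)); rewrite /E pickleK; split=> //.
  split; last by rewrite /= in_itv.
  by move=> [m m'] _; split; [rewrite /= in_itv|exact: hn].
exists J => i; have [mJ subE] := hJ i; split=> //; move: subE; rewrite /E.
case: (unpickle i) => [[k|[n k]]|] sub.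
- left; split; first by apply: lambda_null_sub N0 => t /sub[].
  by exists k%:R => t /sub[].
- right; exists n; split=> [t /sub[[Et _] nNt]|t t' /sub[[_ [t01 lt]] _] /sub[[_ [t'01 lt']] _]].
    by split=> // m m' nm nm'; have [_ /(_ nm nm')] := Et (m, m') I.
  apply: (hlab n); rewrite ?inE; [by exists t|by exists t'|by rewrite lt lt'].
- left; split; first by apply: (@lambda_null_sub R _ set0) => //; rewrite lambda_outer outer_measure0.
  by exists 0 => t /sub.
Qed.

End Partitions.

Section HausdorffConvergence.
Context {R : realType} {X : completeNormedModType R}.
Implicit Types (A : nat -> set X) (B : set X) (u : dual X).

Lemma hausdorff_cvgP A B : (forall n, cwk (A n)) -> cwk B ->
  hausdorff_dist (A n) B @[n --> \oo] --> 0%E <->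
  forall e : R, 0 < e -> exists N, forall n u, (N <= n)%N -> dual_ball u ->
    `|support_fun u (A n) - support_fun u B| <= e.
Proof.
move=> cA cB; split=> [h e e0|h].
  have : nbhs (0%E : \bar R) [set x | (x < e%:E)%E].
    by apply: open_nbhs_nbhs; split; [exact: open_ereal_lt_ereal|rewrite /= lte_fin].
  move=> /h[N _ hN]; exists N => n u Nn.
  by apply: (hausdorff_leP (cA n) cB (ltW e0)).1; apply: ltW; exact: hN.
have ge0 n : (0 <= hausdorff_dist (A n) B)%E.
  have [[a Aa] _ _] := cA n.
  rewrite /hausdorff_dist le_max; apply/orP; left.
  apply: (@le_trans _ _ (ereal_inf [set `|a - b|%:E | b in B])).
    by apply: le_ereal_inf_tmp => _ [b _ <-]; rewrite lee_fin.
  by apply: ereal_sup_ubound; exists a.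
have near (e : R) : 0 < e -> \forall n \near \oo, (hausdorff_dist (A n) B <= e%:E)%E.
  move=> e0; have [N hN] := h e e0; exists N => // n /= Nn.
  by apply/(hausdorff_leP (cA n) cB (ltW e0)) => u; exact: hN.
have fin (e : R) n : (hausdorff_dist (A n) B <= e%:E)%E -> hausdorff_dist (A n) B \is a fin_num.
  by move=> le; rewrite ge0_fin_numE // (le_lt_trans le) // ltry.
apply/fine_cvgP; split; first by apply: filterS (near 1 ltr01) => n; exact: fin.
apply/cvgrPdist_le => e e0; apply: filterS (near e e0) => n /= le.
by rewrite sub0r normrN ger0_norm ?fine_ge0 // -lee_fin fineK // (fin e).
Qed.

Lemma hausdorff_limit_le A B (e : R) n u : (forall n, cwk (A n)) -> cwk B -> 0 <= e ->
  hausdorff_dist (A n) B @[n --> \oo] --> 0%E ->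
  (forall m, (n <= m)%N -> (hausdorff_dist (A n) (A m) <= e%:E)%E) -> dual_ball u ->
  `|support_fun u (A n) - support_fun u B| <= e.
Proof.
move=> cA cB e0 /(hausdorff_cvgP cA cB) h hn hu; apply/ler_addgt0Pr => r r0.
have [N hN] := h r r0; apply: (le_trans (ler_distD (support_fun u (A (maxn n N))) _ _)).
apply: lerD; last by apply: hN => //; exact: leq_maxr.
by apply: (hausdorff_leP (cA n) (cA _) e0).1 => //; apply: hn; exact: leq_maxl.
Qed.

Lemma hausdorff_cauchy A B (e : R) : (forall n, cwk (A n)) -> cwk B -> 0 < e ->
  hausdorff_dist (A n) B @[n --> \oo] --> 0%E ->
  exists n, forall m m', (n <= m)%N -> (n <= m')%N -> (hausdorff_dist (A m) (A m') <= e%:E)%E.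
Proof.
move=> cA cB e0 /(hausdorff_cvgP cA cB) h; have e2 : 0 < e / 2 by rewrite divr_gt0.
have [N hN] := h _ e2; exists N => m m' Nm Nm'.
apply/(hausdorff_leP (cA m) (cA m') (ltW e0)) => u hu.
apply: (le_trans (ler_distD (support_fun u B) _ _)); rewrite [e]splitr lerD ?hN //.
by rewrite distrC hN.
Qed.

End HausdorffConvergence.

(** * Strongly measurable selections *)

Section Selection.
Context {R : realType} {X : completeNormedModType R}.
Implicit Types (A B C : set X) (u : dual X) (t : R).

Lemma lambda_null_bigcup (F : nat -> set R) : (forall i, lambda (F i) = 0%E) ->
  lambda (\bigcup_i F i) = 0%E.
Proof.
move=> F0; have [i|N [_ N0 /lambda_null_sub h]] :=
    @negligible_bigcup _ _ R (@lambda R : {measure set _ -> \bar R}) F.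
  exists (F i); split; [exact: (lebesgue_measurable_null (F0 i))|exact: F0|by []].
exact: h N0.
Qed.

Lemma lambda_null_setU (A B : set R) : lambda A = 0%E -> lambda B = 0%E -> lambda (A `|` B) = 0%E.
Proof.
move=> A0 B0; rewrite -bigcup2E; by apply: lambda_null_bigcup => -[|[|i]] //=.
Qed.

(** Truncating the labels J 0 t, ..., J (m - 1) t at n leaves finitely many
    codes. *)
Lemma simple01_codes (J : nat -> R -> nat) n m :
  (forall k i, lebesgue_measurable (fiber 0 1 (J k) i)) ->
  simple01 (fun t => [seq minn (J i t) n | i <- iota 0 m]).
Proof.
move=> mJ; elim: m => [|m IH].
  split=> [|c]; first by apply: (sub_finite_set _ (finite_set1 [::])) => _ [t _ <-].
  rewrite (_ : _ @^-1` _ = if c == [::] then setT else set0).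
    case: ifP => _; first by rewrite setIT; apply: lebesgue_measurable_closed; exact: interval_closed.
    by rewrite setI0; exact: lebesgue_measurable0.
  by apply/seteqP; split=> t /=; [move=> <-; rewrite eqxx|case: eqP].
have fin : finite_set (range (minn^~ n)).
  by apply: (sub_finite_set _ (finite_II n.+1)) => _ [i _ <-]; rewrite /= ltnS geq_minr.
have := simple01_comp (fun p => rcons p.1 p.2) (simple01_pair IH (simple01_index (mJ m) fin)).
congr simple01; apply/funext => t.
by rewrite -[in RHS]addn1 iotaD map_cat cats1.
Qed.

Context (Gamma : R -> set X) (Gamma_cwk : multifunction Gamma).

(** A Bochner measurable multifunction is, uniformly off a null set, close to
    one with countably many values on measurable pieces. *)
Lemma bochner_approx (e : R) : bochner_measurable Gamma -> 0 < e ->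
  exists (J : R -> nat) (C : nat -> set X) (N : set R),
  [/\ forall i, lebesgue_measurable (fiber 0 1 J i), forall i, cwk (C i), lambda N = 0%E
    & forall t u, 0 <= t <= 1 -> ~ N t -> dual_ball u ->
        `|support_fun u (C (J t)) - support_fun u (Gamma t)| <= e].
Proof.
move=> [G_ [hG aeG]] e0; have [N [N0 GN]] := ae_exception aeG.
pose D (A B : set X) : Prop := (hausdorff_dist A B <= e%:E)%E.
have [|t t01 nNt|J hJ] := @simple01_partition R (set X) G_ D N (fun=> 0) _ N0.
- by move=> n; have [] := hG n.
- apply: (hausdorff_cauchy _ (Gamma_cwk t01) e0 (GN t t01 nNt)) => n.
  by have [/(_ t t01)] := hG n.
have hC i : exists A, cwk A /\ (lambda (fiber 0 1 J i) = 0%E \/ forall t u, fiber 0 1 J i t ->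
    dual_ball u -> `|support_fun u A - support_fun u (Gamma t)| <= e).
  have [[t0 Jt0]|no] := pselect (fiber 0 1 J i !=set0); last first.
    exists [set 0]; split; first exact: cwk_set1.
    by right=> t u Jt; exfalso; apply: no; exists t.
  have [mJ [[J0 _]|[n [hn cn]]]] := hJ i.
    by exists [set 0]; split; [exact: cwk_set1|left].
  exists (G_ n t0); split; first by have [/(_ t0 Jt0.1)] := hG n.
  right=> t u Jt hu; rewrite (cn t0 t Jt0 Jt); have [nNt Dt] := hn t Jt.
  apply: (@hausdorff_limit_le _ _ (fun m => G_ m t)) => //.
  - by move=> m; have [/(_ t Jt.1)] := hG m.
  - exact: Gamma_cwk Jt.1.
  - exact: ltW.
  - exact: GN Jt.1 nNt.
  - by move=> m nm; exact: Dt.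
have [C {}hC] := choice hC.
exists J, C, (N `|` \bigcup_i (if lambda (fiber 0 1 J i) == 0%E then fiber 0 1 J i else set0)).
split=> [i|i||t u t01 nNt hu].
- by have [] := hJ i.
- by have [] := hC i.
- apply: lambda_null_setU => //; apply: lambda_null_bigcup => i.
  by case: eqP => // _; rewrite lambda_outer outer_measure0.
- have [_ [J0|]] := hC (J t); last by apply=> //; split.
  by exfalso; apply: nNt; right; exists (J t); rewrite // J0 eqxx.
Qed.

Lemma geometric_telescope (y : nat -> X) : (forall k, `|y k - y k.+1| <= 2^-1 ^+ k) ->
  forall k m, `|y k - y (k + m)%N| <= 2 * 2^-1 ^+ k - 2 * 2^-1 ^+ (k + m).
Proof.
move=> hy k; elim=> [|m IH]; first by rewrite addn0 !subrr normr0.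
apply: (le_trans (ler_distD (y (k + m)%N) _ _)); apply: (le_trans (lerD IH _)).
  by rewrite addnS; exact: hy.
by rewrite addnS exprS; lra.
Qed.

Lemma half_power_small (e : R) : 0 < e -> exists K, forall k, (K <= k)%N -> 2^-1 ^+ k <= e :> R.
Proof.
move=> e0; have : (2^-1 : R) ^+ n @[n --> \oo] --> (0 : R).
  by apply: cvg_expr; rewrite ger0_norm ?invr_ge0 // invf_lt1 // ltr1n.
move=> /cvgrPdist_le /(_ e e0)[K _ hK]; exists K => k /hK.
by rewrite sub0r normrN ger0_norm // exprn_ge0 // invr_ge0.
Qed.

(** Approximate the multifunction by countably valued ones, with summable errors,
    and choose successively, in the value of the next approximation, a point near
    the previous choice.  The choices converge off a null set, and the limit
    belongs to the closed set Gamma t.  The k-th choice is a function of the first k + 1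
    labels of t; truncated labels turn these countably valued functions into
    simple ones. *)
Theorem measurable_selection : bochner_measurable Gamma ->
  exists f : R -> X, strongly_measurable f /\ selection Gamma f.
Proof.
move=> bG.
have h0 k : 0 < (2^-1 : R) ^+ k by rewrite exprn_gt0 // invr_gt0.
have h4 k : 0 < (2^-1 : R) ^+ k / 4 by rewrite divr_gt0.
have [J hJ] := choice (fun k => bochner_approx bG (h4 k)).
have [C {}hJ] := choice hJ; have [N {}hJ] := choice hJ.
have cC k i : cwk (C k i) by have [] := hJ k.
have mJ k i : lebesgue_measurable (fiber 0 1 (J k) i) by have [] := hJ k.
have hnear (p : R * X * set X) : exists b, p.2 !=set0 -> p.2 b /\
    ((exists2 c, p.2 c & `|p.1.2 - c| <= p.1.1) -> `|p.1.2 - b| <= p.1.1).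
  have [[c pc hc]|no] := pselect (exists2 c, p.2 c & `|p.1.2 - c| <= p.1.1); first by exists c.
  have [[b pb]|nb] := pselect (p.2 !=set0); last by exists 0.
  by exists b.
have [near {}hnear] := choice hnear.
(* the approximation y j k depends on the labels j 0, ..., j k only *)
pose y (j : nat -> nat) := fix y k := match k with
  | 0%N => near (0, 0, C 0%N (j 0%N))
  | k'.+1 => near (2^-1 ^+ k', y k', C k'.+1 (j k'.+1)) end.
have yE j j' k : (forall i, (i <= k)%N -> j i = j' i) -> y j k = y j' k.
  elim: k => [|k IH] e /=; first by rewrite e.
  by rewrite e // IH // => i ik; apply: e; exact: leqW.
pose NN := \bigcup_k N k.
have NN0 : lambda NN = 0%E by apply: lambda_null_bigcup => k; have [] := hJ k.
pose yt t := y (fun k => J k t).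
have yC t k : C k (J k t) (yt t k).
  have [nC _ _] := cC k (J k t).
  case: k nC => [|k] nC; first by have [] := hnear (0, 0, C 0%N (J 0%N t)) nC.
  by have [] := hnear (2^-1 ^+ k, yt t k, C k.+1 (J k.+1 t)) nC.
have yclose t u k : 0 <= t <= 1 -> ~ NN t -> dual_ball u ->
    `|support_fun u (C k (J k t)) - support_fun u (Gamma t)| <= 2^-1 ^+ k / 4.
  by move=> t01 nN hu; have [_ _ _] := hJ k; apply=> // Nt; apply: nN; exists k.
have ystep t k : 0 <= t <= 1 -> ~ NN t -> `|yt t k - yt t k.+1| <= 2^-1 ^+ k.
  move=> t01 nN; have [nC _ _] := cC k.+1 (J k.+1 t).
  have [_] := hnear (2^-1 ^+ k, yt t k, C k.+1 (J k.+1 t)) nC; apply.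
  have r0 : 0 <= 2^-1 ^+ k / 4 + 2^-1 ^+ k.+1 / 4 :> R by rewrite addr_ge0 // ltW.
  have [|u hu|b Cb yb] := near_point (cC k (J k t)) (cC k.+1 (J k.+1 t)) (yC t k) r0 (r' := 2^-1 ^+ k).
  - by have := h0 k; rewrite exprS /=; lra.
  - have := yclose t u k t01 nN hu; have := yclose t u k.+1 t01 nN hu.
    rewrite !ler_norml; lra.
  - by exists b; rewrite // ltW.
have hf t : exists x, 0 <= t <= 1 -> Gamma t x /\ (~ NN t -> yt t n @[n --> \oo] --> x).
  have [t01|] := boolP (0 <= t <= 1); last by exists 0.
  have [[x Gx] _ kG] := Gamma_cwk t01.
  have [Nt|nN] := pselect (NN t); first by exists x.
  have tel := geometric_telescope (fun k => ystep t k t01 nN).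
  have cy : cvgn (yt t).
    apply/cauchy_cvgP; apply: cauchy_exP => e e0; have e3 : 0 < e / 3 by rewrite divr_gt0.
    have [K hK] := half_power_small e3; exists (yt t K); exists K => // m /= Km.
    rewrite -ball_normE /= -(subnKC Km).
    apply: (le_lt_trans (tel K (m - K)%N)).
    have := hK K (leqnn K); have := h0 (K + (m - K))%N; lra.
  exists (limn (yt t)) => _; split=> [|_]; last exact: cy.
  apply: weakly_compact_closed => // e e0; have e3 : 0 < e / 3 by rewrite divr_gt0.
  have [K1 hK1] := half_power_small e3.
  move/cvgrPdist_le: (cy) => /(_ _ e3)[K2 _ hK2]; pose k := maxn K1 K2.
  have [|u hu|b Gb yb] := near_point (cC k (J k t)) (Gamma_cwk t01) (yC t k) (ltW (h4 k)) (r' := 2^-1 ^+ k).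
  - by have := h0 k; lra.
  - by have := yclose t u k t01 nN hu; rewrite ler_norml; lra.
  exists b => //; apply: (le_lt_trans (ler_distD (yt t k) _ _)).
  have := hK1 k (leq_maxl _ _); have := hK2 k (leq_maxr _ _); lra.
have [f {}hf] := choice hf; exists f; split; last by move=> t /hf[].
pose pos n (c : seq nat) := (find (leq n) c).-1.
exists (fun n => (fun c => y (nth 0%N c) (pos n c)) \o (fun t => [seq minn (J i t) n | i <- iota 0 n.+1])).
split=> [n|]; first by apply: simple01_comp; exact: simple01_codes.
exists NN; split=> [||t]; [exact: lebesgue_measurable_null|by []|].
move=> /= bad; apply: contrapT => nN; apply: bad => t01.
have [_ /(_ nN) cy] := hf t t01; apply/cvgrPdist_le => e e0.
move/cvgrPdist_le: cy => /(_ e e0)[K _ hK].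
have [L hL] : exists L, forall i, (i <= K)%N -> (J i t < L)%N.
  elim: K {hK} => [|K [L hL]]; first by exists (J 0%N t).+1 => i; rewrite leqn0 => /eqP ->.
  exists (maxn L (J K.+1 t).+1) => i; rewrite leq_eqVlt => /predU1P[->|/hL h].
    by rewrite leq_max leqnn orbT.
  by rewrite leq_max h.
exists (maxn K L) => // n /=; rewrite geq_max => /andP[Kn Ln].
pose c := [seq minn (J i t) n | i <- iota 0 n.+1].
rewrite -[X in `|_ - X|]/(y (nth 0%N c) (pos n c)).
have sc : size c = n.+1 by rewrite size_map size_iota.
have cE i : (i <= n)%N -> nth 0%N c i = minn (J i t) n.
  by move=> le; rewrite (nth_map 0%N) ?size_iota // nth_iota.
have fK : (K < find (leq n) c)%N.
  rewrite ltnNge; apply/negP => le.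
  have hc : has (leq n) c by rewrite has_find sc ltnS (leq_trans le).
  have := nth_find 0%N hc; rewrite cE ?(leq_trans le) // leq_min leqnn andbT.
  by rewrite leqNgt (leq_trans (hL _ le)).
have -> : y (nth 0%N c) (pos n c) = yt t (pos n c).
  apply: yE => i le.
  have lt : (i < find (leq n) c)%N.
    by apply: leq_ltn_trans le _; rewrite /pos prednK ?leqnn // (leq_ltn_trans _ fK).
  have := before_find 0%N lt; have len : (i <= n)%N.
    by rewrite -ltnS -sc (leq_trans lt) // find_size.
  rewrite cE // => /negbT; rewrite -ltnNge gtn_min ltnn orbF => Jn.
  by apply/minn_idPl; exact: ltnW.
by apply: hK => /=; rewrite /pos -ltnS prednK // (leq_ltn_trans _ fK).
Qed.

End Selection.

(** * Translating a multifunction by a selection *)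

Section Difference.
Context {R : realType} {X : completeNormedModType R}.
Context (Gamma : R -> set X) (Phi : R -> R -> set X) (f : R -> X).
Context (Gamma_cwk : multifunction Gamma) (Gamma_bochner : bochner_measurable Gamma).
Context (PhiE : HKP_primitive Gamma Phi).
Context (f_meas : strongly_measurable f) (f_sel : selection Gamma f).
Implicit Types (u v : dual X) (t a b e : R).

Definition translate t : set X := mink_add (Gamma t) [set - f t].
Notation G := translate.

Lemma translate_cwk : multifunction G.
Proof. by move=> t t01; apply: cwk_add; [exact: Gamma_cwk|exact: cwk_set1]. Qed.

Lemma support_translate u t : 0 <= t <= 1 ->
  support_fun u (G t) = support_fun u (Gamma t) - pairing u (f t).
Proof.
move=> t01; rewrite (support_add u (Gamma_cwk t01) (cwk_set1 _)).
by rewrite support_set1 pairingN.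
Qed.

Lemma translate0 t : 0 <= t <= 1 -> G t 0.
Proof. by move=> t01; apply/mink_addP; exists (f t), (- f t); rewrite subrr; split=> //; exact: f_sel. Qed.

Lemma support_translate_ge0 u t : 0 <= t <= 1 -> 0 <= support_fun u (G t).
Proof.
move=> t01; have [_ _ kG] := translate_cwk t01.
by rewrite -[leLHS](pairing0 u); apply: support_ge => //; exact: translate0.
Qed.

Lemma translateK t : Gamma t = mink_add (G t) [set f t].
Proof.
apply/seteqP; split=> x.
  move=> Gx; apply/mink_addP; exists (x - f t), (f t); rewrite subrK; split=> //.
  by apply/mink_addP; exists x, (- f t).
by move=> /mink_addP[_ [_ [/mink_addP[y [_ [Gy -> ->]]] -> ->]]]; rewrite subrK.
Qed.

(** The selection and the multifunction are approximated simultaneously by simple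
    functions; the support functions of the translate then oscillate little on the
    pieces where the approximations are constant, uniformly over the dual ball. *)
Lemma oscillation_partition e : 0 < e -> exists J : R -> nat, forall i,
  [/\ lebesgue_measurable (fiber 0 1 J i),
      exists2 B : R, 0 <= B & forall t, fiber 0 1 J i t -> snorm (G t) <= B
    & lambda (fiber 0 1 J i) = 0%E \/ forall t t' u, fiber 0 1 J i t -> fiber 0 1 J i t' ->
        dual_ball u -> `|support_fun u (G t) - support_fun u (G t')| <= e].
Proof.
move=> e0; have e4 : 0 < e / 4 by rewrite divr_gt0.
have [G_ [hG aeG]] := Gamma_bochner; have [N [N0 GN]] := ae_exception aeG.
have [f_ [sf aef]] := f_meas; have [N' [N'0 fN]] := ae_exception aef.
have cG n t : 0 <= t <= 1 -> cwk (G_ n t) by move=> t01; have [/(_ t t01)] := hG n.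
pose D (p q : set X * X) : Prop := (hausdorff_dist p.1 q.1 <= (e / 4)%:E)%E /\ `|p.2 - q.2| <= e / 4.
have [n|||J hJ] := @simple01_partition R _ (fun n t => (G_ n t, f_ n t)) D (N `|` N') (snorm \o G).
- by apply: simple01_pair (sf n); have [] := hG n.
- exact: lambda_null_setU.
- move=> t t01 nNt.
  have [|n hn] := hausdorff_cauchy (fun n => cG n t t01) (Gamma_cwk t01) e4.
    by apply: GN t01 _ => Nt; apply: nNt; left.
  have /cvgrPdist_le ft : f_ n t @[n --> \oo] --> f t by apply: fN t01 _ => Nt; apply: nNt; right.
  have e8 : 0 < e / 4 / 2 by rewrite divr_gt0.
  have [n' _ hn'] := ft _ e8.
  exists (maxn n n') => m m'; rewrite !geq_max => /andP[nm n'm] /andP[nm' n'm'].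
  split; first exact: hn.
  apply: (le_trans (ler_distD (f t) _ _)); rewrite [e / 4]splitr lerD ?hn' //.
  by rewrite distrC hn'.
exists J => i; have [mJ [[J0 [B hB]]|[n [hn cn]]]] := hJ i.
  split=> //; last by left.
  by exists (Num.max B 0); [rewrite le_max lexx orbT|move=> t /hB; rewrite le_max => ->].
have approx t u : fiber 0 1 J i t -> dual_ball u ->
    `|support_fun u (G_ n t) - pairing u (f_ n t) - support_fun u (G t)| <= e / 4 + e / 4.
  move=> Jt hu; have t01 := Jt.1; have [nNt Dt] := hn t Jt.
  rewrite support_translate // opprB addrACA -!addrA [X in `|_ + X|]addrA addrA.
  rewrite (_ : _ + _ = (support_fun u (G_ n t) - support_fun u (Gamma t)) +
    (pairing u (f t) - pairing u (f_ n t))); last by ring.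
  apply: (le_trans (ler_normD _ _)); apply: lerD.
    apply: (@hausdorff_limit_le _ _ (fun m => G_ m t)) => //.
    - by move=> m; exact: cG.
    - exact: Gamma_cwk.
    - exact: ltW.
    - by apply: GN t01 _ => Nt; apply: nNt; left.
    - by move=> m nm; have [] := Dt n m (leqnn n) nm.
  have /cvgrPdist_le ft : f_ n t @[n --> \oo] --> f t by apply: fN t01 _ => Nt; apply: nNt; right.
  rewrite -pairingB; apply: (le_trans (hu _)); apply/ler_addgt0Pr => r r0.
  have [m _ hm] := ft r r0; apply: (le_trans (ler_distD (f_ (maxn n m) t) _ _)).
  rewrite addrC; apply: lerD; last by apply: hm; exact: leq_maxr.
  by have [] := Dt (maxn n m) n (leq_maxl _ _) (leqnn n).
have osc t t' u : fiber 0 1 J i t -> fiber 0 1 J i t' -> dual_ball u ->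
    `|support_fun u (G t) - support_fun u (G t')| <= e.
  move=> Jt Jt' hu; have := approx t u Jt hu; have := approx t' u Jt' hu.
  have [-> ->] := cn t t' Jt Jt'; rewrite !ler_norml; lra.
split=> //; last by right.
have [[t0 Jt0]|no] := pselect (fiber 0 1 J i !=set0); last first.
  by exists 0 => // t Jt; exfalso; apply: no; exists t.
have B0 : 0 <= snorm (G t0) + e.
  by apply: addr_ge0 (ltW e0); apply: snorm_ge0; exact: translate_cwk Jt0.1.
exists (snorm (G t0) + e) => // t Jt; have cGt := translate_cwk Jt.1.
apply/(snorm_leP cGt B0) => u hu.
have := osc t t0 u Jt Jt0 hu; have := support_le_snorm (translate_cwk Jt0.1) hu.
rewrite !ler_norml; lra.
Qed.

(** The function is nonnegative because f is a selection, and dominated by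
    the integrable function support_fun u Gamma + support_fun (- u) Gamma. *)
Lemma support_translate_integrable u a b : 0 <= a -> a < b -> b <= 1 ->
  HK_integrable a b (fun t => support_fun u (G t)).
Proof.
move=> a0 ab b1; have sub t : a <= t <= b -> 0 <= t <= 1 by lra.
have [k k0 [v hv uv]] := dual_ball_scale u.
have scaleG t : a <= t <= b -> k * support_fun v (G t) = support_fun u (G t).
  move=> /sub t01; have [G0 _ kG] := translate_cwk t01.
  apply/eqP; rewrite eq_le; apply/andP; split.
    have [x Gx ->] := support_attained v kG G0.
    by rewrite -uv; exact: support_ge.
  by apply: support_le => // x Gx; rewrite uv ler_pM2l //; exact: support_ge.
suff [w hw] : HK_integrable a b (fun t => support_fun v (G t)).
  by exists (k * w); apply: is_HK_integral_ext scaleG (is_HK_integralZ k hw).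
have [v' hv'] := dualZ (-1) v.
have [_ hPhi] := PhiE a0 ab b1.
apply: (HK_integrable_step ab _ (is_HK_integralD (hPhi v) (hPhi v'))).
  move=> t /sub t01; rewrite support_translate_ge0 // support_translate // lerD2l.
  have [_ _ kG] := Gamma_cwk t01.
  by rewrite -mulN1r -hv'; apply: support_ge => //; exact: f_sel.
move=> e e0; have e2 : 0 < e / 2 by rewrite divr_gt0.
have [J hJ] := oscillation_partition e2.
have fibE i : fiber a b J i = fiber 0 1 J i `&` `[a, b]%classic.
  apply/seteqP; split=> t; first by move=> [tab Ji]; split; [split=> //; exact: sub|rewrite /= in_itv].
  by move=> [[_ Ji]]; rewrite /= in_itv.
have hB i : exists B : R, 0 <= B /\ forall t, fiber 0 1 J i t -> snorm (G t) <= B.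
  by have [_ [B B0 hB] _] := hJ i; exists B.
have [B {}hB] := choice hB.
have [pt hpt] := fiber_points a b J.
have osc i t : fine (lambda (fiber a b J i)) != 0 -> fiber a b J i t ->
    `|support_fun v (G t) - support_fun v (G (pt i))| <= e / 2.
  move=> ne Jt; have Jr := hpt i (ex_intro _ t Jt).
  have [_ _ [J0|]] := hJ i; last first.
    by apply=> //; [move: Jt|move: Jr]; rewrite fibE => -[].
  exfalso; move/eqP: ne; apply; rewrite (lambda_null_sub _ J0) //.
  by move=> s; rewrite fibE => -[].
exists J, (lower_step a b (fun t => support_fun v (G t)) (e / 2) J pt), B.
split=> [i|i t Jt|i|i].
- rewrite fibE; apply: lebesgue_measurableI; first by have [] := hJ i.
  by apply: lebesgue_measurable_closed; exact: interval_closed.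
- apply: lower_step_le => [|ne]; last exact: osc.
  by apply: support_translate_ge0; exact: sub Jt.1.
- by have [] := hB i.
- split=> [|t Jt|ne t Jt]; first exact: lower_step_ge0.
  + have [_] := hB i; have Jt' : fiber 0 1 J i t by move: Jt; rewrite fibE => -[].
    move=> /(_ t Jt'); apply: le_trans; apply: le_trans (ler_norm _) _.
    by apply: support_le_snorm => //; exact: translate_cwk (sub t Jt.1).
  + by rewrite [X in _ <= _ + X]splitr; apply: lower_step_ge => //; exact: osc.
Qed.

(** The weak integral of the selection over [a, b]: integrating f against u is
    linear in u and stays below the support function of Phi a b, hence is the
    evaluation at a point of Phi a b. *)
Lemma selection_integral a b : 0 <= a -> a < b -> b <= 1 -> exists z, Phi a b z /\
  forall u, is_HK_integral a b (fun t => pairing u (f t)) (pairing u z).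
Proof.
move=> a0 ab b1; have sub t : a <= t <= b -> 0 <= t <= 1 by lra.
have [cPhi hPhi] := PhiE a0 ab b1.
have hxi u : exists x : R, is_HK_integral a b (fun t => pairing u (f t)) x /\ x <= support_fun u (Phi a b).
  have [w hw] := support_translate_integrable u a0 ab b1.
  exists (support_fun u (Phi a b) - w); split.
    apply: is_HK_integral_ext (is_HK_integralB (hPhi u) hw) => t /sub t01.
    by rewrite support_translate //; ring.
  have w0 : 0 <= w.
    by apply: is_HK_integral_ge0 ab _ hw => t /sub t01; exact: support_translate_ge0.
  by rewrite gerBl.
have [xi {}hxi] := choice hxi.
have [||u|z [Pz hz]] := @representation R X (Phi a b) xi cPhi.
- move=> u v w uvw; have [hu _] := hxi u; have [hv _] := hxi v; have [hw _] := hxi w.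
  apply: is_HK_integral_unique ab hw _; apply: is_HK_integral_ext (is_HK_integralD hu hv) => t _.
  by rewrite uvw.
- move=> r u v uv; have [hu _] := hxi u; have [hv _] := hxi v.
  apply: is_HK_integral_unique ab hv _; apply: is_HK_integral_ext (is_HK_integralZ r hu) => t _.
  by rewrite uv.
- by have [] := hxi u.
by exists z; split=> // u; rewrite hz; have [] := hxi u.
Qed.

End Difference.

(** * Variational Henstock integrability *)

Section SupportErrors.
Context {R : realType} {X : completeNormedModType R}.
Implicit Types (A B : set X) (u : dual X).

Lemma dual0 : exists u : dual X, forall x, pairing u x = 0.
Proof. by apply: (@dual_of R X (fun=> 0) 0); split=> *; rewrite ?addr0 ?mulr0 ?normr0 ?mul0r. Qed.

Lemma hausdorff_near_attained A B (e : R) : cwk A -> cwk B -> 0 < e ->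
  exists2 u, dual_ball u & (hausdorff_dist A B <= (`|support_fun u A - support_fun u B| + e)%:E)%E.
Proof.
move=> cA cB e0; pose W := [set `|support_fun u A - support_fun u B| | u in @dual_ball R X].
have [z hz] := dual0; have bz : dual_ball z by move=> x; rewrite hz normr0.
have sW : has_sup W.
  split; first by exists `|support_fun z A - support_fun z B|, z.
  exists (snorm A + snorm B) => _ [u hu <-].
  by apply: (le_trans (ler_normB _ _)); rewrite lerD ?support_le_snorm.
have [_ [u hu <-] near_sup] := sup_adherent e0 sW; exists u => //.
apply/(hausdorff_leP cA cB) => [|v hv]; first by rewrite addr_ge0 // ltW.
have : `|support_fun v A - support_fun v B| <= sup W by apply: sup_upper_bound => //; exists v.
lra.
Qed.

End SupportErrors.

Section Primitive.
Context {R : realType} {X : completeNormedModType R}.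
Context (Gamma : R -> set X) (Phi : R -> R -> set X) (f : R -> X).
Context (Gamma_cwk : multifunction Gamma) (Gamma_bochner : bochner_measurable Gamma).
Context (PhiE : HKP_primitive Gamma Phi).
Context (Phi_null : lambda_continuous (variational_measure Phi)).
Context (f_meas : strongly_measurable f) (f_sel : selection Gamma f).
Context (z : R -> R -> X).
Context (zE : forall a b : R, 0 <= a -> a < b -> b <= 1 -> Phi a b (z a b) /\
  forall u, is_HK_integral a b (fun t => pairing u (f t)) (pairing u (z a b))).
Implicit Types (u v : dual X) (t a b e : R).
Notation G := (translate Gamma f).

(** The integral of the translate is the translate of Phi a b by the weak
    integral of the selection. *)
Definition primitive a b : set X := mink_add (Phi a b) [set - z a b].
Notation Psi := primitive.

Lemma primitive_cwk a b : 0 <= a -> a < b -> b <= 1 -> cwk (Psi a b).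
Proof. by move=> a0 ab b1; have [cP _] := PhiE a0 ab b1; apply: cwk_add cP (cwk_set1 _). Qed.

Lemma support_primitive u : HK_primitive 0 1 (fun t => support_fun u (G t))
  (fun a b => support_fun u (Psi a b)).
Proof.
move=> a b a0 ab b1; have [cP hP] := PhiE a0 ab b1; have [_ hz] := zE a0 ab b1.
rewrite (support_add u cP (cwk_set1 _)) support_set1 pairingN.
apply: is_HK_integral_ext (is_HK_integralB (hP u) (hz u)) => t ht.
by rewrite support_translate //; lra.
Qed.

Lemma primitive_additive : additive_itv Psi.
Proof.
move=> a b c a0 ab bc c1; have b0 : 0 <= b by lra.
have b1 : b <= 1 by lra.
have ac : a < c by exact: lt_trans bc.
have cab := primitive_cwk a0 ab b1; have cbc := primitive_cwk b0 bc c1.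
apply: cwk_eq (primitive_cwk a0 ac c1) (cwk_add cab cbc) _ => u _.
rewrite (support_add u cab cbc).
exact: (HK_primitive_additive (support_primitive u)).
Qed.

(** As the sets primitive a b contain the origin, additivity makes them
    increase with the interval. *)
Lemma primitive_mono a b a' b' : 0 <= a' -> a' <= a -> a < b -> b <= b' -> b' <= 1 ->
  snorm (Psi a b) <= snorm (Psi a' b').
Proof.
move=> a'0 aa ab bb b'1.
have zero x y : 0 <= x -> x < y -> y <= 1 -> Psi x y 0.
  move=> x0 xy y1; apply/mink_addP; exists (z x y), (- z x y); rewrite subrr; split=> //.
  by have [] := zE x0 xy y1.
have a0 := le_trans a'0 aa; have b1 := le_trans bb b'1.
have left_ext : Psi a b `<=` Psi a' b.
  move: aa; rewrite le_eqVlt => /predU1P[->//|aa].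
  rewrite (primitive_additive a'0 aa ab b1) => x Px; apply/mink_addP; exists 0, x.
  by rewrite add0r; split=> //; apply: zero => //; lra.
have a'b := le_lt_trans aa ab.
have right_ext : Psi a' b `<=` Psi a' b'.
  move: bb; rewrite le_eqVlt => /predU1P[->//|bb].
  rewrite (primitive_additive a'0 a'b bb b'1) => x Px; apply/mink_addP; exists x, 0.
  by rewrite addr0; split=> //; apply: zero => //; lra.
apply: snorm_sub; [exact: primitive_cwk| |exact: subset_trans right_ext].
by apply: primitive_cwk => //; exact: lt_le_trans bb.
Qed.

(** The point z a b belongs to Phi a b. *)
Lemma snorm_primitive_le a b : 0 <= a -> a < b -> b <= 1 -> snorm (Psi a b) <= 2 * snorm (Phi a b).
Proof.
move=> a0 ab b1; have [cP _] := PhiE a0 ab b1; have [Pz _] := zE a0 ab b1.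
have n0 := snorm_ge0 cP.
apply/(snorm_leP (primitive_cwk a0 ab b1)) => [|u hu]; first by rewrite mulr_ge0.
rewrite (support_add u cP (cwk_set1 _)) support_set1 pairingN.
apply: (le_trans (ler_normB _ _)); rewrite mulr2n mulrDl mul1r lerD //.
  exact: support_le_snorm.
by apply: (le_trans (hu _)); exact: norm_le_snorm.
Qed.

Lemma primitive_null (N : set R) : N `<=` `[0, 1]%classic -> lebesgue_measurable N ->
  lambda N = 0%E -> null_variation (fun (_ : unit) p => snorm (Psi (lft p) (rgt p))) N.
Proof.
move=> N01 mN N0 eta eta0; have eta2 : 0 < eta / 2 by rewrite divr_gt0.
have : (variational_measure Phi N < (eta / 2)%:E)%E by rewrite Phi_null // lte_fin.
move=> /ereal_inf_lt[_ [d gd <-] sup_lt].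
exists (fun t => if 0 <= t <= 1 then d t else 1); split=> [t|P _ iP fP NP].
  by case: ifP => // /gd.
have {}fP : fine_partition d P.
  move=> p pP; have := fP p pP; have [h1 h2 h3 h4] := iP.1 p pP.
  by rewrite ifT //; lra.
have le : (\sum_(p <- P) set_norm (Phi (lft p) (rgt p)) <= (eta / 2)%:E)%E.
  by apply: le_trans (ltW sup_lt); apply: ereal_sup_ubound; exists P.
have sumE : (\sum_(p <- P) set_norm (Phi (lft p) (rgt p)) =
    (\sum_(p <- P) snorm (Phi (lft p) (rgt p)))%:E)%E.
  rewrite -sumEFin big_seq [RHS]big_seq; apply: eq_bigr => p pP.
  have [h1 h2 h3 h4] := iP.1 p pP; rewrite /snorm fineK // set_norm_fin //.
  by have [] := PhiE h1 h2 h3.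
move: le; rewrite sumE lee_fin => le.
apply: (@le_trans _ _ (\sum_(p <- P) 2 * snorm (Phi (lft p) (rgt p)))); last first.
  by rewrite -mulr_sumr mulrC -ler_pdivlMr.
rewrite big_seq [leRHS]big_seq; apply: ler_sum => p pP.
by have [h1 h2 h3 h4] := iP.1 p pP; exact: snorm_primitive_le.
Qed.

(** Elements of the unit ball of the dual index the family of support
    functions. *)
Definition unit_ball := {u : dual X | dual_ball u}.

Notation supp := (fun (th : unit_ball) t => support_fun (sval th) (G t)).
Notation supp_primitive := (fun (th : unit_ball) a b => support_fun (sval th) (Psi a b)).

Lemma support_error_small eta : 0 < eta ->
  variation_le (henstock_error supp supp_primitive) `[0, 1]%classic eta.
Proof.
apply: (@henstock_error_small R unit_ball supp supp_primitive (fun a b => snorm (Psi a b)) (snorm \o G)).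
- by move=> th t t01; exact: support_translate_ge0.
- by move=> t t01; apply: snorm_ge0; exact: translate_cwk.
- move=> th t t01; apply: le_trans (ler_norm _) _.
  by apply: support_le_snorm; [exact: translate_cwk|exact: (svalP th)].
- by move=> th; exact: support_primitive.
- move=> th a b a0 ab b1; apply: le_trans (ler_norm _) _.
  by apply: support_le_snorm; [exact: primitive_cwk|exact: (svalP th)].
- by move=> a b a0 ab b1; apply: snorm_ge0; exact: primitive_cwk.
- exact: primitive_mono.
- exact: primitive_null.
- move=> e /(oscillation_partition Gamma_cwk Gamma_bochner f_meas)[J hJ].
  exists J => i; have [mJ _ [J0|osc]] := hJ i; split=> //; [by left|right].
  by move=> t t' th Jt Jt'; apply: osc => //; exact: (svalP th).
Qed.

(** By Hoermander's formula the Hausdorff distance on each tagged interval is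
    nearly the error of one support function, which may vary with the interval. *)
Theorem translate_variationally_henstock : variationally_henstock_integrable G.
Proof.
exists Psi; split; [exact: primitive_cwk|exact: primitive_additive|].
move=> eps eps0; have e3 : 0 < eps / 3 by rewrite divr_gt0.
have [d [d0 hd]] := support_error_small e3; exists d; split=> [t _|P oP fP]; first exact: d0.
have iP := oP.1.
have hk (p : R * R * R) : exists th : unit_ball, p \in P ->
    (hausdorff_dist (Psi (lft p) (rgt p)) (mink_scale (itv_length p) (G (tagpt p))) <=
     (henstock_error supp supp_primitive (fun=> th) p + eps / 3 * itv_length p)%:E)%E.
  have [u0 hu0] := @dual0 R X.
  have bu0 : dual_ball u0 by move=> x; rewrite hu0 normr0.
  have [pP|_] := boolP (p \in P); last by exists (exist _ u0 bu0).
  have [h1 h2 h3 h4] := iP.1 p pP.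
  have l0 : 0 < itv_length p by rewrite subr_gt0.
  have cG : cwk (G (tagpt p)) by apply: translate_cwk => //; lra.
  have [u hu le] := hausdorff_near_attained (primitive_cwk h1 h2 h3)
    (cwk_scale (itv_length p) cG) (mulr_gt0 e3 l0).
  exists (exist _ u hu) => _; move: le; rewrite (support_scale u (ltW l0) cG).
  by rewrite /henstock_error /= mulrC.
have [k {}hk] := choice hk.
apply: (@le_lt_trans _ _ (\sum_(p <- P) (henstock_error supp supp_primitive k p + eps / 3 * itv_length p)%:E)%E).
  by rewrite big_seq [leRHS]big_seq; apply: lee_sum => p pP; exact: hk.
rewrite sumEFin lte_fin big_split -mulr_sumr /=.
rewrite (perron_of_sum ltr01 (@additive_on_length R 0 1) oP) subr0 mulr1.
have le : \sum_(p <- P) henstock_error supp supp_primitive k p <= eps / 3.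
  by apply: hd => // p pP; have [h1 h2 h3 h4] := iP.1 p pP; rewrite /= in_itv /=; lra.
lra.
Qed.

End Primitive.

(** * Birkhoff integrability *)

Section Series.
Context {R : realType} {X : completeNormedModType R}.
Implicit Types (C : nat -> set X) (S : set X) (u : dual X) (s : nat -> nat).

Lemma big_mink_add C n : (forall k, cwk (C k)) ->
  cwk (\big[mink_add/[set 0]]_(k < n) C k) /\
  forall u, support_fun u (\big[mink_add/[set 0]]_(k < n) C k) =
    \sum_(k <- iota 0 n) support_fun u (C k).
Proof.
move=> cC; have -> : iota 0 n = index_iota 0 n by rewrite /index_iota subn0.
suff [c h] : cwk (\big[mink_add/[set 0]]_(k < n) C k) /\ forall u,
    support_fun u (\big[mink_add/[set 0]]_(k < n) C k) = \sum_(k < n) support_fun u (C k).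
  by split=> // u; rewrite h big_mkord.
elim: n C cC => [|n IH] C cC.
  rewrite big_ord0; split=> [|u]; first exact: cwk_set1.
  by rewrite big_ord0 support_set1 pairing0.
have [cn hn] := IH (fun k => C k.+1) (fun k => cC k.+1).
rewrite big_ord_recl; split=> [|u]; first exact: cwk_add.
by rewrite big_ord_recl (support_add u (cC 0%N) cn) hn.
Qed.

(** The blocks contain the origin, so that partial sums increase; the tail
    condition makes all reorderings Cauchy. *)
Definition summable C := [/\ forall k, cwk (C k), forall k, C k 0 &
  forall e : R, 0 < e -> exists N : nat, forall r : seq nat, uniq r ->
    (forall k, k \in r -> (N <= k)%N) -> forall u, dual_ball u ->
    \sum_(k <- r) support_fun u (C k) <= e].

Lemma summable_series C : summable C -> exists S, hausdorff_series C S.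
Proof.
move=> [cC C0 tail]; pose P n := \big[mink_add/[set 0]]_(k < n) C k.
have cP n : cwk (P n) by have [] := big_mink_add n cC.
have sP n u : support_fun u (P n) = \sum_(k <- iota 0 n) support_fun u (C k).
  by have [_] := big_mink_add n cC.
have s0 k u : 0 <= support_fun u (C k).
  by have [_ _ kC] := cC k; rewrite -[leLHS](pairing0 u); exact: support_ge.
have [n|e e0|S [cS PS near]] := @cwk_limit R X P cP.
- apply: cwk_near => // u _; rewrite !sP -[in leRHS]addn1 iotaD big_cat /=.
  by rewrite lerDl big_seq1.
- have [N hN] := tail e e0; exists N => n u Nn hu.
  rewrite !sP -(subnKC Nn) iotaD big_cat lerD2l; apply: hN => //; first exact: iota_uniq.
  by move=> k; rewrite mem_iota add0n => /andP[].
exists S; split=> //; apply/(hausdorff_cvgP cP cS) => e e0.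
have [N hN] := near e e0; exists N => n u Nn hu.
have [S0 _ kS] := cS; have [P0 _ kP] := cP n.
have le : support_fun u (P n) <= support_fun u S.
  by apply: support_le => // x Px; apply: support_ge => //; exact: PS Px.
have := hN n u Nn hu; rewrite ler_norml; lra.
Qed.

Lemma summable_reorder C s : bijective s -> summable C -> summable (fun k => C (s k)).
Proof.
move=> [s' sK s'K] [cC C0 tail]; split=> [k|k|e e0]; [exact: cC|exact: C0|].
have [N hN] := tail e e0; exists (\max_(i < N) s' i).+1 => r ur hr u hu.
rewrite -(big_map s xpredT (fun k => support_fun u (C k))); apply: hN => //.
  by rewrite map_inj_uniq //; exact: can_inj sK.
move=> _ /mapP[k kr ->]; rewrite leqNgt; apply/negP => lt.
have := hr k kr; rewrite ltnNge => /negP; apply.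
by rewrite -[X in (X <= _)%N]sK; exact: (leq_bigmax (Ordinal lt)).
Qed.

Lemma summable_unconditional C : summable C -> unconditionally_convergent C.
Proof. by move=> sC s bs; apply: summable_series; exact: summable_reorder. Qed.

End Series.

Section Birkhoff.
Context {R : realType} {X : completeNormedModType R}.
Context (Gamma : R -> set X) (Phi : R -> R -> set X) (f : R -> X).
Context (Gamma_cwk : multifunction Gamma) (Gamma_bochner : bochner_measurable Gamma).
Context (PhiE : HKP_primitive Gamma Phi).
Context (Phi_null : lambda_continuous (variational_measure Phi)).
Context (f_meas : strongly_measurable f) (f_sel : selection Gamma f).
Context (z : R -> R -> X).
Context (zE : forall a b : R, 0 <= a -> a < b -> b <= 1 -> Phi a b (z a b) /\
  forall u, is_HK_integral a b (fun t => pairing u (f t)) (pairing u (z a b))).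
Implicit Types (u v : dual X) (t a b e : R).
Notation G := (translate Gamma f).
Notation Psi := (primitive Phi z).
Notation supp := (fun (th : @unit_ball R X) t => support_fun (sval th) (G t)).
Notation supp_primitive := (fun (th : @unit_ball R X) a b => support_fun (sval th) (Psi a b)).

Lemma integral_le_riemann eta : 0 < eta -> exists d : R -> R, (forall t, 0 < d t) /\
  forall P (th : @unit_ball R X), perron_of 0 1 P -> fine_partition d P ->
    supp_primitive th 0 1 <= \sum_(p <- P) supp th (tagpt p) * itv_length p + eta.
Proof.
move=> /(support_error_small Gamma_cwk Gamma_bochner PhiE Phi_null f_meas f_sel zE)[d [d0 hd]].
exists d; split=> // P th oP fP; have iP := oP.1.
have PsiE := HK_primitive_additive (support_primitive Gamma_cwk PhiE zE (sval th)).
rewrite -(perron_of_sum ltr01 PsiE oP) -lerBlDl -sumrB.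
apply: le_trans (hd P (fun=> th) iP fP _); last first.
  by move=> p pP; have [h1 h2 h3 h4] := iP.1 p pP; rewrite /= in_itv /=; lra.
by apply: ler_sum => p _; exact: ler_norm.
Qed.

Lemma good_partition e : 0 < e -> exists J : R -> nat, good_index supp J e.
Proof.
move=> /(oscillation_partition Gamma_cwk Gamma_bochner f_meas)[J hJ].
exists J => i; have [mJ [B B0 hB] osc] := hJ i; split=> //.
  exists B => // th t Jt; apply: le_trans (ler_norm _) _; apply: le_trans (hB t Jt).
  by apply: support_le_snorm; [exact: translate_cwk Jt.1|exact: (svalP th)].
move=> ne th t t' Jt Jt'; case: osc => [J0|]; last by apply=> //; exact: (svalP th).
by move: ne; rewrite J0 eqxx.
Qed.

(** On a partition finer than one with small oscillation, the sums of the support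
    functions differ little from their integrals, and uniform integrability makes
    the tails small, both uniformly over the dual ball. *)
Theorem translate_birkhoff : birkhoff_integrable G.
Proof.
have cW : cwk (Psi 0 1) by exact: (primitive_cwk PhiE z (lexx 0) ltr01 (lexx 1)).
have suppI (th : @unit_ball R X) : is_HK_integral 0 1 (supp th) (supp_primitive th 0 1).
  exact: (support_primitive Gamma_cwk PhiE zE (sval th) (lexx 0) ltr01 (lexx 1)).
have supp0 (th : @unit_ball R X) t : 0 <= t <= 1 -> 0 <= supp th t.
  by move=> t01; exact: support_translate_ge0.
exists (Psi 0 1); split=> // eps eps0.
have [e e0 e_small] : exists2 e : R, 0 < e & e + e + e < eps.
  by exists (eps / 4); [rewrite divr_gt0|lra].
have [J gJ] := good_partition e0.
exists (fiber 0 1 J); split.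
  split=> [n|m n _ _ [t [[_ <-] [_ ->]]]//|]; first by have [] := gJ n.
  apply/seteqP; split=> [t [n _ [h _]]|t]; first by rewrite /= in_itv.
  by rewrite /= in_itv /= => h; exists (J t).
move=> A tp [mA trivA covA] finA tpA.
have A01 n : A n `<=` `[0, 1]%classic by rewrite -covA; exact: bigcup_sup.
have hJA t : exists n, 0 <= t <= 1 -> A n t.
  have [t01|] := boolP (0 <= t <= 1); last by exists 0%N.
  have : `[0, 1]%classic t by rewrite /= in_itv.
  by rewrite -covA => -[n _ An]; exists n.
have [JA {}hJA] := choice hJA.
have fibA n : fiber 0 1 JA n = A n.
  apply/seteqP; split=> t; first by move=> [t01 <-]; exact: hJA.
  move=> An; have : `[0, 1]%classic t by exact: A01 An.
  rewrite /= in_itv /= => t01; split=> //; apply: trivA => //.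
  by exists t; split=> //; exact: hJA.
have gJA : good_index supp JA e.
  move=> n; rewrite fibA; have [m Anm] := finA n; have [mJ [B B0 hB] osc] := gJ m.
  split; first exact: mA.
    by exists B => // th t /Anm; exact: hB.
  move=> ne th t t' /Anm Jt /Anm Jt'; apply: osc => //.
  rewrite gt_eqF //; have : 0 < fine (lambda (A n)) by rewrite lt_neqAle eq_sym ne mes_ge0.
  move/lt_le_trans; apply; apply: (@mes_le R 0 1) => //; exact: fiber_sub.
have tp01 n : 0 <= tp n <= 1 by have [] := tpA n.
have tpJ n : fiber 0 1 JA n !=set0 -> fiber 0 1 JA n (tp n).
  by rewrite fibA; have [] := tpA n.
have cG n : cwk (G (tp n)) by exact: translate_cwk.
move=> C; have cC n : cwk (C n) by exact: cwk_scale.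
have sC n u : support_fun u (C n) = fine (lambda (fiber 0 1 JA n)) * support_fun u (G (tp n)).
  by rewrite support_scale ?mes_ge0 // fibA.
have summC : summable C.
  split=> [//|n|eta eta0].
    by exists 0; [exact: translate0|rewrite scaler0].
  have [N hN] := sum_points_tail supp0 suppI integral_le_riemann good_partition gJA (ltW e0) tpJ eta0.
  exists N => r ur rN u hu; under eq_bigr do rewrite sC.
  exact: (hN r ur rN (exist _ u hu)).
split; first exact: summable_unconditional.
have [S SS] := summable_series summC; exists S; split=> //.
have [cS /(hausdorff_cvgP (fun n => (big_mink_add n cC).1) cS) limS] := SS.
have e2 : 0 <= e + e + e by rewrite !addr_ge0 // ltW.
apply: (@le_lt_trans _ _ (e + e + e)%:E); last by rewrite lte_fin.
apply/(hausdorff_leP cW cS e2) => u hu.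
have [N1 hN1] := limS e e0.
have [N2 hN2] := integral_le_sum_points supp0 integral_le_riemann gJA (ltW e0) tp01 tpJ e0.
pose n := maxn N1 N2.
have up := sum_le_integral supp0 suppI gJA (ltW e0) tpJ (exist _ u hu) (iota_uniq 0 n).
have low := hN2 (exist _ u hu).
have mono : \sum_(i <- iota 0 N2) fine (lambda (fiber 0 1 JA i)) * supp (exist _ u hu) (tp i) <=
    \sum_(i <- iota 0 n) fine (lambda (fiber 0 1 JA i)) * supp (exist _ u hu) (tp i).
  rewrite -(subnKC (leq_maxr N1 N2 : N2 <= n)%N) iotaD big_cat lerDl sumr_ge0 // => i _.
  by rewrite mulr_ge0 ?mes_ge0 ?supp0.
have := hN1 n u (leq_maxl _ _) hu; rewrite (big_mink_add n cC).2.
under eq_bigr do rewrite sC.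
move: up low mono; rewrite /= !ler_norml; lra.
Qed.

End Birkhoff.

Theorem theorem3p4 (R : realType) (X : completeNormedModType R)
    (Gamma : R -> set X) (Phi : R -> R -> set X) :
  multifunction Gamma ->
  bochner_measurable Gamma ->
  HKP_integrable Gamma ->
  HKP_primitive Gamma Phi ->
  lambda_continuous (variational_measure Phi) ->
  (exists f : R -> X, strongly_measurable f /\ selection Gamma f) /\
  (forall f : R -> X, strongly_measurable f -> selection Gamma f ->
     exists G : R -> set X,
       [/\ multifunction G,
           variationally_henstock_integrable G,
           birkhoff_integrable G &
           forall t : R, 0 <= t <= 1 -> Gamma t = mink_add (G t) [set f t]]).
Proof.
move=> Gamma_cwk Gamma_bochner _ PhiE Phi_null; split; first exact: measurable_selection.
move=> f f_meas f_sel.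
have hz (p : R * R) : exists x, 0 <= p.1 -> p.1 < p.2 -> p.2 <= 1 -> Phi p.1 p.2 x /\
    forall u, is_HK_integral p.1 p.2 (fun t => pairing u (f t)) (pairing u x).
  have [[p0 [p12 p1]]|no] := pselect (0 <= p.1 /\ p.1 < p.2 /\ p.2 <= 1); last first.
    by exists 0 => p0 p12 p1; exfalso; apply: no.
  have [x hx] := selection_integral Gamma_cwk Gamma_bochner PhiE f_meas f_sel p0 p12 p1.
  by exists x.
have [z {}hz] := choice hz.
have zE a b (a0 : 0 <= a) (ab : a < b) (b1 : b <= 1) := hz (a, b) a0 ab b1.
exists (translate Gamma f); split.
- exact: translate_cwk.
- exact: (translate_variationally_henstock Gamma_cwk Gamma_bochner PhiE Phi_null f_meas f_sel zE).
- exact: (translate_birkhoff Gamma_cwk Gamma_bochner PhiE Phi_null f_meas f_sel zE).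
- by move=> t _; exact: translateK.
Qed.
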